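(* Let $1\le p_1,p_2,p_3\le\infty$. For a trilinear form $\Lambda$ on $\mathcal{S}(\mathbb{R})\times\mathcal{S}(\mathbb{R}^2)\times\mathcal{S}(\mathbb{R}^2)$ consider the a priori inequality $$|\Lambda(f,G,H)|\le C\,\|f\|_{L^{p_1}(\mathbb{R})}\|G\|_{L^{p_2}(\mathbb{R}^2)}\|H\|_{L^{p_3}(\mathbb{R}^2)}\qquad\text{for all } f\in\mathcal{S}(\mathbb{R}),\ G,H\in\mathcal{S}(\mathbb{R}^2).\quad( * )$$ (i) Let $\Lambda$ be any one of the three forms $\Lambda_{(1)}$, $\Lambda_{(2)}$, $\Lambda_{(4,1)}$. If $p_1=\infty$, $\frac1{p_2}+\frac1{p_3}=1$ and $1<p_2,p_3<\infty$, then there exists a constant $C$ such that $( * )$ holds. If $(p_1,p_2,p_3)$ does not satisfy all of these conditions, then there is no constant $C$ such that $( * )$ holds. (ii) Let $\Lambda$ be either of the two forms $\Lambda_{(3)}$, $\Lambda_{(4,0)}$. Then for any $1\le p_1,p_2,p_3\le\infty$ there is no constant $C$ such that $( * )$ holds.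
   Context: $\mathcal{S}(\mathbb{R}^n)$ denotes the Schwartz space. For $f\in\mathcal{S}(\mathbb{R})$, $G,H\in\mathcal{S}(\mathbb{R}^2)$ define $$\Lambda_{(1)}(f,G,H):=\operatorname{p.v.}\int_{\mathbb{R}^3}f(x)G(x,y)H(x,y+t)\frac1t\,dt\,dx\,dy,$$ $$\Lambda_{(2)}(f,G,H):=\operatorname{p.v.}\int_{\mathbb{R}^3}f(x)G(x,y)H(x+t,y)\frac1t\,dt\,dx\,dy,$$ $$\Lambda_{(3)}(f,G,H):=\operatorname{p.v.}\int_{\mathbb{R}^3}f(x+t)G(x,y)H(x,y+t)\frac1t\,dt\,dx\,dy,$$ and, for $\beta\in\mathbb{R}$, $$\Lambda_{(4,\beta)}(f,G,H):=\operatorname{p.v.}\int_{\mathbb{R}^3}f(x+t)G(x,y)H(x+\beta t,y)\frac1t\,dt\,dx\,dy,$$ so that $\Lambda_{(4,1)}$ and $\Lambda_{(4,0)}$ are the cases $\beta=1$ and $\beta=0$. In each case the principal value is the limit as $\varepsilon\to0^+$ of the integral restricted to $\varepsilon\le|t|\le\varepsilon^{-1}$. *)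

(* Defs.v *)
From HB Require Import structures.
From mathcomp Require Import all_boot all_order all_algebra.
From mathcomp Require Import complex.
From mathcomp Require Import all_classical all_reals all_analysis.

Set Implicit Arguments.
Unset Strict Implicit.
Unset Printing Implicit Defensive.

Import Order.TTheory GRing.Theory Num.Theory.
Import numFieldNormedType.Exports.

Local Open Scope classical_set_scope.
Local Open Scope ring_scope.
Local Open Scope complex_scope.

Section Schwartz.
Context {R : realType}.

Definition schwartz1_real (u : R -> R) : Prop :=
  (forall n x, derivable (derive1n n u) x 1) /\
  (forall k n, exists M : R, forall x, `|x ^+ k * derive1n n u x| <= M).

Definition coord_dir (b : bool) : R * R := if b then (0, 1) else (1, 0).

(* [:: b1; b2; ...] stands for the operator d_b1 d_b2 ..., where d_false and
   d_true are the partial derivatives in the first and second variable. *)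
Definition iter_partial (s : seq bool) (u : R * R -> R) : R * R -> R :=
  foldr (fun b w => 'D_(coord_dir b) w) u s.

Definition smooth2 (u : R * R -> R) : Prop :=
  forall s, continuous (iter_partial s u) /\
    (forall b z, derivable (iter_partial s u) z (coord_dir b)).

Definition schwartz2_real (u : R * R -> R) : Prop :=
  smooth2 u /\
  (forall k l s, exists M : R, forall z : R * R,
     `|z.1 ^+ k * z.2 ^+ l * iter_partial s u z| <= M).

(* Differentiation and decay of a complex-valued function on a real space are
   read off its real and imaginary parts. *)
Definition schwartz1 (f : R -> R[i]) : Prop :=
  schwartz1_real (fun x => complex.Re (f x)) /\
  schwartz1_real (fun x => complex.Im (f x)).

Definition schwartz2 (F : R * R -> R[i]) : Prop :=
  schwartz2_real (fun z => complex.Re (F z)) /\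
  schwartz2_real (fun z => complex.Im (F z)).

End Schwartz.

Section Integration.
Context {R : realType}.

Definition lebesgue2 := (@lebesgue_measure R \x @lebesgue_measure R)%E.

Definition lebesgue3 := (lebesgue2 \x @lebesgue_measure R)%E.

Definition cintegral d (T : measurableType d)
    (mu : {measure set T -> \bar R}) (D : set T) (f : T -> R[i]) : R[i] :=
  (\int[mu]_(x in D) complex.Re (f x)) +i* (\int[mu]_(x in D) complex.Im (f x)).

(* [Normc.normc] is the R-valued modulus; [`|_|] on R[i] is R[i]-valued. *)
Definition cLnorm d (T : measurableType d)
    (mu : {measure set T -> \bar R}) (p : \bar R) (f : T -> R[i]) : \bar R :=
  ('N[mu]_p[(fun x => (Normc.normc (f x))%:E)])%E.

Definition truncated_integral (K : R -> R -> R -> R[i]) (eps : R) : R[i] :=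
  cintegral lebesgue3 [set q : R * R * R | eps <= `|q.2| <= eps^-1]
    (fun q => K q.1.1 q.1.2 q.2 * (q.2^-1)%:C).

(* For the Schwartz data below both limits exist, so the default value of the
   total operator [lim] is never used. *)
Definition pv_integral (K : R -> R -> R -> R[i]) : R[i] :=
  lim (complex.Re (truncated_integral K eps) @[eps --> 0^'+]) +i*
  lim (complex.Im (truncated_integral K eps) @[eps --> 0^'+]).

End Integration.

Section Forms.
Context {R : realType}.

Definition trilinear_form :=
  (R -> R[i]) -> (R * R -> R[i]) -> (R * R -> R[i]) -> R[i].

Definition Lambda1 : trilinear_form := fun f G H =>
  pv_integral (fun x y t => f x * G (x, y) * H (x, y + t)).

Definition Lambda2 : trilinear_form := fun f G H =>
  pv_integral (fun x y t => f x * G (x, y) * H (x + t, y)).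

Definition Lambda3 : trilinear_form := fun f G H =>
  pv_integral (fun x y t => f (x + t) * G (x, y) * H (x, y + t)).

Definition Lambda4 (beta : R) : trilinear_form := fun f G H =>
  pv_integral (fun x y t => f (x + t) * G (x, y) * H (x + beta * t, y)).

Definition bounded_with (p1 p2 p3 : \bar R) (C : R) (L : trilinear_form) : Prop :=
  forall f G H, schwartz1 f -> schwartz2 G -> schwartz2 H ->
    ((Normc.normc (L f G H))%:E <=
      C%:E * (cLnorm lebesgue_measure p1 f * cLnorm lebesgue2 p2 G *
              cLnorm lebesgue2 p3 H))%E.

End Forms.
Arguments trilinear_form : clear implicits.

(* Main.v *)
Require Import Defs.
From HB Require Import structures.
From mathcomp Require Import all_boot all_order all_algebra complex.
From mathcomp Require Import all_classical all_reals all_analysis.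
From mathcomp Require Import measurable_realfun.
From mathcomp Require Import ring lra.
Set Implicit Arguments.
Unset Strict Implicit.
Unset Printing Implicit Defensive.
Import Order.TTheory GRing.Theory Num.Theory.
Import numFieldNormedType.Exports.
Local Open Scope classical_set_scope.
Local Open Scope ring_scope.

(** The first three forms are bounded because each is a Hilbert transform in a single
    variable. In [Lambda1] and [Lambda2] the factor [f] is not translated, so the form
    is the pairing of [fG] with the Hilbert transform of [H] in the second or the first
    variable. In [Lambda4 1] the factors [f] and [H] are translated by the same amount,
    and the form pairs [G] with the transform of [fH]. With [f] bounded, the inequality
    of Hölder and the boundedness of the Hilbert transform on L^p of the line for 1 < p
    < oo are all that is needed.

    Boundedness on L^p is proved by a method of Stein, with uniform constants for the
    truncations. For [h >= 0] let [U] and [V] be the Poisson integral of [h] and its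
    conjugate. For 1 < p <= 2 the function W = p/(p-1) U^p - (U^2+V^2)^(p/2) is
    subharmonic ([bellman_laplacian_ge0]). Green's formula on large boxes
    ([stein_rectangle]) shows that the integral of W over a horizontal line is
    nonnegative, which bounds the norm of [V] by that of [U] ([stein_conv]). The norm of
    [U] is at most that of [h] up to a constant, by convexity ([young_pker]). The
    truncated kernel is a difference of two conjugate Poisson kernels up to an error
    bounded by Poisson kernels ([hker_qker_le]), so the bound passes to truncations.
    Exponents above 2 follow by skew-adjointness ([trunc_hilbert_skew]), and two
    variables by Tonelli's theorem ([trunc_hilbert2_Lp]).

    For the converse, all forms are evaluated on products of Gaussians in which one
    factor is replaced by a sum of functions w x exp(-B x^2). This odd factor cancels
    the singularity and the principal value becomes an explicit sum
    ([pv_integral_tensor], [odd_value]). With a single odd term and Gaussians at scale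
    1/p in the first and 1/q in the second variable, the norms are powers of p and q,
    and letting p or q vary forces 1/p1 = 0 and 1/p2 + 1/p3 = 1 ([scaling_exponents]).
    The cases that remain are excluded by the logarithmic divergence of the Hilbert
    transform at the endpoints. The lacunary sum of the functions 2^k x exp(-4^k x^2), k
    < n, is bounded uniformly in n ([odd_sum_dyadic_le]), but against a Gaussian at
    scale 2^(-n) with integral of order 1 every term contributes an amount bounded
    below, so that the pairing grows linearly in n. For the first three forms the
    lacunary sum is placed in the factor of exponent oo and the concentrated Gaussian in
    the factor of exponent 1, which excludes (p2, p3) = (1, oo) and (oo, 1)
    ([endpoint_unbounded]). In [Lambda3] and [Lambda4 0] the product of [G] and [H] is
    not translated in the first variable while [f] is, so that [f], of exponent oo, can
    be the lacunary sum and [GH] the Gaussian of exponent 1, whatever p2 and p3 are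
    ([logarithmic_unbounded]). *)

(** * A subharmonic function of two conjugate harmonic functions *)

Section bellman.
Context {R : realType}.
Variable p : R.
Hypotheses (p1 : 1 < p) (p2 : p <= 2).

(** For [u > 0] and [v] conjugate harmonic functions and [1 < p <= 2] this is
    subharmonic. When [u] and [v] decay, its integral over horizontal lines is then
    nonnegative, which bounds the p-th power of [v] by that of [u]. *)
Definition bellman (u v : R) : R :=
  p / (p - 1) * u `^ p - (u ^+ 2 + v ^+ 2) `^ (p / 2).

(** The derivative of [bellman] along a curve with [u' = a] and [v' = b]. Powers are
    kept at the exponents [p] and [p / 2], with all other factors as quotients, so that
    every expression is rational in these powers and in the other data. *)
Definition bellman1 (u v a b : R) : R :=
  p / (p - 1) * p * (u `^ p * (a / u))
  - p * ((u ^+ 2 + v ^+ 2) `^ (p / 2) * ((u * a + v * b) / (u ^+ 2 + v ^+ 2))).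

(** The second derivative along the same curve, with [u'' = c] and [v'' = d]. *)
Definition bellman2 (u v a b c d : R) : R :=
  p / (p - 1) * p * (u `^ p * ((p - 1) * (a / u) ^+ 2 + c / u))
  - p * ((u ^+ 2 + v ^+ 2) `^ (p / 2) *
    ((p - 2) * ((u * a + v * b) / (u ^+ 2 + v ^+ 2)) ^+ 2
     + (a ^+ 2 + b ^+ 2 + u * c + v * d) / (u ^+ 2 + v ^+ 2))).

Lemma is_derive_powR (f : R -> R) (x df q : R) : 0 < f x ->
  is_derive x 1 f df ->
  is_derive x 1 (fun z => f z `^ q) (q * (f x `^ q) * (df / f x)).
Proof.
move=> f0 fd.
have fxI : f x \in `]0, +oo[ by rewrite in_itv/= f0.
have h : is_derive (f x) 1 (fun z : R => z `^ q) (q * f x `^ (q - 1)).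
  apply: DeriveDef; first exact: derivable_powR.
  by rewrite -derive1E powR_derive1.
have := is_derive1_comp h fd.
have -> : f x `^ (q - 1) = f x `^ q / f x.
  by rewrite powRB ?(gt_eqF f0) ?implybT// (powRr1 (ltW f0)).
suff -> : q * (f x `^ q / f x) * df = q * (f x `^ q) * (df / f x) by [].
by rewrite !mulrA -!(mulrAC _ _ df).
Qed.

Lemma sumsq_gt0 (u v : R) : 0 < u -> 0 < u ^+ 2 + v ^+ 2.
Proof. by move=> u0; rewrite ltr_pwDl ?exprn_gt0// sqr_ge0. Qed.

Variables (u v a b : R -> R) (z c d : R).
Hypothesis u0 : 0 < u z.
Hypothesis ud : is_derive z 1 u (a z).
Hypothesis vd : is_derive z 1 v (b z).

Let is_derive_sumsq : is_derive z 1 (fun z => u z ^+ 2 + v z ^+ 2)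
  (2 * (u z * a z + v z * b z)).
Proof.
have h : is_derive z 1 (u ^+ 2 + v ^+ 2)
  ((2 * u z ^+ 1) *: a z + (2 * v z ^+ 1) *: b z).
  apply: (is_derive_eq (is_deriveD (is_deriveX (f := u) 2 ud) (is_deriveX (f := v) 2 vd))).
  by rewrite /GRing.scale /= !expr1 ?mulr_natl.
have e : u ^+ 2 + v ^+ 2 = (fun z => u z ^+ 2 + v z ^+ 2) by apply/funext.
rewrite e in h; apply: (is_derive_eq h).
by rewrite /GRing.scale /= !expr1; ring.
Qed.

Lemma is_derive_bellman :
  is_derive z 1 (fun z => bellman (u z) (v z)) (bellman1 (u z) (v z) (a z) (b z)).
Proof.
have S0 := sumsq_gt0 (v z) u0.
have h1 := @is_derive_powR u z _ p u0 ud.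
have h2 := @is_derive_powR (fun z => u z ^+ 2 + v z ^+ 2) z _ (p / 2) S0 is_derive_sumsq.
have h3 := is_deriveZ (p / (p - 1)) h1.
apply: (is_derive_eq (is_deriveB h3 h2)).
rewrite /bellman1 /GRing.scale /=; set X := u z `^ p; set Y := (_ `^ (p / 2)).
have p10 : p - 1 != 0 by rewrite subr_eq0 gt_eqF.
have S1 : u z ^+ 2 + v z ^+ 2 != 0 by rewrite gt_eqF.
have u1 : u z != 0 by rewrite gt_eqF.
by field; rewrite S1 u1 p10.
Qed.

Hypothesis ad : is_derive z 1 a c.
Hypothesis bd : is_derive z 1 b d.

Lemma is_derive_bellman1 :
  is_derive z 1 (fun z => bellman1 (u z) (v z) (a z) (b z))
    (bellman2 (u z) (v z) (a z) (b z) c d).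
Proof.
have S0 := sumsq_gt0 (v z) u0.
have p10 : p - 1 != 0 by rewrite subr_eq0 gt_eqF.
have S1 : u z ^+ 2 + v z ^+ 2 != 0 by rewrite gt_eqF.
have u1 : u z != 0 by rewrite gt_eqF.
have h1 := @is_derive_powR u z _ p u0 ud.
have h2 := @is_derive_powR (fun z => u z ^+ 2 + v z ^+ 2) z _ (p / 2) S0 is_derive_sumsq.
have iu := is_deriveV (x := z) u1 ud.
have iS := is_deriveV (f := fun z => u z ^+ 2 + v z ^+ 2) (x := z) S1 is_derive_sumsq.
have k1 := is_deriveZ (p / (p - 1) * p) (is_deriveM h1 (is_deriveM ad iu)).
have k2 := is_deriveZ p (is_deriveM h2 (is_deriveM
   (is_deriveD (is_deriveM ud ad) (is_deriveM vd bd)) iS)).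
have k := is_deriveB k1 k2.
apply: (is_derive_eq k).
rewrite /bellman2 /GRing.scale /=; set X := u z `^ p; set Y := (_ `^ (p / 2)).
rewrite !fctE.
by field; rewrite S1 u1 p10.
Qed.
End bellman.

Section bellman_bounds.
Context {R : realType}.
Variable p : R.
Hypotheses (p1 : 1 < p) (p2 : p <= 2).

Lemma powR_le_sumsq (u v : R) : 0 < u -> u `^ p <= (u ^+ 2 + v ^+ 2) `^ (p / 2).
Proof.
move=> u0; have p0 : 0 < p by apply: lt_trans p1.
have -> : u `^ p = (u ^+ 2) `^ (p / 2).
  by rewrite -powR_mulrn ?(ltW u0)// -powRrM mulrCA divff ?mulr1// pnatr_eq0.
apply: ge0_ler_powR; rewrite ?nnegrE ?addr_ge0 ?sqr_ge0 ?divr_ge0 ?(ltW p0)//.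
by rewrite lerDl sqr_ge0.
Qed.

(** A conjugate pair has [u_x = v_y = a], [v_x = - u_y = b], [u_xx = - u_yy = c] and
    [v_xx = - v_yy = d]. In the Laplacian the terms in [c] and [d] cancel, and what
    remains is [p ^+ 2 * (a ^+ 2 + b ^+ 2)] times [(u ^+ 2) `^ (p / 2 - 1) - (u ^+ 2 + v
    ^+ 2) `^ (p / 2 - 1)], which is nonnegative because the exponent [p / 2 - 1] is at
    most [0]. *)
Lemma bellman_laplacian_ge0 (u v a b c d : R) : 0 < u ->
  0 <= bellman2 p u v a b c d + bellman2 p u v (- b) a (- c) (- d).
Proof.
move=> u0; have S0 := sumsq_gt0 v u0.
have p10 : p - 1 != 0 by rewrite subr_eq0 gt_eqF.
have S1 : u ^+ 2 + v ^+ 2 != 0 by rewrite gt_eqF.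
have u1 : u != 0 by rewrite gt_eqF.
set X := u `^ p; set Y := (u ^+ 2 + v ^+ 2) `^ (p / 2).
suff h : Y / (u ^+ 2 + v ^+ 2) <= X / u ^+ 2.
  rewrite (_ : _ + _ = p ^+ 2 * (a ^+ 2 + b ^+ 2) * (X / u ^+ 2 - Y / (u ^+ 2 + v ^+ 2))).
    by apply: mulr_ge0; [apply: mulr_ge0; rewrite ?addr_ge0 ?sqr_ge0|rewrite subr_ge0].
  rewrite /bellman2 -/X -/Y.
  by field; rewrite S1 u1 p10.
have -> : X / u ^+ 2 = (u ^+ 2) `^ (p / 2 - 1).
  have u2 : u ^+ 2 != 0 by rewrite expf_neq0.
  rewrite powRB ?u2 ?implybT// (powRr1 (sqr_ge0 u)); congr (_ / _).
  by rewrite -powR_mulrn ?(ltW u0)// -powRrM mulrCA divff ?mulr1// pnatr_eq0.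
have -> : Y / (u ^+ 2 + v ^+ 2) = (u ^+ 2 + v ^+ 2) `^ (p / 2 - 1).
  by rewrite powRB ?S1 ?implybT// (powRr1 (ltW S0)).
have -> : p / 2 - 1 = - (1 - p / 2) by rewrite opprB.
rewrite !powRN lef_pV2 ?posrE ?powR_gt0 ?exprn_gt0//.
apply: ge0_ler_powR; rewrite ?nnegrE ?(ltW S0) ?sqr_ge0// ?lerDl ?sqr_ge0//.
by rewrite subr_ge0 ler_pdivrMr// mul1r.
Qed.

Lemma bellman_le (u v : R) : 0 < u ->
  `|bellman p u v| <= (p / (p - 1) + 1) * (u ^+ 2 + v ^+ 2) `^ (p / 2).
Proof.
move=> u0; have l0 : 0 < p / (p - 1) by rewrite divr_gt0 ?subr_gt0// (lt_trans _ p1).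
rewrite /bellman (le_trans (ler_normB _ _))// mulrDl mul1r lerD//.
  by rewrite normrM (gtr0_norm l0) ger0_norm ?powR_ge0// ler_wpM2l ?powR_le_sumsq// (ltW l0).
by rewrite ger0_norm// powR_ge0.
Qed.

(** By the inequality of Harnack, a positive harmonic function [u] in the upper
    half-plane has first derivatives of size at most [u / y] at height [y]; hence the
    hypotheses. *)
Lemma bellman1_le (u v a b y : R) : 0 < u -> 0 < y ->
  `|a| <= u / y -> `|b| <= u / y ->
  `|bellman1 p u v a b| <=
    (p / (p - 1) * p + 2 * p) * ((u ^+ 2 + v ^+ 2) `^ (p / 2) / y).
Proof.
move=> u0 y0 ha hb; have S0 := sumsq_gt0 v u0.
have p0 : 0 < p by rewrite (lt_trans _ p1).
have l0 : 0 < p / (p - 1) by rewrite divr_gt0 ?subr_gt0.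
set Y := (_ `^ _); have Y0 : 0 <= Y by rewrite powR_ge0.
rewrite /bellman1 (le_trans (ler_normB _ _))// [leRHS]mulrDl lerD//.
  rewrite normrM (gtr0_norm (mulr_gt0 l0 p0)) ler_wpM2l ?(ltW (mulr_gt0 l0 p0))// normrM.
  apply: ler_pM => //; first by rewrite ger0_norm ?powR_ge0// powR_le_sumsq.
  by rewrite normrM normfV (gtr0_norm u0) ler_pdivrMr// mulrC.
rewrite normrM (gtr0_norm p0) -/Y [leRHS](_ : _ = p * (Y * (2 / y))); last by ring.
rewrite ler_wpM2l ?(ltW p0)// normrM (ger0_norm Y0) ler_wpM2l//.
rewrite normrM normfV (gtr0_norm S0) ler_pdivrMr// (le_trans (ler_normD _ _))//.
rewrite !normrM (gtr0_norm u0).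
apply: (@le_trans _ _ ((u + `|v|) * (u / y))).
  by rewrite mulrDl lerD// ?ler_wpM2l// ltW.
rewrite [leLHS](_ : _ = (u + `|v|) * u / y); last by ring.
rewrite [leRHS](_ : _ = (2 * (u ^+ 2 + `|v| ^+ 2)) / y); last by rewrite real_normK ?num_real//; ring.
by apply: ler_wpM2r; [rewrite invr_ge0 ltW|have := sqr_ge0 (u - `|v|); nra].
Qed.

Lemma bellman2_le (u v a b c d y : R) : 0 < u -> 0 < y ->
  `|a| <= u / y -> `|b| <= u / y -> `|c| <= 2 * u / y ^+ 2 -> `|d| <= 2 * u / y ^+ 2 ->
  `|bellman2 p u v a b c d| <=
    (p / (p - 1) * p * 3 + p * 10) * ((u ^+ 2 + v ^+ 2) `^ (p / 2) / y ^+ 2).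
Proof.
move=> u0 y0 ha hb hc hd; move: (p1) (p2) => p1' p2'; have S0 := sumsq_gt0 v u0.
have p0 : 0 < p by rewrite (lt_trans _ p1).
have l0 : 0 < p / (p - 1) by rewrite divr_gt0 ?subr_gt0.
set Y := (_ `^ _); have Y0 : 0 <= Y by rewrite powR_ge0.
have y20 : 0 < y ^+ 2 by rewrite exprn_gt0.
have hau : `|a / u| <= y^-1 by rewrite normrM normfV (gtr0_norm u0) ler_pdivrMr// mulrC.
have hcu : `|c / u| <= 2 / y ^+ 2.
  by rewrite normrM normfV (gtr0_norm u0) ler_pdivrMr// mulrAC.
have uv : (u + `|v|) * u <= 2 * (u ^+ 2 + v ^+ 2).
  by rewrite -(real_normK (num_real v)); have := sqr_ge0 (u - `|v|); nra.
have sq (x t : R) : `|x| <= t -> x ^+ 2 <= t ^+ 2.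
  by move=> xt; rewrite -(real_normK (num_real x)) lerXn2r ?nnegrE// (le_trans _ xt).
have h1 : `|(u * a + v * b) / (u ^+ 2 + v ^+ 2)| <= 2 / y.
  rewrite normrM normfV (gtr0_norm S0) ler_pdivrMr// (le_trans (ler_normD _ _))//.
  rewrite !normrM (gtr0_norm u0).
  apply: (@le_trans _ _ ((u + `|v|) * (u / y))).
    by rewrite mulrDl lerD// ?ler_wpM2l// ltW.
  rewrite mulrA [leRHS]mulrAC; apply: ler_wpM2r => //; by rewrite invr_ge0 ltW.
have h2 : `|(a ^+ 2 + b ^+ 2 + u * c + v * d) / (u ^+ 2 + v ^+ 2)| <= 6 / y ^+ 2.
  rewrite normrM normfV (gtr0_norm S0) ler_pdivrMr//.
  apply: (@le_trans _ _ (2 * (u / y) ^+ 2 + (u + `|v|) * (2 * u / y ^+ 2))).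
    rewrite -addrA (le_trans (ler_normD _ _))//; apply: lerD.
      rewrite ger0_norm ?addr_ge0 ?sqr_ge0//; have := sq _ _ ha; have := sq _ _ hb; lra.
    rewrite (le_trans (ler_normD _ _))// mulrDl !normrM (gtr0_norm u0).
    by apply: lerD; rewrite ler_wpM2l// ltW.
  rewrite [leLHS](_ : _ = (2 * u ^+ 2 + 2 * ((u + `|v|) * u)) / y ^+ 2); last by field; rewrite gt_eqF.
  rewrite [leRHS]mulrAC; apply: ler_wpM2r; first by rewrite invr_ge0 ltW.
  have := sqr_ge0 v; have := sqr_ge0 u; lra.
rewrite /bellman2 (le_trans (ler_normB _ _))// [leRHS]mulrDl lerD//.
  rewrite normrM (gtr0_norm (mulr_gt0 l0 p0)) -[leRHS]mulrA ler_wpM2l ?(ltW (mulr_gt0 l0 p0))// normrM.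
  rewrite [leRHS](_ : _ = Y * (3 / y ^+ 2)); last by ring.
  apply: ler_pM => //; first by rewrite ger0_norm ?powR_ge0// powR_le_sumsq.
  rewrite (le_trans (ler_normD _ _))// [leRHS](_ : _ = 1 / y ^+ 2 + 2 / y ^+ 2); last by ring.
  apply: lerD => //; rewrite normrM normrX mul1r -exprVn.
  have := sq _ _ hau; rewrite real_normK ?num_real// => h.
  apply: le_trans h; apply: ler_piMl; first exact: sqr_ge0.
  by rewrite ler_norml; apply/andP; split; lra.
rewrite normrM (gtr0_norm p0) -/Y -[leRHS]mulrA ler_wpM2l ?(ltW p0)//.
rewrite [leRHS](_ : _ = Y * (10 / y ^+ 2)); last by ring.
rewrite normrM (ger0_norm Y0) ler_wpM2l//.
rewrite (le_trans (ler_normD _ _))// [leRHS](_ : _ = 4 / y ^+ 2 + 6 / y ^+ 2); last by ring.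
apply: lerD => //; rewrite normrM normrX.
have h := sq _ _ h1; rewrite real_normK ?num_real//.
rewrite (_ : 4 / y ^+ 2 = (2 / y) ^+ 2); last by rewrite expr_div_n; ring.
have : `|p - 2| <= 1 by rewrite ler_norml; apply/andP; split; lra.
move=> hp; have := sqr_ge0 ((u * a + v * b) / (u ^+ 2 + v ^+ 2)); nra.
Qed.
End bellman_bounds.

(** * Integration over a box in the upper half-plane *)

Section rect.
Context {R : realType}.
Local Notation Rm := (measurableTypeR R).
Local Notation mu := (@lebesgue_measure R).

Lemma is_derive_continuous (f : R -> R) (x df : R) :
  is_derive x 1 f df -> {for x, continuous f}.
Proof.
move=> h; apply: differentiable_continuous; apply/derivable1_diffP.
by case: h.
Qed.

Lemma integral_FTC (f F : R -> R) (a b : R) : a < b ->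
  (forall x, a <= x <= b -> is_derive x 1 F (f x)) ->
  (forall x, a <= x <= b -> {for x, continuous f}) ->
  (\int[mu]_(x in `[a, b]) (f x)%:E = (F b - F a)%:E)%E.
Proof.
move=> ab dF cf; rewrite (@continuous_FTC2 _ f F)//.
- apply: continuous_in_subspaceT => x; rewrite inE/= in_itv/= => xab; exact: cf.
- split.
  + move=> x; rewrite in_itv/= => /andP[ax xb].
    by have [] := dF x; rewrite ?(ltW ax) ?(ltW xb).
  + apply: cvg_at_right_filter; apply: (is_derive_continuous (df := f a)).
    by apply: dF; rewrite lexx ltW.
  + apply: cvg_at_left_filter; apply: (is_derive_continuous (df := f b)).
    by apply: dF; rewrite lexx ltW.
- move=> x; rewrite in_itv/= => /andP[ax xb].
  rewrite derive1E; apply: derive_val; apply: dF; by rewrite (ltW ax) (ltW xb).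
Qed.

Lemma rect_Fubini (f : Rm * Rm -> \bar R) (A B : set Rm) :
  measurable A -> measurable B ->
  (mu \x mu)%E.-integrable (A `*` B) f ->
  (\int[(mu \x mu)%E]_(z in A `*` B) f z = \int[mu]_(x in A) \int[mu]_(y in B) f (x, y))%E /\
  (\int[(mu \x mu)%E]_(z in A `*` B) f z = \int[mu]_(y in B) \int[mu]_(x in A) f (x, y))%E.
Proof.
move=> mA mB fi; have mAB : measurable (A `*` B) by exact: measurableX.
have fi' := proj1 (integrable_mkcond f mAB) fi.
rewrite integral_mkcond; split.
- rewrite -integral12_prod_meas1// [RHS]integral_mkcond.
  apply: eq_integral => x _; rewrite /fubini_F [RHS]patchE; case: ifPn => xA.
  + rewrite [RHS]integral_mkcond; apply: eq_integral => y _.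
    by rewrite !patchE in_setX xA.
  + by apply: integral0_eq => y _; rewrite patchE in_setX (negbTE xA).
- rewrite -integral21_prod_meas1// [RHS]integral_mkcond.
  apply: eq_integral => y _; rewrite /fubini_G [RHS]patchE; case: ifPn => yB.
  + rewrite [RHS]integral_mkcond; apply: eq_integral => x _.
    by rewrite !patchE in_setX yB andbT.
  + by apply: integral0_eq => x _; rewrite patchE in_setX (negbTE yB) andbF.
Qed.

Lemma integrable_rect (f : R * R -> R) (a b c d M : R) : a <= b -> c <= d ->
  measurable_fun [set: Rm * Rm] f ->
  (forall x y, a <= x <= b -> c <= y <= d -> `|f (x, y)| <= M) ->
  (mu \x mu)%E.-integrable (`[a, b] `*` `[c, d]) (EFin \o f).
Proof.
move=> ab cd mf fM; apply: measurable_bounded_integrable.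
- exact: measurableX.
- suff : ((mu \x mu) (`[a, b] `*` `[c, d]) < +oo)%E by [].
  rewrite product_measure1E//.
  rewrite [X in (X * _)%E]lebesgue_measure_itv [X in (_ * X)%E]lebesgue_measure_itv/=; case: ifP; case: ifP => _ _;
  by rewrite -?EFinB -?EFinM ?mule0 ?mul0e ltry.
- exact: measurable_funTS.
- exists M; split; first exact: num_real.
  move=> N MN [x y] /= []; rewrite !in_itv/= => xab ycd.
  exact: (le_trans (fM _ _ xab ycd) (ltW MN)).
Qed.

Lemma continuous_powR (f : R -> R) (x q : R) : 0 < f x ->
  {for x, continuous f} -> {for x, continuous (fun z => f z `^ q)}.
Proof.
move=> f0 cf; apply: (@continuous_comp _ _ _ f (fun z => z `^ q)) => //.
apply: differentiable_continuous; apply/derivable1_diffP.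
by apply: derivable_powR; rewrite in_itv/= f0.
Qed.

Lemma continuous_sqr (f : R -> R) (x : R) :
  {for x, continuous f} -> {for x, continuous (fun z => f z ^+ 2)}.
Proof.
move=> cf; apply: (@continuous_comp _ _ _ f (fun z => z ^+ 2)) => //.
exact: exprn_continuous.
Qed.

Lemma continuous_at_mul (f g : R -> R) (x : R) : {for x, continuous f} ->
  {for x, continuous g} -> {for x, continuous (fun z => f z * g z)}.
Proof. by move=> cf cg; exact: cvgM. Qed.

Lemma continuous_at_add (f g : R -> R) (x : R) : {for x, continuous f} ->
  {for x, continuous g} -> {for x, continuous (fun z => f z + g z)}.
Proof. by move=> cf cg; exact: cvgD. Qed.

Lemma continuous_bellman2 (p : R) (u v a b c d : R -> R) (z : R) : 0 < u z ->
  {for z, continuous u} -> {for z, continuous v} -> {for z, continuous a} ->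
  {for z, continuous b} -> {for z, continuous c} -> {for z, continuous d} ->
  {for z, continuous (fun z => bellman2 p (u z) (v z) (a z) (b z) (c z) (d z))}.
Proof.
move=> u0 cu cv ca cb cc cd; have S0 := sumsq_gt0 (v z) u0.
have cX := continuous_powR (q := p) u0 cu.
have cS : {for z, continuous (fun z => u z ^+ 2 + v z ^+ 2)}.
  by apply: cvgD; exact: continuous_sqr.
have cY := continuous_powR (f := fun z => u z ^+ 2 + v z ^+ 2) (q := p / 2) S0 cS.
have S1 : u z ^+ 2 + v z ^+ 2 != 0 by rewrite gt_eqF.
have u1 : u z != 0 by rewrite gt_eqF.
have iS : (u t ^+ 2 + v t ^+ 2)^-1 @[t --> z] --> (u z ^+ 2 + v z ^+ 2)^-1 by apply: cvgV.
have iu : (u t)^-1 @[t --> z] --> (u z)^-1 by apply: cvgV.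
have cc_ (k : R) : {for z, continuous (fun=> k)} by exact: cvg_cst.
have D := continuous_at_add; have M := continuous_at_mul; have Q := continuous_sqr.
rewrite /bellman2; apply: cvgB; (apply: cvgM; [exact: cvg_cst|]); apply: cvgM => //.
- apply: (@D (fun z => (p - 1) * (a z / u z) ^+ 2) (fun z => c z / u z)); last exact: M.
  by apply: (@M (fun=> p - 1) (fun z => (a z / u z) ^+ 2)) => //; apply: (@Q (fun z => a z / u z)); exact: M.
- apply: (@D (fun z => (p - 2) * ((u z * a z + v z * b z) / (u z ^+ 2 + v z ^+ 2)) ^+ 2)
    (fun z => (a z ^+ 2 + b z ^+ 2 + u z * c z + v z * d z) / (u z ^+ 2 + v z ^+ 2))).
  + apply: (@M (fun=> p - 2) (fun z => ((u z * a z + v z * b z) / (u z ^+ 2 + v z ^+ 2)) ^+ 2)) => //.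
    apply: (@Q (fun z => (u z * a z + v z * b z) / (u z ^+ 2 + v z ^+ 2))).
    by apply: (@M (fun z => u z * a z + v z * b z)) => //; apply: D; exact: M.
  + apply: (@M (fun z => a z ^+ 2 + b z ^+ 2 + u z * c z + v z * d z)) => //.
    apply: (@D (fun z => a z ^+ 2 + b z ^+ 2 + u z * c z)); last exact: M.
    apply: (@D (fun z => a z ^+ 2 + b z ^+ 2)); last exact: M.
    by apply: D; exact: Q.
Qed.

(** Real powers are measurable, and [x^-1 = x * (x ^+ 2) `^ (-1)] also at [x = 0]. *)
Lemma measurable_funV d0 (T : measurableType d0) (f : T -> R) :
  measurable_fun setT f -> measurable_fun setT (fun z => (f z)^-1).
Proof.
move=> mf; have -> : (fun z => (f z)^-1) = (fun z => f z * (f z ^+ 2) `^ (-1)).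
  apply/funext => z; rewrite powR_inv1 ?sqr_ge0//.
  have [->|f0] := eqVneq (f z) 0; first by rewrite invr0 mul0r.
  by rewrite expr2 invfM mulrA divff ?mul1r.
apply: measurable_funM => //.
apply: (@measurableT_comp _ _ _ _ _ _ (fun x : R => x `^ (-1))).
  exact: measurable_powR.
exact: measurable_funX.
Qed.

Lemma measurable_powR_comp d0 (T : measurableType d0) (f : T -> R) (q : R) :
  measurable_fun setT f -> measurable_fun setT (fun z => f z `^ q).
Proof.
move=> mf; apply: (@measurableT_comp _ _ _ _ _ _ (fun x : R => x `^ q)) => //.
Qed.

Lemma measurable_bellman d0 (T : measurableType d0) (p : R) (u v : T -> R) :
  measurable_fun setT u -> measurable_fun setT v ->
  measurable_fun setT (fun z => bellman p (u z) (v z)).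
Proof.
move=> mu_ mv; rewrite /bellman; apply: measurable_funB.
  by apply: measurable_funM => //; exact: measurable_powR_comp.
by apply: measurable_powR_comp; apply: measurable_funD; exact: measurable_funX.
Qed.

Lemma measurable_bellman1 d0 (T : measurableType d0) (p : R) (u v a b : T -> R) :
  measurable_fun setT u -> measurable_fun setT v -> measurable_fun setT a ->
  measurable_fun setT b ->
  measurable_fun setT (fun z => bellman1 p (u z) (v z) (a z) (b z)).
Proof.
move=> mu_ mv ma mb.
have mS : measurable_fun setT (fun z => u z ^+ 2 + v z ^+ 2).
  by apply: measurable_funD; exact: measurable_funX.
rewrite /bellman1; apply: measurable_funB; apply: measurable_funM => //;
  apply: measurable_funM; try exact: measurable_powR_comp.
- by apply: measurable_funM => //; exact: measurable_funV.
- apply: measurable_funM; last exact: measurable_funV.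
  by apply: measurable_funD; exact: measurable_funM.
Qed.

Lemma measurable_bellman2 d0 (T : measurableType d0) (p : R) (u v a b c d : T -> R) :
  measurable_fun setT u -> measurable_fun setT v -> measurable_fun setT a ->
  measurable_fun setT b -> measurable_fun setT c -> measurable_fun setT d ->
  measurable_fun setT (fun z => bellman2 p (u z) (v z) (a z) (b z) (c z) (d z)).
Proof.
move=> mu_ mv ma mb mc md.
have mX (f : T -> R) : measurable_fun setT f -> measurable_fun setT (fun z => f z ^+ 2).
  by move=> mf; exact: measurable_funX.
have mP (f : T -> R) q : measurable_fun setT f -> measurable_fun setT (fun z => f z `^ q).
  by move=> mf; apply: (@measurableT_comp _ _ _ _ _ _ (fun x : R => x `^ q)) => //; exact: measurable_powR.
rewrite /bellman2; apply: measurable_funB; apply: measurable_funM => //.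
- apply: measurable_funM; first exact: mP.
  apply: measurable_funD; last by apply: measurable_funM => //; exact: measurable_funV.
  by apply: measurable_funM => //; apply: mX; apply: measurable_funM => //; exact: measurable_funV.
- have mS : measurable_fun setT (fun z => u z ^+ 2 + v z ^+ 2).
    by apply: measurable_funD; exact: mX.
  apply: measurable_funM; first exact: mP.
  apply: measurable_funD.
  + apply: measurable_funM => //; apply: mX; apply: measurable_funM; last exact: measurable_funV.
    by apply: measurable_funD; exact: measurable_funM.
  + apply: measurable_funM; last exact: measurable_funV.
    apply: measurable_funD; last exact: measurable_funM.
    apply: measurable_funD; last exact: measurable_funM.
    by apply: measurable_funD; exact: mX.
Qed.
End rect.

Section stein.
Context {R : realType}.
Local Notation Rm := (measurableTypeR R).
Local Notation mu := (@lebesgue_measure R).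
(* [U] is a positive harmonic function in the upper half-plane and [V] a conjugate of
   it, with [a = U_x = V_y], [b = V_x = - U_y], [c = U_xx] and [d = V_xx]. *)
Variables (U V a b c d : R -> R -> R) (p s K : R).
Hypotheses (p1 : 1 < p) (p2 : p <= 2) (s0 : 0 < s) (K0 : 0 <= K).
Hypothesis U0 : forall x y : R, 0 < y -> 0 < U x y.
Hypothesis Ux : forall x y : R, 0 < y -> is_derive x 1 (U^~ y) (a x y).
Hypothesis Vx : forall x y : R, 0 < y -> is_derive x 1 (V^~ y) (b x y).
Hypothesis ax : forall x y : R, 0 < y -> is_derive x 1 (a^~ y) (c x y).
Hypothesis bx : forall x y : R, 0 < y -> is_derive x 1 (b^~ y) (d x y).
Hypothesis Uy : forall x y : R, 0 < y -> is_derive y 1 (U x) (- b x y).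
Hypothesis Vy : forall x y : R, 0 < y -> is_derive y 1 (V x) (a x y).
Hypothesis ay : forall x y : R, 0 < y -> is_derive y 1 (a x) (- d x y).
Hypothesis b_y : forall x y : R, 0 < y -> is_derive y 1 (b x) (c x y).
Hypothesis cx : forall x y : R, 0 < y -> {for x, continuous (c^~ y)}.
Hypothesis dx : forall x y : R, 0 < y -> {for x, continuous (d^~ y)}.
Hypothesis cy : forall x y : R, 0 < y -> {for y, continuous (c x)}.
Hypothesis dy : forall x y : R, 0 < y -> {for y, continuous (d x)}.
Hypothesis a_le : forall x y : R, 0 < y -> `|a x y| <= U x y / y.
Hypothesis b_le : forall x y : R, 0 < y -> `|b x y| <= U x y / y.
Hypothesis c_le : forall x y : R, 0 < y -> `|c x y| <= 2 * U x y / y ^+ 2.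
Hypothesis d_le : forall x y : R, 0 < y -> `|d x y| <= 2 * U x y / y ^+ 2.
Hypothesis mU : measurable_fun [set: Rm * Rm] (fun z : R * R => U z.1 z.2).
Hypothesis mV : measurable_fun [set: Rm * Rm] (fun z : R * R => V z.1 z.2).
Hypothesis ma : measurable_fun [set: Rm * Rm] (fun z : R * R => a z.1 z.2).
Hypothesis mb : measurable_fun [set: Rm * Rm] (fun z : R * R => b z.1 z.2).
Hypothesis mc : measurable_fun [set: Rm * Rm] (fun z : R * R => c z.1 z.2).
Hypothesis md : measurable_fun [set: Rm * Rm] (fun z : R * R => d z.1 z.2).
Hypothesis decay : forall x y n : R, s <= y -> 0 < n -> (n <= `|x|) || (n <= y) ->
  `|U x y| <= K / n /\ `|V x y| <= K / n.

Let W x y := bellman p (U x y) (V x y).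
Let Wx x y := bellman1 p (U x y) (V x y) (a x y) (b x y).
Let Wxx x y := bellman2 p (U x y) (V x y) (a x y) (b x y) (c x y) (d x y).
Let Wy x y := bellman1 p (U x y) (V x y) (- b x y) (a x y).
Let Wyy x y := bellman2 p (U x y) (V x y) (- b x y) (a x y) (- c x y) (- d x y).
Let Y x y := (U x y ^+ 2 + V x y ^+ 2) `^ (p / 2).
Let L := p / (p - 1) * p + 2 * p.
Let L2 := p / (p - 1) * p * 3 + p * 10.
Let B n := (2 * (K / n) ^+ 2) `^ (p / 2).

Let p0 : 0 < p. Proof. exact: lt_trans p1. Qed.
Let l0 : 0 < p / (p - 1). Proof. by rewrite divr_gt0// subr_gt0. Qed.
Let Ly0 : 0 <= L.
Proof. by apply: addr_ge0; apply: mulr_ge0; rewrite ?(ltW p0) ?(ltW l0). Qed.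
Let L20 : 0 <= L2.
Proof.
apply: addr_ge0; apply: mulr_ge0; rewrite ?(ltW p0)//.
by apply: mulr_ge0; rewrite ?(ltW p0) ?(ltW l0).
Qed.

Let W_x (x y : R) : 0 < y -> is_derive x 1 (W^~ y) (Wx x y).
Proof.
move=> y0; apply: (@is_derive_bellman R p p1 (U^~ y) (V^~ y) (a^~ y) (b^~ y)).
- exact: U0.
- exact: Ux.
- exact: Vx.
Qed.

Let Wx_x (x y : R) : 0 < y -> is_derive x 1 (Wx^~ y) (Wxx x y).
Proof.
move=> y0; apply: (@is_derive_bellman1 R p p1 (U^~ y) (V^~ y) (a^~ y) (b^~ y)).
- exact: U0.
- exact: Ux.
- exact: Vx.
- exact: ax.
- exact: bx.
Qed.

Let W_y (x y : R) : 0 < y -> is_derive y 1 (W x) (Wy x y).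
Proof.
move=> y0; apply: (@is_derive_bellman R p p1 (U x) (V x) (fun y => - b x y) (a x)).
- exact: U0.
- exact: Uy.
- exact: Vy.
Qed.

Let Wy_y (x y : R) : 0 < y -> is_derive y 1 (Wy x) (Wyy x y).
Proof.
move=> y0; apply: (@is_derive_bellman1 R p p1 (U x) (V x) (fun y => - b x y) (a x)).
- exact: U0.
- exact: Uy.
- exact: Vy.
- exact: (is_deriveN (b_y x y0)).
- exact: ay.
Qed.

Let cWxx (x y : R) : 0 < y -> {for x, continuous (Wxx^~ y)}.
Proof.
move=> y0; apply: continuous_bellman2; [exact: U0| | | | | |].
- exact: is_derive_continuous (Ux x y0).
- exact: is_derive_continuous (Vx x y0).
- exact: is_derive_continuous (ax x y0).
- exact: is_derive_continuous (bx x y0).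
- exact: cx.
- exact: dx.
Qed.

Let cWyy (x y : R) : 0 < y -> {for y, continuous (Wyy x)}.
Proof.
move=> y0; apply: (@continuous_bellman2 R p (U x) (V x) (fun y => - b x y) (a x)
  (fun y => - c x y) (fun y => - d x y)); first exact: U0.
- exact: is_derive_continuous (Uy x y0).
- exact: is_derive_continuous (Vy x y0).
- apply: cvgN; exact: is_derive_continuous (b_y x y0).
- exact: is_derive_continuous (ay x y0).
- apply: cvgN; exact: cy.
- apply: cvgN; exact: dy.
Qed.

Let Y_le (x y n : R) : s <= y -> 0 < n -> (n <= `|x|) || (n <= y) -> Y x y <= B n.
Proof.
move=> sy n0 h; have [hU hV] := decay sy n0 h.
have sq (z : R) : `|z| <= K / n -> z ^+ 2 <= (K / n) ^+ 2.
  by move=> hz; rewrite -(real_normK (num_real z)) lerXn2r// nnegrE// (le_trans _ hz).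
have S2 : U x y ^+ 2 + V x y ^+ 2 <= 2 * (K / n) ^+ 2.
  have := sq _ hU; have := sq _ hV; lra.
have S1 : 0 <= U x y ^+ 2 + V x y ^+ 2 by rewrite addr_ge0 ?sqr_ge0.
apply: ge0_ler_powR => //; first by rewrite divr_ge0// ltW.
by rewrite nnegrE (le_trans S1).
Qed.

Let Wx_le (x y n : R) : s <= y -> 0 < n -> (n <= `|x|) || (n <= y) ->
  `|Wx x y| <= L * (B n / y).
Proof.
move=> sy n0 h; have y0 := lt_le_trans s0 sy.
apply: (le_trans (bellman1_le p1 (V x y) (U0 x y0) y0 (a_le x y0) (b_le x y0))).
by rewrite ler_wpM2l// ler_wpM2r ?invr_ge0 ?(ltW y0)//; exact: Y_le.
Qed.

Let Wy_le (x y n : R) : s <= y -> 0 < n -> (n <= `|x|) || (n <= y) ->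
  `|Wy x y| <= L * (B n / y).
Proof.
move=> sy n0 h; have y0 := lt_le_trans s0 sy.
apply: (le_trans (bellman1_le (a := - b x y) p1 (V x y) (U0 x y0) y0 _ (a_le x y0))).
  by rewrite normrN; exact: b_le.
by rewrite ler_wpM2l// ler_wpM2r ?invr_ge0 ?(ltW y0)//; exact: Y_le.
Qed.

Let W_le (x y n : R) : s <= y -> 0 < n -> (n <= `|x|) || (n <= y) ->
  `|W x y| <= (p / (p - 1) + 1) * B n.
Proof.
move=> sy n0 h; have y0 := lt_le_trans s0 sy.
apply: (le_trans (bellman_le p1 (V x y) (U0 x y0))).
rewrite ler_wpM2l//; last exact: Y_le.
by rewrite addr_ge0// ltW.
Qed.

Let Wxx_le (x y : R) : s <= y -> `|Wxx x y| <= L2 * (B s / s ^+ 2).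
Proof.
move=> sy; have y0 := lt_le_trans s0 sy.
apply: (le_trans (bellman2_le p1 p2 (V x y) (U0 x y0) y0 (a_le x y0) (b_le x y0) (c_le x y0) (d_le x y0))).
apply: ler_wpM2l => //; apply: ler_pM; rewrite ?powR_ge0 ?invr_ge0 ?sqr_ge0//.
  by apply: Y_le => //; rewrite sy orbT.
by rewrite lef_pV2 ?posrE ?exprn_gt0// lerXn2r ?nnegrE ?(ltW s0) ?(ltW y0).
Qed.

Let Wyy_le (x y : R) : s <= y -> `|Wyy x y| <= L2 * (B s / s ^+ 2).
Proof.
move=> sy; have y0 := lt_le_trans s0 sy.
apply: (le_trans (bellman2_le (a := - b x y) (c := - c x y) (d := - d x y) p1 p2 (V x y) (U0 x y0) y0 _ (a_le x y0) _ _)).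
- by rewrite normrN; exact: b_le.
- by rewrite normrN; exact: c_le.
- by rewrite normrN; exact: d_le.
apply: ler_wpM2l => //; apply: ler_pM; rewrite ?powR_ge0 ?invr_ge0 ?sqr_ge0//.
  by apply: Y_le => //; rewrite sy orbT.
by rewrite lef_pV2 ?posrE ?exprn_gt0// lerXn2r ?nnegrE ?(ltW s0) ?(ltW y0).
Qed.

(** Green's formula on the box of the points [(x, y)] with [|x| <= n] and [s <= y <= n],
    where the integral of [(y - s) * (W_xx + W_yy)] is nonnegative. The weight [y - s]
    vanishes on the lower edge, so two integrations by parts in [y] leave there the
    integral of [W] itself; [decay] bounds the contributions of the other three edges.
    *)
Lemma stein_rectangle (n : R) : s < n ->
  mu.-integrable `[- n, n] (fun x => (W x s)%:E) /\
  ((- (B n * n * (4 * L + 2 * (p / (p - 1) + 1))))%:E <=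
    \int[mu]_(x in `[(- n)%R, n]) (W x s)%:E)%E.
Proof.
move=> sn; have n0 := lt_trans s0 sn.
have nn : - n < n by rewrite (lt_trans _ n0)// oppr_lt0.
pose A : set Rm := `[- n, n]%classic; pose I : set Rm := `[s, n]%classic.
have mA : measurable A by exact: measurable_itv.
have mI : measurable I by exact: measurable_itv.
pose g1 (z : R * R) := (z.2 - s) * Wxx z.1 z.2.
pose g2 (z : R * R) := (z.2 - s) * Wyy z.1 z.2.
have m2 : measurable_fun [set: Rm * Rm] (fun z : R * R => z.2 - s).
  by apply: measurable_funB => //; exact: measurable_snd.
have m1 : measurable_fun [set: Rm] (fun y : R => y - s) by exact: measurable_funB.
have mR (f : R -> R -> R) x : measurable_fun [set: Rm * Rm] (fun z : R * R => f z.1 z.2) ->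
    measurable_fun [set: Rm] (f x).
  by move=> mf; apply: (@measurableT_comp _ _ _ _ _ _ _ _ (fun y : Rm => (x : Rm, y)) mf); exact: pair1_measurable.
have mL (f : R -> R -> R) y : measurable_fun [set: Rm * Rm] (fun z : R * R => f z.1 z.2) ->
    measurable_fun [set: Rm] (f^~ y).
  by move=> mf; apply: (@measurableT_comp _ _ _ _ _ _ _ _ (fun x : Rm => (x, y : Rm)) mf); exact: pair2_measurable.
have mWx x : measurable_fun [set: Rm] (Wx x) by apply: measurable_bellman1; exact: mR.
have mWy y : measurable_fun [set: Rm] (Wy^~ y).
  have mnb : measurable_fun [set: Rm] (fun x => - b x y).
    by apply: (measurableT_comp (@oppr_measurable R setT)); exact: (mL b).
  exact: (@measurable_bellman1 _ _ Rm p (U^~ y) (V^~ y) _ (a^~ y) (mL U y mU) (mL V y mV) mnb (mL a y ma)).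
have mW y : measurable_fun [set: Rm] (W^~ y).
  exact: (@measurable_bellman _ _ Rm p (U^~ y) (V^~ y) (mL U y mU) (mL V y mV)).
have mg1 : measurable_fun [set: Rm * Rm] g1.
  by apply: measurable_funM => //; exact: measurable_bellman2.
have mg2 : measurable_fun [set: Rm * Rm] g2.
  apply: measurable_funM => //; apply: measurable_bellman2 => //;
  exact: (measurableT_comp (@oppr_measurable R setT)).
have B0 t : 0 <= B t by exact: powR_ge0.
have ig1 : (mu \x mu)%E.-integrable (A `*` I) (EFin \o g1).
  apply: (@integrable_rect _ _ _ _ _ _ ((n - s) * (L2 * (B s / s ^+ 2)))) => //; [exact: ltW|exact: ltW|].
  move=> x y _ /andP[sy yn]; rewrite normrM ler_pM// ?Wxx_le//.
  by rewrite ger0_norm ?subr_ge0// lerB.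
have ig2 : (mu \x mu)%E.-integrable (A `*` I) (EFin \o g2).
  apply: (@integrable_rect _ _ _ _ _ _ ((n - s) * (L2 * (B s / s ^+ 2)))) => //; [exact: ltW|exact: ltW|].
  move=> x y _ /andP[sy yn]; rewrite normrM ler_pM// ?Wyy_le//.
  by rewrite ger0_norm ?subr_ge0// lerB.
have ge : (0 <= \int[(mu \x mu)%E]_(z in A `*` I) ((g1 z)%:E + (g2 z)%:E))%E.
  apply: integral_ge0 => -[x y] /= [_]; rewrite /I/= in_itv/= => /andP[sy _].
  rewrite -EFinD lee_fin -mulrDr mulr_ge0 ?subr_ge0//.
  apply: bellman_laplacian_ge0 => //; exact/U0/(lt_le_trans s0).
rewrite integralD// in ge; last exact: measurableX.
rewrite [X in (_ <= X + _)%E](rect_Fubini mA mI ig1).2 in ge.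
rewrite [X in (_ <= _ + X)%E](rect_Fubini mA mI ig2).1 in ge.
(* Integrating in [x] first leaves [(y - s) * W_x] on the two lateral edges. *)
have e1 : (\int[mu]_(y in I) \int[mu]_(x in A) (EFin \o g1) (x, y) <= (2 * L * B n * n)%:E)%E.
  have h y : I y -> (\int[mu]_(x in A) (EFin \o g1) (x, y) = ((y - s) * (Wx n y - Wx (- n) y))%:E)%E.
    rewrite /I/= in_itv/= => /andP[sy yn]; have y0 := lt_le_trans s0 sy.
    pose f (x : R) := (y - s) * Wxx x y; pose F (x : R) := (y - s) * Wx x y.
    have dF (x : R) : - n <= x <= n -> is_derive x 1 F (f x).
      by move=> _; have := is_deriveZ (y - s) (Wx_x x y0).
    have cf (x : R) : - n <= x <= n -> {for x, continuous f}.
      by move=> _; apply: cvgM; [exact: cvg_cst|exact: cWxx].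
    have -> : (y - s) * (Wx n y - Wx (- n) y) = F n - F (- n) by rewrite mulrBr.
    exact: (integral_FTC nn dF cf).
  have -> : (\int[mu]_(y in I) \int[mu]_(x in A) (EFin \o g1) (x, y) =
      \int[mu]_(y in I) ((y - s) * (Wx n y - Wx (- n) y))%:E)%E.
    by apply: eq_integral => y /set_mem; exact: h.
  have mphi : measurable_fun I (fun y => ((y - s) * (Wx n y - Wx (- n) y))%:E).
    apply/measurable_EFinP/measurable_funTS; apply: measurable_funM; first exact: m1.
    by apply: measurable_funB; exact: mWx.
  apply: (le_trans (lee_abs _)).
  apply: (le_trans (le_abse_integral mu mI mphi)).
  apply: (@le_trans _ _ ((2 * L * B n)%:E * mu I)%E).
    apply: integral_le_bound => //.
    - by rewrite lee_fin !mulr_ge0.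
    - apply/aeW => y; rewrite /I/= in_itv/= => /andP[sy yn]; have y0 := lt_le_trans s0 sy.
      rewrite lee_fin normrM ger0_norm ?subr_ge0//.
      apply: (@le_trans _ _ (y * (L * (B n / y) + L * (B n / y)))); last first.
        by rewrite le_eqVlt; apply/orP; left; apply/eqP; field; rewrite gt_eqF.
      apply: ler_pM => //; rewrite ?subr_ge0//; first by rewrite lerBlDr lerDl ltW.
      rewrite (le_trans (ler_normB _ _))//.
      by apply: lerD; apply: Wx_le; rewrite ?normrN ?(ger0_norm (ltW n0)) ?lexx.
  rewrite /I lebesgue_measure_itv/= lte_fin sn -EFinB -EFinM lee_fin ler_wpM2l ?mulr_ge0//.
  by rewrite lerBlDr lerDl ltW.
(* A primitive of [(y - s) * W_yy] in [y] is [(y - s) * W_y - W]. *)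
have e2 : (\int[mu]_(x in A) \int[mu]_(y in I) (EFin \o g2) (x, y) =
   \int[mu]_(x in A) ((n - s) * Wy x n - W x n + W x s)%:E)%E.
  apply: eq_integral => x _.
  pose f (y : R) := (y - s) * Wyy x y; pose F (y : R) := (y - s) * Wy x y - W x y.
  have dF (y : R) : s <= y <= n -> is_derive y 1 F (f y).
    move=> /andP[sy yn]; have y0 := lt_le_trans s0 sy.
    have h1 : is_derive y 1 (fun y : R => y - s) 1.
      by apply: (is_derive_eq (is_deriveB (is_derive_id y 1) (is_derive_cst s y 1))); rewrite subr0.
    apply: (is_derive_eq (is_deriveB (is_deriveM h1 (Wy_y x y0)) (W_y x y0))).
    by rewrite /GRing.scale/= mulr1 addrK.
  have cf (y : R) : s <= y <= n -> {for y, continuous f}.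
    move=> /andP[sy yn]; have y0 := lt_le_trans s0 sy.
    apply: cvgM; last exact: cWyy.
    by apply: cvgB; [exact: cvg_id|exact: cvg_cst].
  have -> : (n - s) * Wy x n - W x n + W x s = F n - F s.
    by rewrite /F subrr mul0r sub0r opprK.
  exact: (integral_FTC sn dF cf).
have muA : mu A = (2 * n)%:E.
  by rewrite /A lebesgue_measure_itv/= lte_fin nn -EFinB opprK; congr (_%:E); ring.
have muAy : (mu A < +oo)%E by rewrite muA ltry.
have cWs : {in setT, continuous (fun x => W x s)}.
  by move=> x _; exact: is_derive_continuous (W_x x s0).
have iW : mu.-integrable A (fun x => (W x s)%:E).
  apply: continuous_compact_integrable; first exact: segment_compact.
  by apply: continuous_subspaceT => x; apply: cWs; rewrite inE.
split; first exact: iW.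
(* Bound for this primitive on the upper edge. *)
pose M2 := (L + (p / (p - 1) + 1)) * B n.
have iM : mu.-integrable A (fun x => M2%:E).
  apply: continuous_compact_integrable; first exact: segment_compact.
  by apply: continuous_subspaceT => x; exact: cvg_cst.
have e3 : (\int[mu]_(x in A) ((n - s) * Wy x n - W x n + W x s)%:E <=
   (M2 * (2 * n))%:E + \int[mu]_(x in A) (W x s)%:E)%E.
  have -> : ((M2 * (2 * n))%:E = \int[mu]_(x in A) M2%:E)%E.
    apply: (etrans _ (esym (integral_cst mu mA M2%:E))).
    by apply: (etrans _ (congr1 (mule M2%:E) (esym muA))).
  rewrite -integralD//.
  have hM x : `|(n - s) * Wy x n - W x n| <= M2.
    rewrite /M2 [leRHS]mulrDl (le_trans (ler_normB _ _))// lerD//; last first.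
      by apply: W_le => //; [exact: ltW|rewrite lexx orbT].
    rewrite normrM ger0_norm ?subr_ge0 ?(ltW sn)//.
    apply: (@le_trans _ _ (n * (L * (B n / n)))); last first.
      by rewrite le_eqVlt; apply/orP; left; apply/eqP; field; rewrite gt_eqF.
    apply: ler_pM => //; rewrite ?subr_ge0 ?(ltW sn)//; first by rewrite lerBlDr lerDl ltW.
    by apply: Wy_le; [exact: ltW|by []|rewrite lexx orbT].
  apply: le_integral => //.
  - under eq_fun do rewrite EFinD.
    apply: integrableD => //; apply: measurable_bounded_integrable => //.
    + have mk : measurable_fun [set: Rm] (fun=> n - s) by exact: measurable_cst.
      exact: (measurable_funTS (measurable_funB (measurable_funM mk (mWy n)) (mW n))).
    + exists M2; split; first exact: num_real.
      by move=> N MN x _ /=; exact: le_trans (hM x) (ltW MN).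
  - exact: integrableD.
  - by move=> x xA; rewrite -EFinD lee_fin lerD2r (le_trans (ler_norm _)).
rewrite e2 in ge.
have := le_trans ge (leeD e1 e3); rewrite addeA -EFinD.
have -> : 2 * L * B n * n + M2 * (2 * n) = B n * n * (4 * L + 2 * (p / (p - 1) + 1)).
  by rewrite /M2; ring.
set I0 := (\int[mu]_(x in A) _)%E; set c0 := (_ * _ * _).
have : I0 \is a fin_num by apply: integrable_fin_num.
rewrite -/A -/I0; move=> /fineK <-; rewrite -EFinD !lee_fin => h.
by rewrite -subr_ge0 opprK addrC.
Qed.
End stein.

(** * The Poisson kernel and its conjugate *)

Section kernels.
Context {R : realType}.
Local Notation Rm := (measurableTypeR R).
Implicit Types x y : R.

(** These are the parts of [1 / (x + i * y) = qker x y - i * pker x y], so that [pker]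
    has mass [pi] in [x]. *)
Definition pker x y := y / (x ^+ 2 + y ^+ 2).
Definition qker x y := x / (x ^+ 2 + y ^+ 2).
Definition pker_x x y := - 2 * x * y / (x ^+ 2 + y ^+ 2) ^+ 2.
Definition qker_x x y := (y ^+ 2 - x ^+ 2) / (x ^+ 2 + y ^+ 2) ^+ 2.
(** By harmonicity these are also, up to sign, the second derivatives in [y]. *)
Definition pker_xx x y := (6 * x ^+ 2 * y - 2 * y ^+ 3) / (x ^+ 2 + y ^+ 2) ^+ 3.
Definition qker_xx x y := (2 * x ^+ 3 - 6 * x * y ^+ 2) / (x ^+ 2 + y ^+ 2) ^+ 3.

Lemma is_derive_rational (p q : {poly R}) (x : R) : q.[x] != 0 ->
  is_derive x 1 (fun t => p.[t] / q.[t])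
    ((p^`().[x] * q.[x] - p.[x] * q^`().[x]) / q.[x] ^+ 2).
Proof.
move=> q0.
have h := is_deriveM (is_derive_poly p x) (is_deriveV (f := fun t => q.[t]) q0 (is_derive_poly q x)).
apply: (is_derive_eq h); rewrite /GRing.scale/=; field; exact: q0.
Qed.

Lemma ball_den_gt0 x y : 0 < y -> 0 < x ^+ 2 + y ^+ 2.
Proof. by move=> y0; rewrite ltr_wpDl ?sqr_ge0 ?exprn_gt0. Qed.

Let den_neq0 x y : 0 < y -> x ^+ 2 + y ^+ 2 != 0.
Proof. by move=> /(ball_den_gt0 x) h; rewrite gt_eqF. Qed.

Let hE := (derivD, derivB, derivN, derivM, derivXn, derivX, derivC, deriv_exp, hornerE).

Lemma is_derive_pker_x x y : 0 < y -> is_derive x 1 (pker^~ y) (pker_x x y).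
Proof.
move=> y0; have D := den_neq0 x y0.
have -> : pker^~ y = fun t => (y%:P : {poly R}).[t] / ('X ^+ 2 + (y ^+ 2)%:P).[t].
  by apply/funext => t; rewrite /pker !hornerE.
apply: (is_derive_eq (is_derive_rational _ _)); first by rewrite !hornerE.
by rewrite /pker_x !hE/= ?hE/=; field.
Qed.

Lemma is_derive_qker_x x y : 0 < y -> is_derive x 1 (qker^~ y) (qker_x x y).
Proof.
move=> y0; have D := den_neq0 x y0.
have -> : qker^~ y = fun t => ('X : {poly R}).[t] / ('X ^+ 2 + (y ^+ 2)%:P).[t].
  by apply/funext => t; rewrite /qker !hornerE.
apply: (is_derive_eq (is_derive_rational _ _)); first by rewrite !hornerE.
by rewrite /qker_x !hE/= ; field.
Qed.

(** The Cauchy-Riemann equations for [1 / (x + i * y)]. *)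
Lemma is_derive_pker_y x y : 0 < y -> is_derive y 1 (pker x) (- qker_x x y).
Proof.
move=> y0; have D := den_neq0 x y0.
have -> : pker x = fun t => ('X : {poly R}).[t] / ((x ^+ 2)%:P + 'X ^+ 2).[t].
  by apply/funext => t; rewrite /pker !hornerE.
apply: (is_derive_eq (is_derive_rational _ _)); first by rewrite !hornerE.
by rewrite /qker_x !hE/= ; field.
Qed.

Lemma is_derive_qker_y x y : 0 < y -> is_derive y 1 (qker x) (pker_x x y).
Proof.
move=> y0; have D := den_neq0 x y0.
have -> : qker x = fun t => (x%:P : {poly R}).[t] / ((x ^+ 2)%:P + 'X ^+ 2).[t].
  by apply/funext => t; rewrite /qker !hornerE.
apply: (is_derive_eq (is_derive_rational _ _)); first by rewrite !hornerE.
by rewrite /pker_x !hE/= ; field.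
Qed.

Lemma is_derive_pker_xx x y : 0 < y -> is_derive x 1 (pker_x^~ y) (pker_xx x y).
Proof.
move=> y0; have D := den_neq0 x y0.
have -> : pker_x^~ y = fun t => ((- 2 * y)%:P * 'X : {poly R}).[t] / (('X ^+ 2 + (y ^+ 2)%:P) ^+ 2).[t].
  by apply/funext => t; rewrite /pker_x !hornerE; congr (_ / _); ring.
apply: (is_derive_eq (is_derive_rational _ _)); first by rewrite !hornerE expf_neq0.
by rewrite /pker_xx !hE/= ?hE/=; field.
Qed.

Lemma is_derive_qker_xx x y : 0 < y -> is_derive x 1 (qker_x^~ y) (qker_xx x y).
Proof.
move=> y0; have D := den_neq0 x y0.
have -> : qker_x^~ y = fun t => ((y ^+ 2)%:P - 'X ^+ 2 : {poly R}).[t] / (('X ^+ 2 + (y ^+ 2)%:P) ^+ 2).[t].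
  by apply/funext => t; rewrite /qker_x !hornerE.
apply: (is_derive_eq (is_derive_rational _ _)); first by rewrite !hornerE expf_neq0.
by rewrite /qker_xx !hE/= ?hE/=; field.
Qed.

Lemma is_derive_pker_xy x y : 0 < y -> is_derive y 1 (pker_x x) (- qker_xx x y).
Proof.
move=> y0; have D := den_neq0 x y0.
have -> : pker_x x = fun t => ((- 2 * x)%:P * 'X : {poly R}).[t] / (((x ^+ 2)%:P + 'X ^+ 2) ^+ 2).[t].
  by apply/funext => t; rewrite /pker_x !hornerE.
apply: (is_derive_eq (is_derive_rational _ _)); first by rewrite !hornerE expf_neq0.
by rewrite /qker_xx !hE/= ?hE/=; field.
Qed.

Lemma is_derive_qker_xy x y : 0 < y -> is_derive y 1 (qker_x x) (pker_xx x y).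
Proof.
move=> y0; have D := den_neq0 x y0.
have -> : qker_x x = fun t => ('X ^+ 2 - (x ^+ 2)%:P : {poly R}).[t] / (((x ^+ 2)%:P + 'X ^+ 2) ^+ 2).[t].
  by apply/funext => t; rewrite /qker_x !hornerE.
apply: (is_derive_eq (is_derive_rational _ _)); first by rewrite !hornerE expf_neq0.
by rewrite /pker_xx !hE/= ?hE/=; field.
Qed.

Lemma pker_gt0 x y : 0 < y -> 0 < pker x y.
Proof. by move=> y0; rewrite divr_gt0// ball_den_gt0. Qed.

Lemma pker_le x y : 0 < y -> pker x y <= y^-1.
Proof.
move=> y0; rewrite ler_pdivrMr ?ball_den_gt0// mulrDr.
have -> : y^-1 * y ^+ 2 = y by field; rewrite gt_eqF.
by rewrite lerDr mulr_ge0 ?invr_ge0 ?(ltW y0)// sqr_ge0.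
Qed.

Lemma norm_pker x y : 0 < y -> `|pker x y| = pker x y.
Proof. by move=> y0; rewrite gtr0_norm// pker_gt0. Qed.

Let sqr_le (a b : R) : 0 <= b -> a ^+ 2 <= b ^+ 2 -> `|a| <= b.
Proof. by move=> b0; rewrite -(real_normK (num_real a)) ler_pXn2r// nnegrE. Qed.

Lemma qker_le x y : 0 < y -> `|qker x y| <= y^-1.
Proof.
move=> y0; have D := ball_den_gt0 x y0.
rewrite normrM normfV (gtr0_norm D) ler_pdivrMr// mulrC ler_pdivlMr//.
have -> : `|x| * y = `|x * y| by rewrite normrM (gtr0_norm y0).
rewrite ler_norml; apply/andP; split; have := sqr_ge0 (x - y); have := sqr_ge0 (x + y); have := sqr_ge0 x; have := sqr_ge0 y; nra.
Qed.

Lemma pker_x_le x y : 0 < y -> `|pker_x x y| <= pker x y / y.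
Proof.
move=> y0; have D := ball_den_gt0 x y0.
have -> : pker x y / y = (x ^+ 2 + y ^+ 2)^-1 by rewrite /pker; field; rewrite !gt_eqF.
rewrite normrM normfV (gtr0_norm (exprn_gt0 _ D)) ler_pdivrMr ?exprn_gt0//.
rewrite expr2 mulrA mulVf ?gt_eqF// mul1r.
rewrite ler_norml; apply/andP; split; have := sqr_ge0 (x - y); have := sqr_ge0 (x + y); nra.
Qed.

Lemma qker_x_le x y : 0 < y -> `|qker_x x y| <= pker x y / y.
Proof.
move=> y0; have D := ball_den_gt0 x y0.
have -> : pker x y / y = (x ^+ 2 + y ^+ 2)^-1 by rewrite /pker; field; rewrite !gt_eqF.
rewrite normrM normfV (gtr0_norm (exprn_gt0 _ D)) ler_pdivrMr ?exprn_gt0//.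
rewrite expr2 mulrA mulVf ?gt_eqF// mul1r.
rewrite ler_norml; apply/andP; split; have := sqr_ge0 x; have := sqr_ge0 y; lra.
Qed.

(* [pker_xx] and [qker_xx] have as numerators twice the imaginary and the real part of
   the cube of [x + i * y]; these two parts are [a] and [b], in either order. *)
Let cube_le (a b : R) x y : 0 < y -> a ^+ 2 + b ^+ 2 = (x ^+ 2 + y ^+ 2) ^+ 3 ->
  `|2 * a / (x ^+ 2 + y ^+ 2) ^+ 3| <= 2 * pker x y / y ^+ 2.
Proof.
move=> y0 h; have D := ball_den_gt0 x y0; set d := x ^+ 2 + y ^+ 2 in D h *.
have -> : 2 * pker x y / y ^+ 2 = 2 * (d * y)^-1.
  by rewrite /pker -/d; field; rewrite !gt_eqF.
rewrite -mulrA normrM ger0_norm// ler_wpM2l// normrM normfV (gtr0_norm (exprn_gt0 _ D)).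
rewrite ler_pdivrMr ?exprn_gt0// invfM -mulrA.
rewrite (_ : d^-1 * (y^-1 * d ^+ 3) = d ^+ 2 / y); last by field; rewrite !gt_eqF.
apply: sqr_le; first by rewrite divr_ge0 ?sqr_ge0// ltW.
apply: (@le_trans _ _ (d ^+ 3)); first by rewrite -h lerDl sqr_ge0.
rewrite expr_div_n ler_pdivlMr ?exprn_gt0// -exprM (_ : d ^+ (2 * 2) = d ^+ 3 * d); last by rewrite -exprSr.
apply: ler_wpM2l; first by rewrite exprn_ge0 ?(ltW D).
by rewrite /d lerDr sqr_ge0.
Qed.

Lemma pker_xx_le x y : 0 < y -> `|pker_xx x y| <= 2 * pker x y / y ^+ 2.
Proof.
move=> y0; have := @cube_le (3 * x ^+ 2 * y - y ^+ 3) (x ^+ 3 - 3 * x * y ^+ 2) x y y0.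
rewrite /pker_xx (_ : 2 * (_ - _) = 6 * x ^+ 2 * y - 2 * y ^+ 3); last by ring.
by apply; ring.
Qed.

Lemma qker_xx_le x y : 0 < y -> `|qker_xx x y| <= 2 * pker x y / y ^+ 2.
Proof.
move=> y0; have := @cube_le (x ^+ 3 - 3 * x * y ^+ 2) (3 * x ^+ 2 * y - y ^+ 3) x y y0.
rewrite /qker_xx (_ : 2 * (_ - _) = 2 * x ^+ 3 - 6 * x * y ^+ 2); last by ring.
by apply; ring.
Qed.

Lemma mulr_pker_le1 x y : 0 < y -> `|x| * `|pker x y| <= 1.
Proof.
move=> y0; have D := ball_den_gt0 x y0.
rewrite norm_pker// /pker mulrA ler_pdivrMr// mul1r -(real_normK (num_real x)).
have := sqr_ge0 (`|x| - y); have := normr_ge0 x; nra.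
Qed.

Lemma mulr_qker_le1 x y : 0 < y -> `|x| * `|qker x y| <= 1.
Proof.
move=> y0; have D := ball_den_gt0 x y0.
rewrite normrM normfV (gtr0_norm D) mulrA ler_pdivrMr// mul1r -expr2 real_normK ?num_real//.
by rewrite lerDl sqr_ge0.
Qed.
Let continuous_rational (p q : {poly R}) (x : R) : q.[x] != 0 ->
  {for x, continuous (fun t => p.[t] / q.[t])}.
Proof.
move=> q0; apply: cvgM; first exact: continuous_horner.
by apply: cvgV => //; exact: continuous_horner.
Qed.

Lemma continuous_pker_xx_x x y : 0 < y -> {for x, continuous (pker_xx^~ y)}.
Proof.
move=> y0; have D := den_neq0 x y0.
have -> : pker_xx^~ y = fun t => ((6 * y)%:P * 'X ^+ 2 - (2 * y ^+ 3)%:P : {poly R}).[t] / (('X ^+ 2 + (y ^+ 2)%:P) ^+ 3).[t].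
  by apply/funext => t; rewrite /pker_xx; congr (_ / _); rewrite !(hornerD, hornerN, hornerCM, hornerXn, hornerC, horner_exp, hornerX)//; ring.
by apply: continuous_rational; rewrite !hornerE expf_neq0.
Qed.

Lemma continuous_qker_xx_x x y : 0 < y -> {for x, continuous (qker_xx^~ y)}.
Proof.
move=> y0; have D := den_neq0 x y0.
have -> : qker_xx^~ y = fun t => (2%:P * 'X ^+ 3 - (6 * y ^+ 2)%:P * 'X : {poly R}).[t] / (('X ^+ 2 + (y ^+ 2)%:P) ^+ 3).[t].
  by apply/funext => t; rewrite /qker_xx; congr (_ / _); rewrite !(hornerD, hornerN, hornerCM, hornerXn, hornerC, horner_exp, hornerX)//; ring.
by apply: continuous_rational; rewrite !hornerE expf_neq0.
Qed.

Lemma continuous_pker_xx_y x y : 0 < y -> {for y, continuous (pker_xx x)}.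
Proof.
move=> y0; have D := den_neq0 x y0.
have -> : pker_xx x = fun t => ((6 * x ^+ 2)%:P * 'X - 2%:P * 'X ^+ 3 : {poly R}).[t] / (((x ^+ 2)%:P + 'X ^+ 2) ^+ 3).[t].
  by apply/funext => t; rewrite /pker_xx !hornerE.
by apply: continuous_rational; rewrite !hornerE expf_neq0.
Qed.

Lemma continuous_qker_xx_y x y : 0 < y -> {for y, continuous (qker_xx x)}.
Proof.
move=> y0; have D := den_neq0 x y0.
have -> : qker_xx x = fun t => ((2 * x ^+ 3)%:P - (6 * x)%:P * 'X ^+ 2 : {poly R}).[t] / (((x ^+ 2)%:P + 'X ^+ 2) ^+ 3).[t].
  by apply/funext => t; rewrite /qker_xx !hornerE.
by apply: continuous_rational; rewrite !hornerE expf_neq0.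
Qed.
End kernels.

(** * Poisson integrals and their conjugates *)

Section conv.
Context {R : realType}.
Local Notation Rm := (measurableTypeR R).
Local Notation mu := (@lebesgue_measure R).
Variable h : R -> R.
Hypothesis mh : measurable_fun [set: Rm] h.
Hypothesis h0 : forall t, 0 <= h t.
Hypothesis ih : mu.-integrable [set: Rm] (EFin \o h).

(** Up to the factor [pi], [cv pker] is the Poisson integral of [h] and [cv qker] its
    conjugate. *)
Definition cv (k : R -> R -> R) (x y : R) : R := \int[mu]_t (h t * k (x - t) y).

Lemma integrable_mulh (phi : R -> R) (M : R) : measurable_fun [set: Rm] phi ->
  (forall t, `|phi t| <= M) -> mu.-integrable [set: Rm] (fun t => (h t * phi t)%:E).
Proof.
move=> mphi phiM; apply: (@le_integrable _ _ _ mu _ measurableT _ (fun t => (M%:E * (h t)%:E)%E)).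
- by apply/measurable_EFinP; exact: measurable_funM.
- move=> t _; rewrite -EFinM !abse_EFin lee_fin !normrM (ger0_norm (h0 t)) mulrC.
  by rewrite ler_wpM2r// (le_trans (phiM t))// ler_norm.
- exact: integrableZl.
Qed.

Lemma is_derive_integral (phi phi' : R -> R -> R) (a u v M : R) :
  u < a < v ->
  (forall l, u < l < v -> measurable_fun [set: Rm] (phi l)) ->
  (forall l t : R, u < l < v -> is_derive l 1 (phi^~ t) (phi' l t)) ->
  (forall l t, u < l < v -> `|phi l t| <= M) ->
  (forall l t, u < l < v -> `|phi' l t| <= M) ->
  is_derive a 1 (fun l => \int[mu]_t (h t * phi l t)) (\int[mu]_t (h t * phi' a t)).
Proof.
move=> uav mphi dphi phiM phi'M.
pose f l t := h t * phi l t.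
have Ia : `]u, v[%classic a by rewrite /= in_itv.
have df (l t : R) : `]u, v[%classic l -> is_derive l 1 (f^~ t) (h t * phi' l t).
  by rewrite /= in_itv/= => Il; exact: (is_deriveZ (h t) (dphi l t Il)).
have pE (l t : R) : `]u, v[%classic l -> partial1of2 f l t = h t * phi' l t.
  by move=> Il; rewrite partial1of2E; apply: derive_val; exact: df.
have intf l : `]u, v[%classic l -> mu.-integrable [set: Rm] (EFin \o f l).
  by rewrite /= in_itv/= => Il; apply: (@integrable_mulh _ M); [exact: mphi|move=> t; exact: phiM].
have derf l t : `]u, v[%classic l -> [set: Rm] t -> derivable (f^~ t) l 1.
  by move=> Il _; have [] := df l t Il.
have G0 (t : Rm) : 0 <= h t * `|M| by rewrite mulr_ge0.
have iG : mu.-integrable [set: Rm] (EFin \o (fun t => h t * `|M|)).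
  by apply: (@integrable_mulh (fun=> `|M|) `|M|) => // t; rewrite normr_id.
have Gub l t : `]u, v[%classic l -> [set: Rm] t -> `|partial1of2 f l t| <= h t * `|M|.
  move=> Il _; rewrite pE// normrM (ger0_norm (h0 t)) ler_wpM2l//.
  by rewrite (le_trans (phi'M _ _ _)) ?ler_norm//; move: Il; rewrite /= in_itv.
apply: DeriveDef.
  exact: (derivable_under_integral measurableT Ia intf derf G0 iG Gub).
rewrite -derive1E (differentiation_under_integral measurableT Ia intf derf G0 iG Gub).
by apply: eq_Rintegral => t _; rewrite pE.
Qed.

Lemma continuous_integral (phi : R -> R -> R) (a u v M : R) :
  u < a < v ->
  (forall l, u < l < v -> measurable_fun [set: Rm] (phi l)) ->
  (forall l t : R, u < l < v -> {for l, continuous (phi^~ t)}) ->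
  (forall l t, u < l < v -> `|phi l t| <= M) ->
  {for a, continuous (fun l => \int[mu]_t (h t * phi l t))}.
Proof.
move=> uav mphi cphi phiM.
pose f l t := h t * phi l t.
have Ia : a \in `]u, v[%classic by rewrite inE/= in_itv.
have intf l : `]u, v[%classic l -> mu.-integrable [set: Rm] (EFin \o f l).
  by rewrite /= in_itv/= => Il; apply: (@integrable_mulh _ M); [exact: mphi|move=> t; exact: phiM].
have iG : mu.-integrable [set: Rm] (EFin \o (fun t => h t * `|M|)).
  by apply: (@integrable_mulh (fun=> `|M|) `|M|) => // t; rewrite normr_id.
apply: (continuity_under_integral measurableT intf _ iG _ Ia).
- apply/aeW => t _ l /set_mem; rewrite /= in_itv/= => Il.
  by apply: cvgM; [exact: cvg_cst|exact: cphi].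
- move=> l; rewrite /= in_itv/= => Il; apply/aeW => t _.
  by rewrite normrM (ger0_norm (h0 t)) ler_wpM2l// (le_trans (phiM _ _ Il)) ?ler_norm.
Qed.

Lemma measurable_Rintegral d (T : measurableType d) (f : T * Rm -> R) :
  measurable_fun [set: T * Rm] f ->
  measurable_fun [set: T] (fun z => \int[mu]_t f (z, t)).
Proof.
move=> mf.
have m1 : measurable_fun [set: T] (fubini_F mu (fun z : T * Rm => (EFin \o f)^\+%E z)).
  apply: measurable_fun_fubini_tonelli_F => //.
  by apply: measurable_funepos; exact/measurable_EFinP.
have m2 : measurable_fun [set: T] (fubini_F mu (fun z : T * Rm => (EFin \o f)^\-%E z)).
  apply: measurable_fun_fubini_tonelli_F => //.
  by apply: measurable_funeneg; exact/measurable_EFinP.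
rewrite /Rintegral; apply: (@measurableT_comp _ _ _ _ _ _ fine) => //.
apply: (eq_measurable_fun _ _ (emeasurable_funB m1 m2)) => z _.
rewrite [RHS]integralE /fubini_F; congr (_ - _)%E; apply: eq_integral => t _;
  by rewrite ?funeposE ?funenegE.
Qed.

Lemma measurable_comp2 d (T : measurableType d) (k : R -> R -> R) (f g : T -> R) :
  measurable_fun [set: Rm * Rm] (fun z : R * R => k z.1 z.2) ->
  measurable_fun setT f -> measurable_fun setT g ->
  measurable_fun setT (fun z => k (f z) (g z)).
Proof.
move=> mk mf mg.
apply: (@measurableT_comp _ _ _ _ _ _ (fun z : Rm * Rm => k z.1 z.2) _
  (fun z => (f z : Rm, g z : Rm)) mk).
by apply/measurable_fun_pairP; split; [exact: mf|exact: mg].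
Qed.

Lemma measurable_cv (k : R -> R -> R) :
  measurable_fun [set: Rm * Rm] (fun z : R * R => k z.1 z.2) ->
  measurable_fun [set: Rm * Rm] (fun z : R * R => cv k z.1 z.2).
Proof.
move=> mk.
apply: (@measurable_Rintegral _ (Rm * Rm)%type (fun z : (Rm * Rm) * Rm => h z.2 * k (z.1.1 - z.2) z.1.2)).
apply: measurable_funM; first by apply: (measurableT_comp mh); exact: measurable_snd.
apply: (measurable_comp2 mk).
- apply: measurable_funB; last exact: measurable_snd.
  exact: (measurableT_comp measurable_fst measurable_fst).
- exact: (measurableT_comp measurable_snd measurable_fst).
Qed.

(** Boundedness away from the boundary of the half-plane; with [h] integrable it
    provides the dominating functions for differentiation under the integral. *)
Definition locally_bounded_kernel (k : R -> R -> R) := forall s, 0 < s ->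
  exists M, forall x y, s <= y -> `|k x y| <= M.

Lemma measurable_slice (k : R -> R -> R) x y :
  measurable_fun [set: Rm * Rm] (fun z : R * R => k z.1 z.2) ->
  measurable_fun [set: Rm] (fun t => k (x - t) y).
Proof.
move=> mk; apply: (measurable_comp2 mk); last exact: measurable_cst.
exact: measurable_funB.
Qed.

Section derive_cv.
Variables k k' : R -> R -> R.
Hypothesis mk : measurable_fun [set: Rm * Rm] (fun z : R * R => k z.1 z.2).
Hypothesis bk : locally_bounded_kernel k.

Lemma is_derive_cv_x (x y : R) : 0 < y -> locally_bounded_kernel k' ->
  (forall x y : R, 0 < y -> is_derive x 1 (k^~ y) (k' x y)) ->
  is_derive x 1 ((cv k)^~ y) (cv k' x y).
Proof.
move=> y0 bk' dk; have [M kM] := bk y0; have [M' kM'] := bk' y y0.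
apply: (@is_derive_integral (fun l t => k (l - t) y) (fun l t => k' (l - t) y) x (x - 1) (x + 1) (Num.max M M')).
- by rewrite ltrBlDr !ltrDl !ltr01.
- by move=> l _; exact: measurable_slice.
- move=> l t _; have := is_derive1_comp (f := k^~ y) (g := fun l => l - t) (dk (l - t) y y0)
    (is_deriveB (is_derive_id l 1) (is_derive_cst t l 1)).
  by rewrite subr0 mulr1.
- by move=> l t _; rewrite le_max kM.
- by move=> l t _; rewrite le_max kM' ?orbT.
Qed.

Lemma is_derive_cv_y (x y : R) : 0 < y -> locally_bounded_kernel k' ->
  (forall x y : R, 0 < y -> is_derive y 1 (k x) (k' x y)) ->
  is_derive y 1 (cv k x) (cv k' x y).
Proof.
move=> y0 bk' dk; have y2 : 0 < y / 2 by rewrite divr_gt0.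
have [M kM] := bk y2; have [M' kM'] := bk' _ y2.
apply: (@is_derive_integral (fun l t => k (x - t) l) (fun l t => k' (x - t) l) y (y / 2) (y + 1) (Num.max M M')).
- by rewrite ltrDl ltr01 ltr_pdivrMr// ltr_pMr// ltr1n.
- by move=> l _; exact: measurable_slice.
- by move=> l t /andP[yl _]; apply: dk; exact: lt_trans yl.
- by move=> l t /andP[yl _]; rewrite le_max kM// ltW.
- by move=> l t /andP[yl _]; rewrite le_max kM' ?orbT// ltW.
Qed.

Lemma continuous_cv_x (x y : R) : 0 < y ->
  (forall x y : R, 0 < y -> {for x, continuous (k^~ y)}) ->
  {for x, continuous ((cv k)^~ y)}.
Proof.
move=> y0 ck; have [M kM] := bk y0.
apply: (@continuous_integral (fun l t => k (l - t) y) x (x - 1) (x + 1) M).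
- by rewrite ltrBlDr !ltrDl !ltr01.
- by move=> l _; exact: measurable_slice.
- move=> l t _; apply: (@continuous_comp _ _ _ (fun l : R => l - t) (k^~ y)); last exact: ck.
  by apply: cvgB; [exact: cvg_id|exact: cvg_cst].
- by move=> l t _; exact: kM.
Qed.

Lemma continuous_cv_y (x y : R) : 0 < y ->
  (forall x y : R, 0 < y -> {for y, continuous (k x)}) ->
  {for y, continuous (cv k x)}.
Proof.
move=> y0 ck; have y2 : 0 < y / 2 by rewrite divr_gt0.
have [M kM] := bk y2.
apply: (@continuous_integral (fun l t => k (x - t) l) y (y / 2) (y + 1) M).
- by rewrite ltrDl ltr01 ltr_pdivrMr// ltr_pMr// ltr1n.
- by move=> l _; exact: measurable_slice.
- by move=> l t /andP[yl _]; apply: ck; exact: lt_trans yl.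
- by move=> l t /andP[yl _]; apply: kM; exact: ltW.
Qed.

End derive_cv.

Lemma measurable_ratio d (T : measurableType d) (f g : T -> R) :
  measurable_fun setT f -> measurable_fun setT g -> measurable_fun setT (fun z => f z / g z).
Proof. by move=> mf mg; apply: measurable_funM => //; exact: measurable_funV. Qed.

Let m1 : measurable_fun [set: Rm * Rm] (fun z : R * R => z.1). Proof. exact: measurable_fst. Qed.
Let m2 : measurable_fun [set: Rm * Rm] (fun z : R * R => z.2). Proof. exact: measurable_snd. Qed.
Let md : measurable_fun [set: Rm * Rm] (fun z : R * R => z.1 ^+ 2 + z.2 ^+ 2).
Proof. by apply: measurable_funD; exact: measurable_funX. Qed.

Lemma measurable_pker : measurable_fun [set: Rm * Rm] (fun z : R * R => pker z.1 z.2).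
Proof. exact: measurable_ratio. Qed.
Lemma measurable_qker : measurable_fun [set: Rm * Rm] (fun z : R * R => qker z.1 z.2).
Proof. exact: measurable_ratio. Qed.
Lemma measurable_pker_x : measurable_fun [set: Rm * Rm] (fun z : R * R => pker_x z.1 z.2).
Proof.
apply: measurable_ratio; last exact: measurable_funX.
by apply: measurable_funM => //; exact: measurable_funM.
Qed.
Lemma measurable_qker_x : measurable_fun [set: Rm * Rm] (fun z : R * R => qker_x z.1 z.2).
Proof.
apply: measurable_ratio; last exact: measurable_funX.
by apply: measurable_funB; exact: measurable_funX.
Qed.
Lemma measurable_pker_xx : measurable_fun [set: Rm * Rm] (fun z : R * R => pker_xx z.1 z.2).
Proof.
apply: measurable_ratio; last exact: measurable_funX.
apply: measurable_funB; last by apply: measurable_funM => //; exact: measurable_funX.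
by apply: measurable_funM => //; apply: measurable_funM => //; exact: measurable_funX.
Qed.
Lemma measurable_qker_xx : measurable_fun [set: Rm * Rm] (fun z : R * R => qker_xx z.1 z.2).
Proof.
apply: measurable_ratio; last exact: measurable_funX.
apply: measurable_funB; first by apply: measurable_funM => //; exact: measurable_funX.
by apply: measurable_funM; [exact: measurable_funM|exact: measurable_funX].
Qed.

Let bounded_by_pker (k : R -> R -> R) (c : R) n : 0 <= c ->
  (forall x y, 0 < y -> `|k x y| <= c * pker x y / y ^+ n) -> locally_bounded_kernel k.
Proof.
move=> c0 kc s s0; exists (c * s^-1 / s ^+ n) => x y sy.
have y0 := lt_le_trans s0 sy; apply: (le_trans (kc x y y0)).
have iys : y^-1 <= s^-1 by rewrite lef_pV2.
apply: ler_pM.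
- by rewrite mulr_ge0// ltW// pker_gt0.
- by rewrite invr_ge0 exprn_ge0// ltW.
- by rewrite ler_wpM2l// (le_trans (pker_le x y0)).
- by rewrite -!exprVn lerXn2r ?nnegrE ?invr_ge0 ?(ltW s0) ?(ltW y0).
Qed.

Lemma lb_pker : locally_bounded_kernel pker.
Proof. by apply: (@bounded_by_pker _ 1 0) => // x y y0; rewrite norm_pker// expr0 divr1 mul1r. Qed.
Lemma lb_qker : locally_bounded_kernel qker.
Proof.
move=> s s0; exists s^-1 => x y sy; have y0 := lt_le_trans s0 sy.
by rewrite (le_trans (qker_le x y0))// lef_pV2.
Qed.
Lemma lb_pker_x : locally_bounded_kernel pker_x.
Proof. by apply: (@bounded_by_pker _ 1 1) => // x y y0; rewrite mul1r pker_x_le. Qed.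
Lemma lb_qker_x : locally_bounded_kernel qker_x.
Proof. by apply: (@bounded_by_pker _ 1 1) => // x y y0; rewrite mul1r qker_x_le. Qed.
Lemma lb_pker_xx : locally_bounded_kernel pker_xx.
Proof. by apply: (@bounded_by_pker _ 2 2) => // x y y0; exact: pker_xx_le. Qed.
Lemma lb_qker_xx : locally_bounded_kernel qker_xx.
Proof. by apply: (@bounded_by_pker _ 2 2) => // x y y0; exact: qker_xx_le. Qed.
Lemma lb_oppk k : locally_bounded_kernel k -> locally_bounded_kernel (fun x y => - k x y).
Proof. by move=> bk s /bk[M kM]; exists M => x y sy; rewrite normrN kM. Qed.

Lemma integrable_cv k (x y : R) :
  measurable_fun [set: Rm * Rm] (fun z : R * R => k z.1 z.2) ->
  locally_bounded_kernel k -> 0 < y ->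
  mu.-integrable [set: Rm] (fun t => (h t * k (x - t) y)%:E).
Proof.
move=> mk bk y0; have [M kM] := bk y y0.
by apply: (@integrable_mulh _ M) => [|t]; [exact: measurable_slice|exact: kM].
Qed.

Lemma cvN k (x y : R) :
  measurable_fun [set: Rm * Rm] (fun z : R * R => k z.1 z.2) ->
  locally_bounded_kernel k -> 0 < y ->
  cv (fun x y => - k x y) x y = - cv k x y.
Proof.
move=> mk bk y0; rewrite /cv -mulN1r -RintegralZl//; last exact: integrable_cv.
by apply: eq_Rintegral => t _; ring.
Qed.

Lemma cv_le k (x y c : R) :
  measurable_fun [set: Rm * Rm] (fun z : R * R => k z.1 z.2) ->
  locally_bounded_kernel k -> 0 < y ->
  (forall x, `|k x y| <= c * pker x y) -> `|cv k x y| <= c * cv pker x y.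
Proof.
move=> mk bk y0 kc; have ik := integrable_cv x mk bk y0.
have ip := integrable_cv x measurable_pker lb_pker y0.
apply: (le_trans (le_normr_Rintegral measurableT ik)).
rewrite /cv -RintegralZl//; apply: le_Rintegral => //.
- exact: integrable_norm.
- exact: (integrableZl measurableT c ip).
- by move=> t _; rewrite normrM (ger0_norm (h0 t)) mulrCA ler_wpM2l.
Qed.

Lemma cv_pker_ge0 (x y : R) : 0 < y -> 0 <= cv pker x y.
Proof.
by move=> y0; apply: Rintegral_ge0 => t _; rewrite mulr_ge0// ltW// pker_gt0.
Qed.

Lemma cv_pker_eq0 (x y : R) : 0 < y -> cv pker x y = 0 ->
  {ae mu, forall t : Rm, h t = 0}.
Proof.
move=> y0 e; have ip := integrable_cv x measurable_pker lb_pker y0.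
have : (\int[mu]_t `|(h t * pker (x - t) y)%:E| = 0)%E.
  rewrite (eq_integral (fun t : Rm => (h t * pker (x - t) y)%:E)); last first.
    by move=> t _; rewrite abse_EFin ger0_norm// mulr_ge0// ltW// pker_gt0.
  have := integrable_fin_num measurableT ip => /fineK <-.
  by rewrite -[X in _ = X%:E]e.
move/(ae_eq_integral_abs mu measurableT (measurable_int mu ip)).
apply: filterS => t /(_ I) [] /eqP; rewrite mulf_eq0 => /orP[/eqP//|].
by rewrite gt_eqF// pker_gt0.
Qed.

Hypothesis ih1 : mu.-integrable [set: Rm] (fun t => (h t * `|t|)%:E).

(** For [y >= n] the kernel is at most [1 / n]. For [|x| >= n] write [x = (x - t) + t]:
    the product of [x - t] with the kernel is bounded, and the product with [t] is
    controlled by the first moment of [h]. *)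
Lemma cv_decay k (s : R) :
  measurable_fun [set: Rm * Rm] (fun z : R * R => k z.1 z.2) ->
  locally_bounded_kernel k -> 0 < s ->
  (forall x y : R, 0 < y -> `|k x y| <= y^-1) ->
  (forall x y : R, 0 < y -> `|x| * `|k x y| <= 1) ->
  forall x y n : R, s <= y -> 0 < n -> (n <= `|x|) || (n <= y) ->
  `|cv k x y| <= (\int[mu]_t (h t + h t * `|t| * s^-1)) / n.
Proof.
move=> mk bk s0 k1 k2 x y n sy n0 nxy; have y0 := lt_le_trans s0 sy.
have ik := integrable_cv x mk bk y0.
have i2 : mu.-integrable [set: Rm] (EFin \o (fun t => h t + h t * `|t| * s^-1)).
  rewrite (_ : EFin \o _ = (fun t => ((h t)%:E + (s^-1)%:E * (h t * `|t|)%:E)%E)).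
    by apply: integrableD => //; exact: integrableZl.
  by apply/funext => t /=; rewrite EFinD (mulrC _ s^-1) EFinM.
apply: (le_trans (le_normr_Rintegral measurableT ik)).
rewrite ler_pdivlMr// mulrC -RintegralZl//; last exact: integrable_norm.
apply: le_Rintegral => //.
- exact: (integrableZl measurableT n (integrable_norm ik)).
- move=> t _; rewrite normrM (ger0_norm (h0 t)) mulrCA -mulrA -[X in _ <= X + _]mulr1 -mulrDr.
  rewrite ler_wpM2l//.
  have kt := k1 (x - t) y y0; have kt2 := k2 (x - t) y y0.
  have iys : y^-1 <= s^-1 by rewrite lef_pV2.
  have ts : 0 <= `|t| * s^-1 by rewrite mulr_ge0// invr_ge0 ltW.
  case/orP: nxy => [nx|ny].
    apply: (@le_trans _ _ (`|x - t| * `|k (x - t) y| + `|t| * `|k (x - t) y|)).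
      by rewrite -mulrDl ler_wpM2r// (le_trans nx)// -[X in `|X| <= _](subrK t) ler_normD.
    by rewrite lerD// ler_wpM2l// (le_trans kt).
  rewrite (@le_trans _ _ 1) ?lerDl// (le_trans (ler_wpM2l (ltW n0) kt))//.
  by rewrite ler_pdivrMr// mul1r.
Qed.

Lemma stein_conv_rectangle (p s n : R) : 1 < p -> p <= 2 -> 0 < s ->
  (forall x y : R, 0 < y -> 0 < cv pker x y) -> s < n ->
  let W x := bellman p (cv pker x s) (cv qker x s) in
  let K := \int[mu]_t (h t + h t * `|t| * s^-1) in
  let c1 := 4 * (p / (p - 1) * p + 2 * p) + 2 * (p / (p - 1) + 1) in
  mu.-integrable `[- n, n] (fun x => (W x)%:E) /\
  ((- ((2 * (K / n) ^+ 2) `^ (p / 2) * n * c1))%:E <=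
    \int[mu]_(x in `[(- n)%R, n]) (W x)%:E)%E.
Proof.
move=> p1 p2 s0 U0 sn W K c1;  apply: (@stein_rectangle R (cv pker) (cv qker) (cv pker_x) (cv qker_x)
   (cv pker_xx) (cv qker_xx) p s (\int[mu]_t (h t + h t * `|t| * s^-1))) => //.
- by move=> x y y0; apply: is_derive_cv_x => //; [exact: measurable_pker|exact: lb_pker|exact: lb_pker_x|exact: is_derive_pker_x].
- by move=> x y y0; apply: is_derive_cv_x => //; [exact: measurable_qker|exact: lb_qker|exact: lb_qker_x|exact: is_derive_qker_x].
- by move=> x y y0; apply: is_derive_cv_x => //; [exact: measurable_pker_x|exact: lb_pker_x|exact: lb_pker_xx|exact: is_derive_pker_xx].
- by move=> x y y0; apply: is_derive_cv_x => //; [exact: measurable_qker_x|exact: lb_qker_x|exact: lb_qker_xx|exact: is_derive_qker_xx].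
- move=> x y y0; rewrite -cvN//; [|exact: measurable_qker_x|exact: lb_qker_x].
  by apply: (@is_derive_cv_y pker (fun x y => - qker_x x y)) => //; [exact: measurable_pker|exact: lb_pker|apply: lb_oppk; exact: lb_qker_x|exact: is_derive_pker_y].
- by move=> x y y0; apply: is_derive_cv_y => //; [exact: measurable_qker|exact: lb_qker|exact: lb_pker_x|exact: is_derive_qker_y].
- move=> x y y0; rewrite -cvN//; [|exact: measurable_qker_xx|exact: lb_qker_xx].
  by apply: (@is_derive_cv_y pker_x (fun x y => - qker_xx x y)) => //; [exact: measurable_pker_x|exact: lb_pker_x|apply: lb_oppk; exact: lb_qker_xx|exact: is_derive_pker_xy].
- by move=> x y y0; apply: is_derive_cv_y => //; [exact: measurable_qker_x|exact: lb_qker_x|exact: lb_pker_xx|exact: is_derive_qker_xy].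
- by move=> x y y0; apply: continuous_cv_x => //; [exact: measurable_pker_xx|exact: lb_pker_xx|exact: continuous_pker_xx_x].
- by move=> x y y0; apply: continuous_cv_x => //; [exact: measurable_qker_xx|exact: lb_qker_xx|exact: continuous_qker_xx_x].
- by move=> x y y0; apply: continuous_cv_y => //; [exact: measurable_pker_xx|exact: lb_pker_xx|exact: continuous_pker_xx_y].
- by move=> x y y0; apply: continuous_cv_y => //; [exact: measurable_qker_xx|exact: lb_qker_xx|exact: continuous_qker_xx_y].
- move=> x y y0; rewrite mulrC; apply: cv_le => // [||z]; [exact: measurable_pker_x|exact: lb_pker_x|].
  by rewrite mulrC pker_x_le.
- move=> x y y0; rewrite mulrC; apply: cv_le => // [||z]; [exact: measurable_qker_x|exact: lb_qker_x|].
  by rewrite mulrC qker_x_le.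
- move=> x y y0; rewrite mulrAC; apply: cv_le => // [||z]; [exact: measurable_pker_xx|exact: lb_pker_xx|].
  by rewrite mulrAC pker_xx_le.
- move=> x y y0; rewrite mulrAC; apply: cv_le => // [||z]; [exact: measurable_qker_xx|exact: lb_qker_xx|].
  by rewrite mulrAC qker_xx_le.
- exact: measurable_cv measurable_pker.
- exact: measurable_cv measurable_qker.
- exact: measurable_cv measurable_pker_x.
- exact: measurable_cv measurable_qker_x.
- exact: measurable_cv measurable_pker_xx.
- exact: measurable_cv measurable_qker_xx.
- move=> x y m sy m0 mxy; split; apply: cv_decay => //.
  + exact: measurable_pker.
  + exact: lb_pker.
  + by move=> x' y' y'0; rewrite norm_pker// pker_le.
  + exact: mulr_pker_le1.
  + exact: measurable_qker.
  + exact: lb_qker.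
  + exact: qker_le.
  + exact: mulr_qker_le1.
Qed.

(** Since [|V| `^ p <= p / (p - 1) * U `^ p - W] for [W = bellman p U V], it is enough
    to know that the integral of [W] over the interval of radius [n] has a lower bound
    tending to [0]; by [stein_conv_rectangle] it is at least a negative multiple of [n
    `^ (1 - p)]. *)
Lemma stein_conv (p s : R) : 1 < p -> p <= 2 -> 0 < s ->
  (\int[mu]_x (`|cv qker x s| `^ p)%:E <=
   (p / (p - 1))%:E * \int[mu]_x (cv pker x s `^ p)%:E)%E.
Proof.
move=> p1 p2 s0; have p0 : 0 < p by exact: lt_trans p1.
have l0 : 0 < p / (p - 1) by rewrite divr_gt0// subr_gt0.
(* If the Poisson integral vanishes at one point, then [h = 0] almost everywhere;
   otherwise it is positive, and [bellman] is smooth along it. *)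
have [[x0 [y0 [y00 e0]]]|nz] := pselect (exists x y : R, 0 < y /\ cv pker x y = 0).
  have cq0 x : cv qker x s = 0.
    rewrite /cv /Rintegral (ae_eq_integral (cst 0%E)) ?integral0//.
      by apply: (measurable_int mu); exact: (integrable_cv x measurable_qker lb_qker s0).
    by apply: filterS (cv_pker_eq0 y00 e0) => t -> _; rewrite mul0r.
  rewrite integral0_eq; last by move=> x _; rewrite cq0 normr0 powR0// gt_eqF.
  rewrite mule_ge0 ?lee_fin ?(ltW l0)//; apply: integral_ge0 => x _.
  by rewrite lee_fin powR_ge0.
have U0 (x y : R) : 0 < y -> 0 < cv pker x y.
  move=> y0; rewrite lt_neqAle cv_pker_ge0// andbT; apply/negP => /eqP e.
  by apply: nz; exists x, y; split => //.
set K := \int[mu]_t (h t + h t * `|t| * s^-1).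
pose W x := bellman p (cv pker x s) (cv qker x s).
pose c1 := 4 * (p / (p - 1) * p + 2 * p) + 2 * (p / (p - 1) + 1).
have mcq : measurable_fun [set: Rm] (fun x => `|cv qker x s| `^ p).
  apply: measurable_powR_comp; apply: (measurableT_comp (@normr_measurable R setT)).
  by apply: (measurable_comp2 (k := cv qker)) => //; exact: measurable_cv measurable_qker.
have mcp : measurable_fun [set: Rm] (fun x => cv pker x s `^ p).
  apply: measurable_powR_comp.
  by apply: (measurable_comp2 (k := cv pker)) => //; exact: measurable_cv measurable_pker.
have mW : measurable_fun [set: Rm] W.
  apply: measurable_bellman.
    by apply: (measurable_comp2 (k := cv pker)) => //; exact: measurable_cv measurable_pker.
  by apply: (measurable_comp2 (k := cv qker)) => //; exact: measurable_cv measurable_qker.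
pose A (n : nat) : set Rm := `[- (n%:R : R), n%:R]%classic.
have mA n : measurable (A n) by exact: measurable_itv.
set I1 := (\int[mu]_x (cv pker x s `^ p)%:E)%E.
have [I1y|I1f] := eqVneq I1 +oo%E.
  by rewrite I1y gt0_muley ?leey// lte_fin.
have I10 : (0 <= I1)%E by apply: integral_ge0 => x _; rewrite lee_fin powR_ge0.
have iU : mu.-integrable [set: Rm] (fun x => (cv pker x s `^ p)%:E).
  apply/integrableP; split; first exact/measurable_EFinP.
  rewrite (eq_integral (fun x : Rm => (cv pker x s `^ p)%:E)); first by rewrite ltey.
  by move=> x _; rewrite abse_EFin ger0_norm// powR_ge0.
pose c2 := (2 * K ^+ 2) `^ (p / 2) * c1.
have bnd (n : nat) : s < n%:R ->
    (\int[mu]_(x in A n) (`|cv qker x s| `^ p)%:E <=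
      (p / (p - 1))%:E * I1 + (c2 * (n%:R^-1) `^ (p - 1))%:E)%E.
  move=> sn; have n0 : 0 < n%:R :> R := lt_trans s0 sn.
  have [iW0 he0] := stein_conv_rectangle p1 p2 s0 U0 sn.
  have iW : mu.-integrable (A n) (fun x => (W x)%:E) := iW0.
  move: he0; rewrite -/K -/c1.
  have -> : (2 * (K / n%:R) ^+ 2) `^ (p / 2) * n%:R * c1 = c2 * (n%:R^-1) `^ (p - 1).
    have in0 : 0 <= n%:R^-1 :> R by rewrite invr_ge0 ltW.
    have e : (n%:R^-1) `^ p = n%:R^-1 * (n%:R^-1) `^ (p - 1) :> R by rewrite mulr_powRB1.
    have hK : 0 <= 2 * K ^+ 2 by rewrite mulr_ge0// sqr_ge0.
    rewrite /c2 expr_div_n mulrA -exprVn (powRM _ hK (sqr_ge0 _)).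
    rewrite -(powR_mulrn 2 in0) -powRrM.
    have -> : 2%:R * (p / 2) = p by field.
    by rewrite e; field; rewrite gt_eqF.
  set e := c2 * _ => he0.
  have he : ((- e)%:E <= \int[mu]_(x in A n) (W x)%:E)%E := he0.
  have iUA : mu.-integrable (A n) (fun x => ((p / (p - 1))%:E * (cv pker x s `^ p)%:E)%E).
    by apply: integrableZl => //; exact: (integrableS measurableT).
  apply: (@le_trans _ _ (\int[mu]_(x in A n)
      ((p / (p - 1))%:E * (cv pker x s `^ p)%:E - (W x)%:E))%E).
    apply: ge0_le_integral => //.
    - by apply/measurable_EFinP/measurable_funTS.
    - by apply: (measurable_int mu); exact: integrableB.
    - move=> x _; rewrite -EFinM -EFinB lee_fin /W /bellman opprB addrCA subrr addr0.
      have -> : `|cv qker x s| `^ p = (cv qker x s ^+ 2) `^ (p / 2).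
        rewrite -(real_normK (num_real (cv qker x s))) -powR_mulrn// -powRrM.
        by congr (_ `^ _); field.
      apply: ge0_ler_powR; rewrite ?nnegrE ?sqr_ge0 ?addr_ge0 ?sqr_ge0//.
        by rewrite divr_ge0// ltW.
      by rewrite lerDr sqr_ge0.
  rewrite integralB//; apply: leeD; last by rewrite leeNl -EFinN.
    rewrite integralZl//; last exact: (integrableS measurableT).
    rewrite lee_pmul2l ?lte_fin//; apply: ge0_subset_integral => //.
      by apply/measurable_EFinP.
    by move=> x _; rewrite lee_fin powR_ge0.
have cvA : (\int[mu]_(x in A i) (`|cv qker x s| `^ p)%:E)%E @[i --> \oo] -->
    (\int[mu]_x (`|cv qker x s| `^ p)%:E)%E.
  have -> : [set: Rm] = \bigcup_i A i by rewrite /A bigcup_itvT.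
  apply: ge0_nondecreasing_set_cvg_integral => //.
  - move=> i j ij; apply/subsetPset => x; rewrite /A /= !in_itv/= => /andP[ix xi].
    by rewrite (le_trans _ ix) ?(le_trans xi) ?lerN2 ?ler_nat.
  - by move=> i; apply/measurable_EFinP/measurable_funTS.
rewrite -(cvg_lim _ cvA)//; apply/lee_addgt0Pr => e e0.
apply: lime_le; first by apply/cvg_ex; eexists; exact: cvA.
have cv0 : c2 * (n%:R^-1) `^ (p - 1) @[n --> \oo] --> c2 * 0.
  apply: cvgM; first exact: cvg_cst.
  have := @powR_cvg0 R (p - 1); rewrite subr_gt0 => /(_ p1) /cvg_at_rightP h'.
  rewrite -(cvg_shiftn 1)/=; apply: (h' (fun n => (n + 1)%:R^-1)); split.
    by move=> n; rewrite invr_gt0 addn1.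
  by under eq_fun do rewrite addn1; exact: (@cvg_harmonic R).
rewrite mulr0 in cv0.
have [N _ hN] : \forall n \near \oo, s < n%:R by exact: nbhs_infty_gtr.
near=> n.
have sn : s < n%:R by near: n; exact: nbhs_infty_gtr.
apply: (le_trans (bnd n sn)); rewrite leeD2l// lee_fin; near: n.
by apply: (cvgr_le 0) => //.
Unshelve. all: by end_near. Qed.

End conv.

(** * Invariance of Lebesgue measure, mass of the Poisson kernel *)

Section measure_preserving.
Context {R : realType}.
Local Notation Rm := (measurableTypeR R).
Local Notation mu := (@lebesgue_measure R).

Lemma integral_measure_preserving d (T : measurableType d)
    (m : {measure set T -> \bar R}) (phi : T -> T) (f : T -> \bar R) :
  measurable_fun setT phi ->
  (forall A, measurable A -> m (phi @^-1` A) = m A) ->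
  measurable_fun setT f ->
  (\int[m]_x f (phi x) = \int[m]_x f x)%E.
Proof.
move=> mphi hphi mf.
have ge0 (g : T -> \bar R) : measurable_fun setT g -> (forall x, 0 <= g x)%E ->
    (\int[m]_x g (phi x) = \int[m]_x g x)%E.
  move=> mg g0.
  rewrite -[LHS](ge0_integral_pushforward mphi m measurableT)//.
  by apply: eq_measure_integral => //= A mA _; exact: hphi.
rewrite -[LHS]/(\int[m]_x (f \o phi) x)%E [LHS]integralE [RHS]integralE funepos_comp funeneg_comp.
rewrite -(ge0 (f^\+)%E)//; last exact: measurable_funepos.
rewrite -(ge0 (f^\-)%E)//; last exact: measurable_funeneg.
Qed.

Lemma integral_oppr (f : R -> \bar R) : measurable_fun [set: Rm] f ->
  (\int[mu]_x f (- x)%R = \int[mu]_x f x)%E.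
Proof.
move=> mf; apply: (@integral_measure_preserving _ Rm mu (fun x : R => - x)) => //.
- exact: (@oppr_measurable R setT).
- by move=> A mA; exact: lebesgue_measureN.
Qed.

Lemma integral_shift (f : R -> \bar R) (a : R) : measurable_fun [set: Rm] f ->
  (\int[mu]_x f (x + a)%R = \int[mu]_x f x)%E.
Proof.
move=> mf; apply: (@integral_measure_preserving _ Rm mu (fun x : R => x + a)) => //.
- exact: measurable_funD.
- move=> A mA.
  have ms : measurable_fun [set: Rm] (fun x : Rm => x + a : Rm) by exact: measurable_funD.
  apply/esym; apply: (@lebesgue_measure_unique R (pushforward mu (fun x : Rm => x + a : Rm)) _ A mA) => _ [[b c]] _ <- /=.
  rewrite /pushforward (_ : _ @^-1` _ = `]b - a, c - a]%classic).
    rewrite !lebesgue_measure_itv/= !lte_fin ltrD2r; case: ifPn => // _.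
    by rewrite -!EFinD; congr (_%:E); ring.
  by apply/seteqP; split => x /=; rewrite !in_itv/= ltrBlDr lerBrDr.
Qed.

Lemma integral_reflect (f : R -> \bar R) (a : R) : measurable_fun [set: Rm] f ->
  (\int[mu]_x f (a - x)%R = \int[mu]_x f x)%E.
Proof.
move=> mf; rewrite -[RHS](integral_shift a mf) -[RHS]integral_oppr.
  by apply: eq_integral => x _; rewrite addrC.
by apply: (measurableT_comp mf); exact: measurable_funD.
Qed.

Lemma integral_pker (s : R) : 0 < s -> (\int[mu]_x (pker x s)%:E = pi%:E)%E.
Proof.
move=> s0.
have dat (x : R) : is_derive x 1 (fun x => atan (x / s)) (pker x s).
  have h1 : is_derive (x / s) 1 (@atan R) (1 + (x / s) ^+ 2)^-1.
    by apply: DeriveDef; [exact: derivable_atan|rewrite -derive1E derive1_atan].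
  have h2 : is_derive x 1 (fun x => x / s) (s^-1).
    have := is_deriveZ (s^-1) (is_derive_id x 1).
    rewrite /GRing.scale/= mulr1 (_ : s^-1 \*: id = (fun x => x / s))//.
    by apply/funext => y /=; rewrite /GRing.scale/= mulrC.
  have -> : pker x s = (1 + (x / s) ^+ 2)^-1 * s^-1.
    have D := ball_den_gt0 x s0; have D' : 0 < 1 + (x / s) ^+ 2 by rewrite ltr_pwDl ?sqr_ge0.
    rewrite /pker -invfM; apply: (mulIf (lt0r_neq0 D)); rewrite divfK ?gt_eqF//.
    have -> : x ^+ 2 + s ^+ 2 = (1 + (x / s) ^+ 2) * s * s by field; rewrite gt_eqF.
    by rewrite [RHS]mulrA mulVf ?mul1r// mulf_neq0 ?gt_eqF.
  have h := is_derive1_comp (g := fun x : R => x / s) h1 h2; exact: h.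
have cp : continuous (fun x => pker x s).
  by move=> x; exact: is_derive_continuous (is_derive_pker_x x s0).
rewrite ge0_symfun_integralT//; last 2 first.
- by move=> x; rewrite ltW// pker_gt0.
- by move=> x; rewrite /pker /= sqrrN.
rewrite (_ : [set x | _] = `[0, +oo[%classic); last first.
  by apply/seteqP; split => x /=; rewrite in_itv/= andbT.
rewrite (@ge0_continuous_FTC2y _ _ (fun x => atan (x / s)) 0 (pi / 2)).
- by rewrite mul0r atan0 sube0 -EFinM mulrC divfK.
- by move=> x _; rewrite ltW// pker_gt0.
- by apply: continuous_subspaceT.
- apply: (@cvg_comp _ _ _ (fun x => x / s) (@atan R)); last exact: cvgy_atan.
  by apply: gt0_cvgMly => //; rewrite invr_gt0.
- by move=> x _; have [] := dat x.
- by apply: cvg_at_right_filter; exact: is_derive_continuous (dat 0).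
- by move=> x _; rewrite derive1E; apply: derive_val; exact: dat.
Qed.

Lemma measurable_pker1 (s t : R) : measurable_fun [set: Rm] (fun x => pker (t - x) s).
Proof. exact: (measurable_slice (k := pker)) (@measurable_pker R). Qed.

Lemma integral_pker_reflect (s t : R) : 0 < s ->
  (\int[mu]_x (pker (t - x) s)%:E = pi%:E)%E.
Proof.
move=> s0; rewrite -(integral_pker s0).
apply: (integral_reflect (f := fun x => (pker x s)%:E)); apply/measurable_EFinP.
by apply: (measurable_comp2 (k := pker)) => //; exact: measurable_pker.
Qed.

Lemma integral_pker_shift (s t : R) : 0 < s ->
  (\int[mu]_x (pker (x - t) s)%:E = pi%:E)%E.
Proof.
move=> s0; rewrite -(integral_pker_reflect t s0); apply: eq_integral => x _.
by rewrite /pker -(sqrrN (x - t)) opprB.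
Qed.

End measure_preserving.

Section young.
Context {R : realType}.
Local Notation Rm := (measurableTypeR R).
Local Notation mu := (@lebesgue_measure R).
Variable h : R -> R.
Hypothesis mh : measurable_fun [set: Rm] h.
Hypothesis h0 : forall t, 0 <= h t.
Hypothesis ih : mu.-integrable [set: Rm] (EFin \o h).

(** The inequality of Jensen for the probability density [pker (x - t) s / pi]: Young's
    inequality for the numbers [h t] and [m `^ (p - 1)], where [m] is the mean of [h],
    is the tangent line of [u `^ p] at [m], and it is integrated in [t]. *)
Lemma cv_pker_powR_le (p s x : R) : 1 < p -> 0 < s ->
  ((cv h pker x s `^ p)%:E <=
   (pi `^ (p - 1))%:E * \int[mu]_t (h t `^ p * pker (x - t) s)%:E)%E.
Proof.
move=> p1 s0; have p0 : 0 < p by exact: lt_trans p1.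
have pip : 0 < pi `^ (p - 1) :> R by rewrite powR_gt0 ?pi_gt0.
set J := (\int[mu]_t _)%E.
have J0 : (0 <= J)%E.
  by apply: integral_ge0 => t _; rewrite lee_fin mulr_ge0 ?powR_ge0// ltW// pker_gt0.
have mJ : measurable_fun [set: Rm] (fun t => h t `^ p * pker (x - t) s).
  apply: measurable_funM; [exact: measurable_powR_comp|exact: measurable_pker1].
have [->|Jf] := eqVneq J +oo%E; first by rewrite gt0_muley ?leey// lte_fin.
have iJ : mu.-integrable [set: Rm] (fun t => (h t `^ p * pker (x - t) s)%:E).
  apply/integrableP; split; first exact/measurable_EFinP.
  rewrite (eq_integral (fun t : Rm => (h t `^ p * pker (x - t) s)%:E)).
    by rewrite -/J ltey.
  by move=> t _; rewrite abse_EFin ger0_norm// mulr_ge0 ?powR_ge0// ltW// pker_gt0.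
have iP : mu.-integrable [set: Rm] (fun t => (pker (x - t) s)%:E).
  apply/integrableP; split; first by apply/measurable_EFinP; exact: measurable_pker1.
  rewrite (eq_integral (fun t : Rm => (pker (x - t) s)%:E)).
    by rewrite integral_pker_reflect ?ltry.
  by move=> t _; rewrite abse_EFin ger0_norm// ltW// pker_gt0.
have ic := integrable_cv mh h0 ih x (@measurable_pker R) (@lb_pker R) s0.
set U := cv h pker x s; set m := U / pi.
have U0 : 0 <= U by exact: cv_pker_ge0.
have m0 : 0 <= m by rewrite divr_ge0// pi_ge0.
pose q := p / (p - 1).
have pm10 : p - 1 != 0 by rewrite subr_eq0 gt_eqF.
have pn0 : p != 0 by rewrite gt_eqF.
have q0 : 0 < q by rewrite divr_gt0// subr_gt0.
have pq : p^-1 + q^-1 = 1 by rewrite /q; field; rewrite pm10 pn0.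
have tang t : h t * m `^ (p - 1) <= h t `^ p / p + m `^ p / q.
  have := conjugate_powR (h0 t) (powR_ge0 m (p - 1)) p0 q0 pq.
  rewrite -powRrM (_ : (p - 1) * q = p)//.
  by rewrite /q; field.
have le1 : U * m `^ (p - 1) <= p^-1 * fine J + m `^ p / q * pi.
  have -> : fine J = \int[mu]_t (h t `^ p * pker (x - t) s) by [].
  have -> : pi = \int[mu]_t pker (x - t) s :> R.
    by rewrite /Rintegral integral_pker_reflect.
  rewrite mulrC /U /cv -!RintegralZl// -RintegralD//; [|exact: (integrableZl measurableT _ iJ)|exact: (integrableZl measurableT _ iP)].
  apply: le_Rintegral => //.
  - exact: (integrableZl measurableT _ ic).
  - have := integrableD measurableT (integrableZl measurableT p^-1 iJ) (integrableZl measurableT (m `^ p / q) iP); exact.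
  - move=> t _; have := ler_wpM2r (ltW (pker_gt0 (x - t) s0)) (tang t).
    by rewrite mulrDl; congr (_ <= _); ring.
have le2 : pi * m `^ p <= fine J.
  move: le1; have -> : U = pi * m by rewrite /m mulrC divfK// gt_eqF// pi_gt0.
  rewrite -mulrA mulr_powRB1// => le1.
  have q1 : q^-1 = 1 - p^-1 by rewrite -pq addrC addKr.
  have : p^-1 * (pi * m `^ p) <= p^-1 * fine J.
    rewrite -subr_ge0; move: le1; rewrite -subr_ge0 q1; congr (0 <= _); ring.
  by rewrite ler_pM2l// invr_gt0.
have -> : U `^ p = pi `^ (p - 1) * (pi * m `^ p).
  have -> : U = pi * m by rewrite /m mulrC divfK// gt_eqF// pi_gt0.
  by rewrite powRM ?pi_ge0// -(mulr_powRB1 (pi_ge0 R) p0); ring.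
rewrite EFinM lee_pmul2l ?lte_fin// -(fineK (_ : J \is a fin_num)) ?lee_fin//.
by rewrite ge0_fin_numE// ltey.
Qed.

Lemma young_pker (p s : R) : 1 < p -> 0 < s ->
  (\int[mu]_x (cv h pker x s `^ p)%:E <= (pi `^ p)%:E * \int[mu]_t (h t `^ p)%:E)%E.
Proof.
move=> p1 s0; have p0 : 0 < p by exact: lt_trans p1.
pose F (z : Rm * Rm) := (h z.2 `^ p * pker (z.1 - z.2) s)%:E.
have F0 z : (0 <= F z)%E by rewrite lee_fin mulr_ge0 ?powR_ge0// ltW// pker_gt0.
have mF : measurable_fun setT F.
  apply/measurable_EFinP; apply: measurable_funM.
    apply: measurable_powR_comp; apply: (measurableT_comp mh); exact: measurable_snd.
  apply: (measurable_comp2 (k := pker)) => //; first exact: measurable_pker.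
  by apply: measurable_funB; [exact: measurable_fst|exact: measurable_snd].
apply: (@le_trans _ _ (\int[mu]_x ((pi `^ (p - 1))%:E * \int[mu]_t F (x, t)))%E).
  apply: ge0_le_integral => //.
  - by move=> x _; rewrite lee_fin powR_ge0.
  - apply/measurable_EFinP; apply: measurable_powR_comp.
    apply: (measurable_comp2 (k := cv h pker)) => //.
    exact: measurable_cv (@measurable_pker R).
  - apply: emeasurable_funM => //; exact: (measurable_fun_fubini_tonelli_F F mF F0).
  - by move=> x _; exact: cv_pker_powR_le.
rewrite ge0_integralZl//; last 3 first.
- exact: (measurable_fun_fubini_tonelli_F F mF F0).
- by move=> x _; apply: integral_ge0.
- by rewrite lee_fin powR_ge0.
rewrite (fubini_tonelli F mF F0).
rewrite (eq_integral (fun t : Rm => (pi%:E * (h t `^ p)%:E)%E)); last first.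
  move=> t _; rewrite /F /=; under eq_integral do rewrite EFinM.
  rewrite ge0_integralZl//; last 3 first.
  - apply/measurable_EFinP; apply: (measurable_comp2 (k := pker)) => //; first exact: measurable_pker.
    exact: measurable_funB.
  - by move=> x _; rewrite lee_fin ltW// pker_gt0.
  - by rewrite lee_fin powR_ge0.
  by rewrite integral_pker_shift// muleC.
rewrite ge0_integralZl//; last 3 first.
- by apply/measurable_EFinP; exact: measurable_powR_comp.
- by move=> t _; rewrite lee_fin powR_ge0.
- by rewrite lee_fin pi_ge0.
by rewrite muleA -EFinM mulrC mulr_powRB1// pi_ge0.
Qed.

End young.

(** * Truncated Hilbert transforms of nonnegative functions *)

Section truncated.
Context {R : realType}.
Local Notation Rm := (measurableTypeR R).
Local Notation mu := (@lebesgue_measure R).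

Definition hker (e t : R) : R := if e <= `|t| <= e^-1 then t^-1 else 0.

Definition trunc_hilbert (e : R) (h : R -> R) (x : R) : R :=
  \int[mu]_t (h (x + t) * hker e t).

Lemma hkerN e t : hker e (- t) = - hker e t.
Proof. by rewrite /hker normrN invrN; case: ifP; rewrite ?oppr0. Qed.

Lemma hker_le e t : 0 < e -> `|hker e t| <= e^-1.
Proof.
move=> e0; rewrite /hker; case: ifP => [/andP[et _]|_].
  by rewrite normfV lef_pV2 ?posrE// (lt_le_trans e0).
by rewrite normr0 invr_ge0 ltW.
Qed.

Lemma measurable_hker e : measurable_fun [set: Rm] (hker e).
Proof.
have mn : measurable_fun [set: Rm] (fun t : R => `|t|) by exact: (@normr_measurable R setT).
have mb : measurable_fun [set: Rm] (fun t : R => e <= `|t| <= e^-1).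
  by apply: measurable_and; exact: measurable_fun_ler.
have mi : measurable_fun [set: Rm] (fun t : R => t^-1) by exact: measurable_funV.
exact: (measurable_fun_ifT mb mi (measurable_cst _)).
Qed.

Lemma measurable_trunc_hilbert (e : R) (h : R -> R) :
  measurable_fun [set: Rm] h -> measurable_fun [set: Rm] (trunc_hilbert e h).
Proof.
move=> mh; apply: (@measurable_Rintegral _ _ _ (fun z : Rm * Rm => h (z.1 + z.2) * hker e z.2)).
apply: measurable_funM.
  apply: (measurableT_comp mh).
  by apply: measurable_funD; [exact: measurable_fst|exact: measurable_snd].
by apply: (measurableT_comp (measurable_hker e)); exact: measurable_snd.
Qed.

Lemma invr_qker_le (x y : R) : 0 < y -> y <= `|x| -> `|x^-1 - qker x y| <= pker x y.
Proof.
move=> y0 yx; have D := ball_den_gt0 x y0.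
have x0 : x != 0 by rewrite -normr_gt0 (lt_le_trans y0).
have -> : x^-1 - qker x y = (y / x) * pker x y.
  by rewrite /qker /pker; field; rewrite x0 gt_eqF.
rewrite normrM norm_pker// ler_piMl ?(ltW (pker_gt0 x y0))//.
by rewrite normrM normfV (gtr0_norm y0) ler_pdivrMr ?normr_gt0// mul1r.
Qed.

Lemma qker_le_pker (x y : R) : 0 < y -> `|x| <= y -> `|qker x y| <= pker x y.
Proof.
move=> y0 xy; have D := ball_den_gt0 x y0.
by rewrite normrM normfV (gtr0_norm D) ler_wpM2r// invr_ge0 ltW.
Qed.

(** For [|t| >= e] the kernel [qker t e] is close to [t^-1], and subtracting [qker t
    e^-1] cuts it off beyond [e^-1]. The errors are at most Poisson kernels, whose mass
    is the same at all scales; hence bounds uniform in [e]. *)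
Lemma hker_qker_le e t : 0 < e -> e <= 1 ->
  `|hker e t - (qker t e - qker t e^-1)| <= pker t e + pker t e^-1.
Proof.
move=> e0 e1; have ie0 : 0 < e^-1 by rewrite invr_gt0.
have ie : e <= e^-1 by rewrite (le_trans e1)// invf_ge1.
rewrite /hker; case: (leP e `|t|) => [et|te] /=; last first.
  rewrite sub0r normrN (le_trans (ler_normB _ _))// lerD// qker_le_pker// ltW//.
  exact: lt_le_trans ie.
case: (leP `|t| e^-1) => [te|et'].
  rewrite opprB addrA addrAC (le_trans (ler_normD _ _))// lerD// ?invr_qker_le//.
  exact: qker_le_pker.
rewrite sub0r normrN -(subrKA t^-1) (le_trans (ler_normD _ _))// lerD//.
  by rewrite -normrN opprB invr_qker_le.
by rewrite invr_qker_le// ltW.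
Qed.

Section nonneg.
Variable h : R -> R.
Hypothesis mh : measurable_fun [set: Rm] h.
Hypothesis h0 : forall t, 0 <= h t.
Hypothesis ih : mu.-integrable [set: Rm] (EFin \o h).
Hypothesis ih1 : mu.-integrable [set: Rm] (fun t => (h t * `|t|)%:E).

Lemma trunc_hilbert_le (e x : R) : 0 < e -> e <= 1 ->
  `|trunc_hilbert e h x| <= `|cv h qker x e| + cv h pker x e
     + (`|cv h qker x e^-1| + cv h pker x e^-1).
Proof.
move=> e0 e1; have ie0 : 0 < e^-1 by rewrite invr_gt0.
have -> : trunc_hilbert e h x = - \int[mu]_t (h t * hker e (x - t)).
  have mk : measurable_fun [set: Rm] (fun t => h t * hker e (t - x)).
    apply: measurable_funM => //; apply: (measurableT_comp (measurable_hker e)).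
    exact: measurable_funB.
  have : (\int[mu]_t (h (x + t) * hker e t)%:E = \int[mu]_t (h t * hker e (t - x))%:E)%E.
    rewrite -(integral_shift (f := fun t => (h t * hker e (t - x))%:E) x); last exact/measurable_EFinP.
    by apply: eq_integral => t _; rewrite addrK addrC.
  rewrite /trunc_hilbert /Rintegral => ->; rewrite -fineN; congr fine.
  have mk' : measurable_fun [set: Rm] (fun t => hker e (x - t)).
    by apply: (measurableT_comp (measurable_hker e)); exact: measurable_funB.
  have ik : mu.-integrable [set: Rm] (fun t => (h t * hker e (x - t))%:E).
    by apply: (@integrable_mulh _ h mh h0 ih _ e^-1) => // t; exact: hker_le.
  rewrite -mulN1e -integralZl//; apply: eq_integral => t _.
  by rewrite -EFinM mulN1r -mulrN -hkerN opprB.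
rewrite normrN.
have iq s := integrable_cv mh h0 ih x (@measurable_qker R) (@lb_qker R) (y := s).
have ip s := integrable_cv mh h0 ih x (@measurable_pker R) (@lb_pker R) (y := s).
have mk' : measurable_fun [set: Rm] (fun t => hker e (x - t)).
  by apply: (measurableT_comp (measurable_hker e)); exact: measurable_funB.
have ik : mu.-integrable [set: Rm] (fun t => (h t * hker e (x - t))%:E).
  by apply: (@integrable_mulh _ h mh h0 ih _ e^-1) => // t; exact: hker_le.
set I := \int[mu]_t _.
have iqq := integrableB measurableT (iq e e0) (iq e^-1 ie0).
have eqq : cv h qker x e - cv h qker x e^-1 = \int[mu]_t (h t * qker (x - t) e - h t * qker (x - t) e^-1).
  by rewrite RintegralB//; [exact: iq|exact: iq].
have epp : cv h pker x e + cv h pker x e^-1 = \int[mu]_t (h t * pker (x - t) e + h t * pker (x - t) e^-1).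
  by rewrite RintegralD//; [exact: ip|exact: ip].
have main : `|I - (cv h qker x e - cv h qker x e^-1)| <= cv h pker x e + cv h pker x e^-1.
  rewrite eqq epp /I -RintegralB//.
  apply: (le_trans (le_normr_Rintegral measurableT _)); first exact: (integrableB measurableT ik iqq).
  apply: le_Rintegral => //.
  - exact: (integrable_norm (integrableB measurableT ik iqq)).
  - exact: (integrableD measurableT (ip e e0) (ip e^-1 ie0)).
  - move=> t _.
    have -> : h t * hker e (x - t) - (h t * qker (x - t) e - h t * qker (x - t) e^-1) =
      h t * (hker e (x - t) - (qker (x - t) e - qker (x - t) e^-1)) by ring.
    have -> : h t * pker (x - t) e + h t * pker (x - t) e^-1 =
      h t * (pker (x - t) e + pker (x - t) e^-1) by ring.
    by rewrite normrM (ger0_norm (h0 t)) ler_wpM2l// hker_qker_le.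
have := ler_normB (cv h qker x e) (cv h qker x e^-1).
have := ler_normD (I - (cv h qker x e - cv h qker x e^-1)) (cv h qker x e - cv h qker x e^-1).
by rewrite subrK; lra.
Qed.

Lemma powR_sum4_le (p a b c d : R) : 0 < p -> 0 <= a -> 0 <= b -> 0 <= c -> 0 <= d ->
  (a + b + (c + d)) `^ p <= 4 `^ p * (a `^ p + b `^ p + (c `^ p + d `^ p)).
Proof.
move=> p0 a0 b0 c0 d0; set m := Num.max (Num.max a b) (Num.max c d).
have m0 : 0 <= m by rewrite !le_max a0.
have am : a <= m by rewrite !le_max lexx.
have bm : b <= m by rewrite !le_max lexx orbT.
have cm : c <= m by rewrite !le_max lexx ?orbT.
have dm : d <= m by rewrite !le_max lexx ?orbT.
apply: (@le_trans _ _ ((4 * m) `^ p)).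
  by apply: ge0_ler_powR; rewrite ?nnegrE ?(ltW p0) ?mulr_ge0 ?addr_ge0//; lra.
rewrite powRM// ler_wpM2l ?powR_ge0//.
have pa := powR_ge0 a p; have pb := powR_ge0 b p; have pc := powR_ge0 c p; have pd := powR_ge0 d p.
have mp (u v : R) : Num.max u v `^ p <= u `^ p + v `^ p.
  have pu := powR_ge0 u p; have pv := powR_ge0 v p.
  by case: (leP u v) => _; rewrite ?lerDl ?lerDr.
exact: le_trans (mp _ _) (lerD (mp _ _) (mp _ _)).
Qed.

Lemma le_integralD (f g : R -> R) (A B : \bar R) :
  measurable_fun [set: Rm] f -> measurable_fun [set: Rm] g ->
  (forall x, 0 <= f x) -> (forall x, 0 <= g x) ->
  (\int[mu]_x (f x)%:E <= A)%E -> (\int[mu]_x (g x)%:E <= B)%E ->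
  (\int[mu]_x (f x + g x)%:E <= A + B)%E.
Proof.
move=> mf mg f0 g0 fA gB.
have -> : (\int[mu]_x (f x + g x)%:E = \int[mu]_x ((f x)%:E + (g x)%:E))%E by [].
rewrite ge0_integralD//; first exact: leeD.
- by move=> x _; rewrite lee_fin.
- exact/measurable_EFinP.
- by move=> x _; rewrite lee_fin.
- exact/measurable_EFinP.
Qed.

(** Of the four terms of [trunc_hilbert_le], those with [qker] are reduced to those with
    [pker] by [stein_conv], which accounts for the condition [p <= 2], and these to [h]
    by [young_pker]. *)
Lemma trunc_hilbert_nonneg (p e : R) : 1 < p -> p <= 2 -> 0 < e -> e <= 1 ->
  (\int[mu]_x (`|trunc_hilbert e h x| `^ p)%:E <=
   (4 `^ p * (2 * (p / (p - 1) + 1)) * pi `^ p)%:E * \int[mu]_t (h t `^ p)%:E)%E.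
Proof.
move=> p1 p2 e0 e1; have ie0 : 0 < e^-1 by rewrite invr_gt0.
have p0 : 0 < p by exact: lt_trans p1.
have l0 : 0 < p / (p - 1) by rewrite divr_gt0// subr_gt0.
have J0 : (0 <= \int[mu]_t (h t `^ p)%:E)%E by apply: integral_ge0 => t _; rewrite lee_fin powR_ge0.
set J := (\int[mu]_t (h t `^ p)%:E)%E in J0 *.
have mT := measurable_trunc_hilbert e mh.
have mq s : measurable_fun [set: Rm] (fun x => `|cv h qker x s| `^ p).
  apply: measurable_powR_comp; apply: (measurableT_comp (@normr_measurable R setT)).
  by apply: (measurable_comp2 (k := cv h qker)) => //; exact: measurable_cv (@measurable_qker R).
have mp s : measurable_fun [set: Rm] (fun x => cv h pker x s `^ p).
  apply: measurable_powR_comp.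
  by apply: (measurable_comp2 (k := cv h pker)) => //; exact: measurable_cv (@measurable_pker R).
have bq s : 0 < s -> (\int[mu]_x (`|cv h qker x s| `^ p)%:E <= (p / (p - 1) * pi `^ p)%:E * J)%E.
  move=> s0; apply: (le_trans (stein_conv mh h0 ih ih1 p1 p2 s0)).
  rewrite [X in (_ <= X * _)%E]EFinM -[leRHS]muleA; apply: lee_wpmul2l; first by rewrite lee_fin ltW.
  exact: young_pker.
have bp s : 0 < s -> (\int[mu]_x (cv h pker x s `^ p)%:E <= (pi `^ p)%:E * J)%E.
  by move=> s0; exact: young_pker.
pose F x := `|cv h qker x e| `^ p + cv h pker x e `^ p + (`|cv h qker x e^-1| `^ p + cv h pker x e^-1 `^ p).
have mF : measurable_fun [set: Rm] F by apply: measurable_funD; exact: measurable_funD.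
apply: (@le_trans _ _ (\int[mu]_x ((4 `^ p)%:E * (F x)%:E))%E).
  apply: ge0_le_integral => //.
  - apply/measurable_EFinP; apply: measurable_powR_comp.
    exact: (measurableT_comp (@normr_measurable R setT)).
  - by apply: emeasurable_funM => //; exact/measurable_EFinP.
  - move=> x _; rewrite -EFinM lee_fin.
    apply: (le_trans (y := (`|cv h qker x e| + cv h pker x e + (`|cv h qker x e^-1| + cv h pker x e^-1)) `^ p)).
      apply: ge0_ler_powR; rewrite ?nnegrE ?(ltW p0)//; last exact: trunc_hilbert_le.
      by rewrite !addr_ge0// cv_pker_ge0.
    by apply: powR_sum4_le => //; exact: cv_pker_ge0.
rewrite ge0_integralZl//; last 2 first.
- exact/measurable_EFinP.
- by move=> x _; rewrite lee_fin !addr_ge0// powR_ge0.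
rewrite -mulrA [X in (_ <= X * _)%E]EFinM -[leRHS]muleA; apply: lee_wpmul2l; first by rewrite lee_fin powR_ge0.
have -> : ((2 * (p / (p - 1) + 1) * pi `^ p)%:E * J =
    (p / (p - 1) * pi `^ p)%:E * J + (pi `^ p)%:E * J
     + ((p / (p - 1) * pi `^ p)%:E * J + (pi `^ p)%:E * J))%E.
  rewrite -!ge0_muleDl ?lee_fin ?addr_ge0 ?mulr_ge0 ?powR_ge0 ?(ltW l0)//.
  by rewrite -!EFinD; congr (_%:E * _)%E; ring.
all: rewrite ?invr_ge0 ?subr_ge0 ?(ltW p0) ?(ltW p1)//.
pose G y x := `|cv h qker x y| `^ p + cv h pker x y `^ p.
have mG y : measurable_fun [set: Rm] (G y) by exact: measurable_funD.
have bG y : 0 < y -> (\int[mu]_x (G y x)%:E <= (p / (p - 1) * pi `^ p)%:E * J + (pi `^ p)%:E * J)%E.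
  move=> y0; apply: (@le_integralD (fun x => `|cv h qker x y| `^ p) (fun x => cv h pker x y `^ p)).
  - exact: mq.
  - exact: mp.
  - by move=> x; exact: powR_ge0.
  - by move=> x; exact: powR_ge0.
  - exact: bq.
  - exact: bp.
by apply: (@le_integralD (G e) (G e^-1)) => //; [move=> x|move=> x|exact: bG|exact: bG];
  rewrite addr_ge0// powR_ge0.
Qed.
End nonneg.
End truncated.

(** * Truncated Hilbert transforms of integrable functions *)

Section fubini_real.
Context {R : realType}.
Context d1 d2 (T1 : measurableType d1) (T2 : measurableType d2).
Variables (m1 : {sigma_finite_measure set T1 -> \bar R})
          (m2 : {sigma_finite_measure set T2 -> \bar R}).

Lemma Rintegral_prod1 (f : T1 * T2 -> R) :
  (m1 \x m2)%E.-integrable [set: T1 * T2] (EFin \o f) ->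
  \int[(m1 \x m2)%E]_z f z = \int[m1]_x \int[m2]_y f (x, y).
Proof.
move=> fi; rewrite /Rintegral -integral12_prod_meas1//; congr fine.
have mF := measurable_int _ (integrable_fubini_F fi).
have mG : measurable_fun [set: T1] (fun x => (fine (fubini_F m2 (EFin \o f) x))%:E).
  by apply/measurable_EFinP; exact: (measurableT_comp (f := fine)).
apply: ae_eq_integral => //.
have := ae_integrable1 fi; apply: filterS => x fx _ /=.
by rewrite /fubini_F fineK//; exact: integrable_fin_num.
Qed.

Lemma Rintegral_prod2 (f : T1 * T2 -> R) :
  (m1 \x m2)%E.-integrable [set: T1 * T2] (EFin \o f) ->
  \int[(m1 \x m2)%E]_z f z = \int[m2]_y \int[m1]_x f (x, y).
Proof.
move=> fi; rewrite /Rintegral -integral21_prod_meas1//; congr fine.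
have mF : measurable_fun [set: T2] (fubini_G m1 (EFin \o f)) by exact: measurable_fubini_G fi.
have mG : measurable_fun [set: T2] (fun x => (fine (fubini_G m1 (EFin \o f) x))%:E).
  by apply/measurable_EFinP; exact: (measurableT_comp (f := fine)).
apply: ae_eq_integral => //.
have := ae_integrable2 fi; apply: filterS => x fx _ /=.
by rewrite /fubini_G fineK//; exact: integrable_fin_num.
Qed.

Lemma integrable_Rintegral1 (f : T1 * T2 -> R) :
  (m1 \x m2)%E.-integrable [set: T1 * T2] (EFin \o f) ->
  m1.-integrable [set: T1] (fun x => (\int[m2]_y f (x, y))%:E).
Proof.
move=> fi; have iF := integrable_fubini_F fi; have mF := measurable_int _ iF.
apply: (le_integrable measurableT _ _ iF).
  by apply/measurable_EFinP; exact: (measurableT_comp (f := fine)).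
move=> x _; rewrite /Rintegral -/(fubini_F m2 (EFin \o f) x).
by case: (fubini_F _ _ _) => [r| |] //=; rewrite normr0 leey.
Qed.

Lemma integrable_prod_dominated (A : T1 -> R) (F : T1 * T2 -> R) (K : R) :
  m1.-integrable [set: T1] (EFin \o A) -> measurable_fun [set: T1 * T2] F ->
  (forall x, (\int[m2]_y (`|F (x, y)|)%:E <= K%:E)%E) ->
  (m1 \x m2)%E.-integrable [set: T1 * T2] (fun z => (A z.1 * F z)%:E).
Proof.
move=> iA mF FK.
have mA : measurable_fun [set: T1] A by apply/measurable_EFinP; exact: measurable_int iA.
have mAF : measurable_fun [set: T1 * T2] (fun z => (A z.1 * F z)%:E).
  by apply/measurable_EFinP; apply: measurable_funM => //; exact: (measurableT_comp mA measurable_fst).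
apply/(integrable12ltyP m1 m2) => //.
apply: (@le_lt_trans _ _ (\int[m1]_x (K%:E * (`|A x|)%:E))%E).
  apply: ge0_le_integral => //.
  - by move=> x _; exact: integral_ge0.
  - apply: (measurable_fun_fubini_tonelli_F (fun z => `|(A z.1 * F z)%:E|%E)) => //.
    exact: measurableT_comp.
  - by apply: emeasurable_funM => //; apply/measurable_EFinP; exact: measurableT_comp.
  - move=> x _; have mFx : measurable_fun [set: T2] (fun y => (`|F (x, y)|)%:E).
      apply/measurable_EFinP; apply: measurableT_comp => //.
      by apply: (measurableT_comp mF); exact: measurable_pair1.
    under eq_integral do rewrite /= normrM EFinM.
    rewrite ge0_integralZl// muleC; apply: lee_wpmul2r => //.
rewrite integralZl//; last exact: (integrable_norm iA).
by rewrite ltey_eq fin_numM//; apply: (integrable_fin_num measurableT); exact: (integrable_norm iA).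
Qed.

End fubini_real.

Section signed.
Context {R : realType}.
Local Notation Rm := (measurableTypeR R).
Local Notation mu := (@lebesgue_measure R).

Lemma integrable_shift (f : R -> R) (a : R) :
  mu.-integrable [set: Rm] (EFin \o f) ->
  mu.-integrable [set: Rm] (fun t => (f (t + a))%:E).
Proof.
move=> fi; have mf : measurable_fun [set: Rm] f by apply/measurable_EFinP; exact: measurable_int fi.
have ms : measurable_fun [set: Rm] (fun t : R => f (t + a)).
  by apply: (measurableT_comp mf); exact: measurable_funD.
apply/integrableP; split; first exact/measurable_EFinP.
rewrite (integral_shift (f := fun t => `|(f t)%:E|%E)); first by case/integrableP : fi.
by apply: measurableT_comp => //; exact/measurable_EFinP.
Qed.

Lemma integrable_mul_bounded d (T : measurableType d) (m : {measure set T -> \bar R})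
    (f phi : T -> R) (M : R) :
  m.-integrable [set: T] (EFin \o f) -> measurable_fun [set: T] phi ->
  (forall t, `|phi t| <= M) -> m.-integrable [set: T] (fun t => (f t * phi t)%:E).
Proof.
move=> fi mphi phiM; have mf : measurable_fun [set: T] f by apply/measurable_EFinP; exact: measurable_int fi.
apply: (@le_integrable _ _ _ m _ measurableT _ (fun t => (M%:E * `|(f t)%:E|)%E)) => //.
- by apply/measurable_EFinP; exact: measurable_funM.
- move=> t _; change ((`|f t * phi t|)%:E <= (`|M * `|f t| |)%:E)%E.
  rewrite lee_fin !normrM normr_id [leRHS]mulrC ler_wpM2l//.
  exact: le_trans (phiM t) (ler_norm _).
- by apply: integrableZl => //; exact: integrable_abse.
Qed.

Lemma trunc_hilbertB (e : R) (a b : R -> R) (x : R) : 0 < e ->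
  mu.-integrable [set: Rm] (EFin \o a) -> mu.-integrable [set: Rm] (EFin \o b) ->
  trunc_hilbert e (fun t => a t - b t) x = trunc_hilbert e a x - trunc_hilbert e b x.
Proof.
move=> e0 ia ib.
have I (c : R -> R) : mu.-integrable [set: Rm] (EFin \o c) ->
    mu.-integrable [set: Rm] (fun t => (c (x + t) * hker e t)%:E).
  move=> ic; apply: (@integrable_mul_bounded _ Rm mu (fun t => c (x + t)) _ e^-1); last 2 first.
  - exact: measurable_hker.
  - by move=> t; exact: hker_le.
  by have := integrable_shift x ic; apply: eq_integrable => // t _ /=; rewrite addrC.
rewrite /trunc_hilbert -RintegralB//; [|exact: I|exact: I].
by apply: eq_Rintegral => t _; rewrite mulrBl.
Qed.

(** The constant of [trunc_hilbert_nonneg] for the positive and the negative part,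
    recombined by [powR_sum4_le]. *)
Definition hilbert_const (p : R) : R :=
  4 `^ p * (2 * (4 `^ p * (2 * (p / (p - 1) + 1)) * pi `^ p)).

Lemma hilbert_const_ge0 (p : R) : 1 < p -> 0 <= hilbert_const p.
Proof.
move=> p1; have p0 : 0 <= p / (p - 1).
  by rewrite divr_ge0 ?subr_ge0 ?(ltW p1)// ltW// (lt_trans _ p1).
by rewrite !mulr_ge0 ?addr_ge0 ?powR_ge0.
Qed.

Lemma trunc_hilbert_Lp (p e : R) (h : R -> R) : 1 < p -> p <= 2 -> 0 < e -> e <= 1 ->
  mu.-integrable [set: Rm] (EFin \o h) ->
  mu.-integrable [set: Rm] (fun t => (h t * `|t|)%:E) ->
  (\int[mu]_x (`|trunc_hilbert e h x| `^ p)%:E <=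
   (hilbert_const p)%:E * \int[mu]_t (`|h t| `^ p)%:E)%E.
Proof.
move=> p1 p2 e0 e1 ih ih1; have p0 : 0 < p by exact: lt_trans p1.
have mh : measurable_fun [set: Rm] h by apply/measurable_EFinP; exact: measurable_int ih.
pose a t := Num.max (h t) 0; pose b t := Num.max (- h t) 0.
have hE : h = fun t => a t - b t.
  apply/funext => t; rewrite /a /b; case: (leP (h t) 0) => h0.
    by rewrite max_l ?oppr_ge0// sub0r opprK.
  by rewrite max_r ?subr0// oppr_le0 ltW.
have a0 t : 0 <= a t by rewrite le_max lexx orbT.
have b0 t : 0 <= b t by rewrite le_max lexx orbT.
have ah t : `|a t| <= `|h t| by rewrite ger0_norm// ge_max ler_norm normr_ge0.
have bh t : `|b t| <= `|h t| by rewrite ger0_norm// ge_max -normrN ler_norm normr_ge0.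
have ma : measurable_fun [set: Rm] a by exact: measurable_maxr.
have mb : measurable_fun [set: Rm] b by apply: measurable_maxr => //; exact: measurableT_comp.
have C0 : 0 <= 4 `^ p * (2 * (p / (p - 1) + 1)) * pi `^ p.
  have q0 : 0 <= p / (p - 1) by rewrite divr_ge0 ?(ltW p0)// subr_ge0 ltW.
  by rewrite !mulr_ge0 ?addr_ge0 ?powR_ge0.
have key (c : R -> R) : (forall t, 0 <= c t) -> (forall t, `|c t| <= `|h t|) ->
    measurable_fun [set: Rm] c ->
    mu.-integrable [set: Rm] (EFin \o c) /\
    (\int[mu]_x (`|trunc_hilbert e c x| `^ p)%:E <=
      (4 `^ p * (2 * (p / (p - 1) + 1)) * pi `^ p)%:E * \int[mu]_t (`|h t| `^ p)%:E)%E.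
  move=> c0 ch mc.
  have ic : mu.-integrable [set: Rm] (EFin \o c).
    by apply: (le_integrable measurableT _ _ ih); [exact/measurable_EFinP|move=> t _ /=; rewrite lee_fin].
  have ic1 : mu.-integrable [set: Rm] (fun t => (c t * `|t|)%:E).
    apply: (le_integrable measurableT _ _ ih1).
      apply/measurable_EFinP; apply: measurable_funM => //; exact: (@normr_measurable R setT).
    by move=> t _ /=; rewrite lee_fin !normrM ler_wpM2r.
  split=> //; apply: (le_trans (trunc_hilbert_nonneg mc c0 ic ic1 p1 p2 e0 e1)).
  apply: lee_wpmul2l; first by rewrite lee_fin.
  apply: ge0_le_integral => //.
  - by move=> t _; rewrite lee_fin powR_ge0.
  - by apply/measurable_EFinP; exact: measurable_powR_comp.
  - apply/measurable_EFinP; apply: measurable_powR_comp.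
    exact: (measurableT_comp (@normr_measurable R setT)).
  - move=> t _; rewrite lee_fin; apply: ge0_ler_powR; rewrite ?nnegrE ?(ltW p0)//.
    by rewrite -{1}(ger0_norm (c0 t)).
have [ia ka] := key a a0 ah ma; have [ib kb] := key b b0 bh mb.
have mTp (c : R -> R) : measurable_fun [set: Rm] c ->
    measurable_fun [set: Rm] (fun x => `|trunc_hilbert e c x| `^ p).
  move=> mc; apply: measurable_powR_comp; apply: (measurableT_comp (@normr_measurable R setT)).
  exact: measurable_trunc_hilbert.
pose F x := `|trunc_hilbert e a x| `^ p + `|trunc_hilbert e b x| `^ p.
have mF : measurable_fun [set: Rm] F by apply: measurable_funD; exact: mTp.
have F0 x : 0 <= F x by rewrite addr_ge0// powR_ge0.
apply: (@le_trans _ _ (\int[mu]_x ((4 `^ p)%:E * (F x)%:E))%E).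
  apply: ge0_le_integral => //.
  - by apply/measurable_EFinP; exact: mTp.
  - by apply: emeasurable_funM => //; exact/measurable_EFinP.
  - move=> x _; rewrite -EFinM lee_fin hE trunc_hilbertB//.
    apply: (le_trans (y := (`|trunc_hilbert e a x| + `|trunc_hilbert e b x| + (0 + 0)) `^ p)).
      apply: ge0_ler_powR; rewrite ?nnegrE ?(ltW p0) ?addr_ge0//.
      by rewrite !addr0 ler_normB.
    apply: (le_trans (powR_sum4_le _ _ _ _ _)) => //.
    by rewrite powR0 ?gt_eqF// !addr0.
rewrite ge0_integralZl//; last 2 first.
- exact/measurable_EFinP.
- by move=> x _; rewrite lee_fin.
rewrite /hilbert_const [X in (_ <= X * _)%E]EFinM -[leRHS]muleA.
apply: lee_wpmul2l; first by rewrite lee_fin powR_ge0.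
have -> : ((2 * (4 `^ p * (2 * (p / (p - 1) + 1)) * pi `^ p))%:E * \int[mu]_t (`|h t| `^ p)%:E
  = (4 `^ p * (2 * (p / (p - 1) + 1)) * pi `^ p)%:E * \int[mu]_t (`|h t| `^ p)%:E +
    (4 `^ p * (2 * (p / (p - 1) + 1)) * pi `^ p)%:E * \int[mu]_t (`|h t| `^ p)%:E)%E.
  rewrite -ge0_muleDl ?lee_fin//.
  by rewrite -EFinD; congr (_%:E * _)%E; ring.
have pge (c : R -> R) x : 0 <= `|trunc_hilbert e c x| `^ p by exact: powR_ge0.
exact: (le_integralD (mTp a ma) (mTp b mb) (pge a) (pge b) ka kb).
Qed.

Lemma Rintegral_shiftl (f : R -> R) (a : R) : measurable_fun [set: Rm] f ->
  \int[mu]_x f (a + x) = \int[mu]_x f x.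
Proof.
move=> mf; rewrite /Rintegral -[in RHS](integral_shift (f := fun x => (f x)%:E) a); last exact/measurable_EFinP.
by congr fine; apply: eq_integral => x _; rewrite addrC.
Qed.

Lemma integrable_shiftl (f : R -> R) (a : R) :
  mu.-integrable [set: Rm] (EFin \o f) ->
  mu.-integrable [set: Rm] (fun t => (f (a + t))%:E).
Proof. by move/(integrable_shift a); apply: eq_integrable => // t _; rewrite addrC. Qed.

Lemma integrable_mul_hker (e : R) (c : R -> R) : 0 < e ->
  mu.-integrable [set: Rm] (EFin \o c) -> mu.-integrable [set: Rm] (fun t => (c t * hker e t)%:E).
Proof.
move=> e0 ic; apply: (@integrable_mul_bounded _ Rm mu c _ e^-1 ic); first exact: measurable_hker.
by move=> t; exact: hker_le.
Qed.

Lemma integral_norm_hker_le (e : R) (c : R -> R) : 0 < e ->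
  mu.-integrable [set: Rm] (EFin \o c) ->
  (\int[mu]_t (`|c t * hker e t|)%:E <= (e^-1 * \int[mu]_t `|c t|)%:E)%E.
Proof.
move=> e0 ic; have icn := integrable_norm ic.
rewrite EFinM fineK; last exact: (integrable_fin_num measurableT icn).
rewrite -integralZl//; apply: ge0_le_integral => //.
- by have := measurable_int _ (integrable_norm (integrable_mul_hker e0 ic)).
- by apply: emeasurable_funM => //; exact: measurable_int icn.
- by move=> t _; rewrite -EFinM lee_fin normrM mulrC ler_wpM2r// hker_le.
Qed.

Lemma norm_trunc_hilbert_le (e : R) (h : R -> R) (x : R) : 0 < e ->
  mu.-integrable [set: Rm] (EFin \o h) ->
  `|trunc_hilbert e h x| <= e^-1 * \int[mu]_t `|h t|.
Proof.
move=> e0 ih; have mh : measurable_fun [set: Rm] h by apply/measurable_EFinP; exact: measurable_int ih.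
have ish := integrable_shiftl x ih; have ik := integrable_mul_hker e0 ish.
apply: (le_trans (le_normr_Rintegral measurableT ik)).
rewrite -(Rintegral_shiftl x (f := fun t => `|h t|)); last exact: measurableT_comp.
rewrite -lee_fin fineK; last by apply: (integrable_fin_num measurableT); exact: (integrable_norm ik).
exact: integral_norm_hker_le.
Qed.

(** The kernel is odd, so the change of variables that moves the transform from [b] to
    [a] changes the sign. Fubini's theorem applies because the truncated kernel is
    bounded. *)
Lemma trunc_hilbert_skew (e : R) (a b : R -> R) : 0 < e ->
  mu.-integrable [set: Rm] (EFin \o a) -> mu.-integrable [set: Rm] (EFin \o b) ->
  \int[mu]_y (a y * trunc_hilbert e b y) = - \int[mu]_y (b y * trunc_hilbert e a y).
Proof.
move=> e0 ia ib.
have ma : measurable_fun [set: Rm] a by apply/measurable_EFinP; exact: measurable_int ia.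
have mb : measurable_fun [set: Rm] b by apply/measurable_EFinP; exact: measurable_int ib.
have mk : measurable_fun [set: Rm * Rm] (fun z => hker e z.2).
  by apply: (measurableT_comp (measurable_hker e)); exact: measurable_snd.
have shn (c : R -> R) y : measurable_fun [set: Rm] c ->
    \int[mu]_t `|c (y + t)| = \int[mu]_t `|c t|.
  by move=> mc; rewrite (Rintegral_shiftl y (f := fun t => `|c t|))//; exact: measurableT_comp.
have reflect (c : R -> R) y : mu.-integrable [set: Rm] (EFin \o c) ->
    mu.-integrable [set: Rm] (fun t => (c (y - t))%:E).
  move=> ic; have ic' := integrable_shiftl y ic.
  have mc' := measurable_int _ ic'; have := ic'; case/integrableP => _ fin.
  apply/integrableP; split.
    exact: (measurableT_comp mc' (@oppr_measurable R setT)).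
  by rewrite (integral_oppr (f := fun t => `|(c (y + t))%:E|%E))//; exact: measurableT_comp.
have I1 : (mu \x mu)%E.-integrable [set: Rm * Rm] (fun z => (a z.1 * (b (z.1 + z.2) * hker e z.2))%:E).
  apply: (integrable_prod_dominated (K := e^-1 * \int[mu]_t `|b t|) ia).
    apply: measurable_funM => //; apply: (measurableT_comp mb).
    by apply: measurable_funD; [exact: measurable_fst|exact: measurable_snd].
  move=> y /=; rewrite -(shn b y mb); exact: (integral_norm_hker_le e0 (integrable_shiftl y ib)).
have I2 : (mu \x mu)%E.-integrable [set: Rm * Rm] (fun z => (b z.1 * (a (z.1 - z.2) * hker e z.2))%:E).
  apply: (integrable_prod_dominated (K := e^-1 * \int[mu]_t `|a t|) ib).
    apply: measurable_funM => //; apply: (measurableT_comp ma).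
    by apply: measurable_funB; [exact: measurable_fst|exact: measurable_snd].
  move=> y /=; apply: (le_trans (integral_norm_hker_le e0 (reflect a y ia))).
  rewrite lee_fin -(shn a y ma) /Rintegral.
  rewrite -(integral_oppr (f := fun t => (`|a (y + t)|)%:E))//.
  by apply: measurable_int (integrable_norm (integrable_shiftl y ia)).
transitivity (\int[mu]_y \int[mu]_t (a y * (b (y + t) * hker e t))).
  by apply: eq_Rintegral => y _; rewrite RintegralZl//; exact: (integrable_mul_hker e0 (integrable_shiftl y ib)).
rewrite -(Rintegral_prod1 I1) (Rintegral_prod2 I1) /=.
transitivity (\int[mu]_t \int[mu]_y (b y * (a (y - t) * hker e t))).
  apply: eq_Rintegral => t _.
  rewrite -(Rintegral_shiftl t (f := fun y => b y * (a (y - t) * hker e t))).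
    by apply: eq_Rintegral => y _; rewrite addrAC subrr add0r addrC; ring.
  apply: measurable_funM => //; apply: measurable_funM => //.
  by apply: (measurableT_comp ma); exact: measurable_funB.
rewrite -(Rintegral_prod2 I2) (Rintegral_prod1 I2) /=.
have iba : mu.-integrable [set: Rm] (fun y => (b y * trunc_hilbert e a y)%:E).
  apply: (@integrable_mul_bounded _ Rm mu _ _ (e^-1 * \int[mu]_t `|a t|)) => //.
    exact: measurable_trunc_hilbert.
  by move=> y; exact: norm_trunc_hilbert_le.
rewrite -mulN1r -RintegralZl//; apply: eq_Rintegral => y _.
have iar := integrable_mul_hker e0 (integrable_shiftl y ia).
transitivity (\int[mu]_t ((- b y) * (a (y + t) * hker e t))).
  rewrite /Rintegral -(integral_oppr (f := fun t => (- b y * (a (y + t) * hker e t))%:E)).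
    by congr fine; apply: eq_integral => t _; rewrite hkerN; congr _%:E; ring.
  by apply/measurable_EFinP; apply: measurable_funM => //; apply/measurable_EFinP; exact: measurable_int iar.
by rewrite RintegralZl// mulN1r mulNr.
Qed.
End signed.

(** * Truncated Hilbert transforms in one of two variables *)

Section two_dim.
Context {R : realType}.
Local Notation Rm := (measurableTypeR R).
Local Notation mu := (@lebesgue_measure R).
Local Notation mu2 := (mu \x mu)%E.

(** An open set of the plane is the union of the boxes with rational corners that it
    contains. *)
Lemma continuous_measurable2 (f : R * R -> R) : continuous f ->
  measurable_fun [set: Rm * Rm] f.
Proof.
move=> /continuousP cf; apply: (measurability _ (RGenOpens.measurableE R)).
move=> _ [_ [a [b ->] <-]]; rewrite setTI.
have oS := cf _ (@interval_open R (BRight a) (BLeft b) isT isT).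
set S := f @^-1` _ in oS *.
pose box (q : (rat * rat) * (rat * rat)) : set (Rm * Rm) :=
  `]ratr q.1.1, ratr q.1.2[ `*` `]ratr q.2.1, ratr q.2.2[.
have -> : S = \bigcup_(q in [set q | box q `<=` S]) box q.
  rewrite eqEsubset; split => [z Sz|z [q /= qS /qS]//].
  have /nbhs_ballP[e /= e0 eS] : nbhs z S by exact: open_nbhs_nbhs.
  have [a1 +] : exists q : rat, ratr q \in `]z.1 - e, z.1[ by apply: rat_in_itvoo; rewrite ltrBlDr ltrDl.
  rewrite in_itv /= => /andP[l1 r1].
  have [a2 +] : exists q : rat, ratr q \in `]z.1, z.1 + e[ by apply: rat_in_itvoo; rewrite ltrDl.
  rewrite in_itv /= => /andP[l2 r2].
  have [a3 +] : exists q : rat, ratr q \in `]z.2 - e, z.2[ by apply: rat_in_itvoo; rewrite ltrBlDr ltrDl.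
  rewrite in_itv /= => /andP[l3 r3].
  have [a4 +] : exists q : rat, ratr q \in `]z.2, z.2 + e[ by apply: rat_in_itvoo; rewrite ltrDl.
  rewrite in_itv /= => /andP[l4 r4].
  exists ((a1, a2), (a3, a4)) => /=; last first.
    by split; rewrite /= in_itv /=; apply/andP.
  move=> w [/=]; rewrite !in_itv /= => /andP[w1 w2] /andP[w3 w4].
  apply: eS; split; rewrite /ball /= ltr_norml; apply/andP; split; lra.
rewrite bigcup_mkcond; apply: countable_bigcupT_measurable; first exact: countableP.
by move=> q; case: ifP => _ //; apply: measurableX; exact: measurable_itv.
Qed.

Lemma measurable_pair_swap : measurable_fun [set: Rm * Rm] (fun z : Rm * Rm => (z.2, z.1)).
Proof. by apply: measurable_fun_pair; [exact: measurable_snd|exact: measurable_fst]. Qed.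

Lemma ge0_integral2_swap (f : R * R -> \bar R) : measurable_fun [set: Rm * Rm] f ->
  (forall z, (0 <= f z)%E) -> (\int[mu2]_z f (z.2, z.1) = \int[mu2]_z f z)%E.
Proof.
move=> mf f0; rewrite (fubini_tonelli1 (fun z : Rm * Rm => f (z.2, z.1)))//.
  by rewrite [RHS](@fubini_tonelli2 _ _ Rm Rm R mu mu f).
exact: (measurableT_comp mf measurable_pair_swap).
Qed.

Lemma integrable2_swap (f : R * R -> R) : mu2.-integrable [set: Rm * Rm] (EFin \o f) ->
  mu2.-integrable [set: Rm * Rm] (fun z => (f (z.2, z.1))%:E).
Proof.
move=> fi; have mf := measurable_int _ fi.
apply/(integrable12ltyP mu mu); first exact: (measurableT_comp mf measurable_pair_swap).
exact: (integrable21ltyP mu mu mf).1.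
Qed.

Lemma Rintegral2_swap (f : R * R -> R) : mu2.-integrable [set: Rm * Rm] (EFin \o f) ->
  \int[mu2]_z f (z.2, z.1) = \int[mu2]_z f z.
Proof.
by move=> fi; rewrite (Rintegral_prod2 fi) (Rintegral_prod1 (integrable2_swap fi)).
Qed.

(** Still integrable after multiplication by [|x|]: the estimates in one variable use a
    first moment. *)
Definition wt (x : R) : R := pker x 1 ^+ 2.

Lemma pker1_le1 (x : R) : pker x 1 <= 1.
Proof. by rewrite (le_trans (pker_le x ltr01))// invr1. Qed.

Lemma wt_ge0 x : 0 <= wt x. Proof. exact: sqr_ge0. Qed.

Lemma wt_le1 x : wt x <= 1.
Proof. by rewrite /wt expr_le1 ?pker1_le1// ltW// pker_gt0. Qed.

Lemma wt_le_pker x : wt x <= pker x 1.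
Proof. by rewrite /wt expr2 ler_piMl ?pker1_le1//; apply: ltW; exact: pker_gt0. Qed.

Lemma wt_mulr_le_pker x : wt x * `|x| <= pker x 1.
Proof.
rewrite /wt expr2 -mulrA ler_piMr//; first by apply: ltW; exact: pker_gt0.
by rewrite mulrC -(norm_pker x ltr01) mulr_pker_le1.
Qed.

Lemma measurable_wt : measurable_fun [set: Rm] wt.
Proof.
apply: measurable_funX; apply: (measurable_comp2 (@measurable_pker R)) => //.
Qed.

Lemma integrable_pker1 : mu.-integrable [set: Rm] (fun x => (pker x 1)%:E).
Proof.
apply/integrableP; split.
  by apply/measurable_EFinP; apply: (measurable_comp2 (@measurable_pker R)).
under eq_integral do rewrite /= norm_pker//.
by rewrite integral_pker// ltry.
Qed.

Lemma integrable_wt : mu.-integrable [set: Rm] (EFin \o wt).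
Proof.
apply: (le_integrable measurableT _ _ integrable_pker1).
  by apply/measurable_EFinP; exact: measurable_wt.
by move=> x _; rewrite lee_fin norm_pker// ger0_norm ?wt_ge0// wt_le_pker.
Qed.

(** A class between the Schwartz functions and the integrable ones whose members have
    integrable first moments on every horizontal and vertical line, and which contains
    the products [f z.1 * G z] of Schwartz functions [f], [G]. *)
Definition decays2 (B : R * R -> R) :=
  measurable_fun [set: Rm * Rm] B /\ exists M, forall z, `|B z| <= M * (wt z.1 * wt z.2).

Section decays.
Variable B : R * R -> R.
Hypothesis dB : decays2 B.

Lemma measurable_decays2 : measurable_fun [set: Rm * Rm] B. Proof. by case: dB. Qed.

Lemma measurable_row x : measurable_fun [set: Rm] (fun y => B (x, y)).
Proof. by apply: (measurableT_comp measurable_decays2); exact: measurable_pair1. Qed.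

Lemma integrable_row x : mu.-integrable [set: Rm] (fun y => (B (x, y))%:E).
Proof.
have [_ [M BM]] := dB.
have := integrableZl measurableT (M * wt x) integrable_wt; apply: le_integrable => //.
  by apply/measurable_EFinP; exact: measurable_row.
move=> y _ /=; rewrite lee_fin (le_trans (BM _))//= mulrA.
by apply: (le_trans _ (ler_norm _)).
Qed.

Lemma integrable_row_mul x : mu.-integrable [set: Rm] (fun y => (B (x, y) * `|y|)%:E).
Proof.
have [_ [M BM]] := dB.
have := integrableZl measurableT `|M| integrable_pker1; apply: le_integrable => //.
  apply/measurable_EFinP; apply: measurable_funM; first exact: measurable_row.
  exact: (@normr_measurable R setT).
move=> y _; change ((`|B (x, y) * `|y| |)%:E <= (`| `|M| * pker y 1|)%:E)%E.
rewrite lee_fin (normrM `|M|) (normrM (B _)) !normr_id (norm_pker y ltr01).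
apply: (le_trans (ler_wpM2r (normr_ge0 y) (BM (x, y)))) => /=.
have -> : M * (wt x * wt y) * `|y| = M * (wt x * (wt y * `|y|)) by ring.
apply: (le_trans (y := `|M| * (wt x * (wt y * `|y|)))).
  rewrite ler_wpM2r ?ler_norm//; apply: mulr_ge0; first exact: wt_ge0.
  by apply: mulr_ge0 => //; exact: wt_ge0.
rewrite ler_wpM2l// (le_trans (y := wt y * `|y|)) ?wt_mulr_le_pker//.
by rewrite ler_piMl ?wt_le1//; apply: mulr_ge0 => //; exact: wt_ge0.
Qed.

Lemma row_norm_le : exists K, forall x, \int[mu]_y `|B (x, y)| <= K * wt x.
Proof.
have [_ [M BM]] := dB.
exists (M * \int[mu]_y wt y) => x; rewrite mulrAC -RintegralZl//; last exact: integrable_wt.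
apply: le_Rintegral => //.
- exact: (integrable_norm (integrable_row x)).
- by have := integrableZl measurableT (M * wt x) integrable_wt; apply: eq_integrable.
- by move=> y _ /=; rewrite (le_trans (BM _))//= mulrA.
Qed.

Lemma integrable2_decays2 : mu2.-integrable [set: Rm * Rm] (EFin \o B).
Proof.
apply/(integrable12ltyP mu mu); first by apply/measurable_EFinP; exact: measurable_decays2.
have [K BK] := row_norm_le.
apply: (@le_lt_trans _ _ (\int[mu]_x (K * wt x)%:E)%E).
  apply: ge0_le_integral => //.
  - by move=> x _; exact: integral_ge0.
  - apply: (measurable_fun_fubini_tonelli_F (fun z : Rm * Rm => `|(B z)%:E|%E)) => //.
    by apply: measurableT_comp => //; apply/measurable_EFinP; exact: measurable_decays2.
  - by apply/measurable_EFinP; apply: measurable_funM => //; exact: measurable_wt.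
  - move=> x _; rewrite -[leLHS]fineK; first by rewrite lee_fin; exact: BK.
    by apply: (integrable_fin_num measurableT); exact: (integrable_norm (integrable_row x)).
have iw := integrableZl measurableT K integrable_wt.
by rewrite ltey_eq (integrable_fin_num measurableT iw).
Qed.

End decays.

Lemma decays2_swap B : decays2 B -> decays2 (fun z => B (z.2, z.1)).
Proof.
move=> [mB [M BM]]; split; first exact: (measurableT_comp mB measurable_pair_swap).
by exists M => z; rewrite (le_trans (BM _))//= [wt _ * _]mulrC.
Qed.

Definition trunc_hilbert2 (e : R) (B : R * R -> R) (z : R * R) : R :=
  trunc_hilbert e (fun y => B (z.1, y)) z.2.

Lemma measurable_trunc_hilbert2 e B : measurable_fun [set: Rm * Rm] B ->
  measurable_fun [set: Rm * Rm] (trunc_hilbert2 e B).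
Proof.
move=> mB; apply: (@measurable_Rintegral _ _ _
  (fun z : (Rm * Rm) * Rm => B (z.1.1, z.1.2 + z.2) * hker e z.2)).
have m1 : measurable_fun [set: (Rm * Rm) * Rm] (fun z => z.1.1).
  by apply: (measurableT_comp measurable_fst); exact: measurable_fst.
have m2 : measurable_fun [set: (Rm * Rm) * Rm] (fun z => z.1.2).
  by apply: (measurableT_comp measurable_snd); exact: measurable_fst.
have m3 : measurable_fun [set: (Rm * Rm) * Rm] (fun z => z.2) by exact: measurable_snd.
apply: measurable_funM; last exact: (measurableT_comp (measurable_hker e)).
apply: (measurableT_comp mB); apply: measurable_fun_pair => //; exact: measurable_funD.
Qed.

Lemma trunc_hilbert2_Lp (p e : R) B : 1 < p -> p <= 2 -> 0 < e -> e <= 1 -> decays2 B ->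
  (\int[mu2]_z (`|trunc_hilbert2 e B z| `^ p)%:E <=
   (hilbert_const p)%:E * \int[mu2]_z (`|B z| `^ p)%:E)%E.
Proof.
move=> p1 p2 e0 e1 dB.
have mB := measurable_decays2 dB.
have mp (F : R * R -> R) : measurable_fun [set: Rm * Rm] F ->
    measurable_fun [set: Rm * Rm] (fun z => (`|F z| `^ p)%:E).
  move=> mF; apply/measurable_EFinP; apply: measurable_powR_comp.
  exact: (measurableT_comp (@normr_measurable R setT)).
have mT := measurable_trunc_hilbert2 e mB.
have p0 : 0 < p by exact: lt_trans p1.
have C0 := hilbert_const_ge0 p1.
rewrite (@fubini_tonelli1 _ _ Rm Rm R mu mu (fun z => (`|trunc_hilbert2 e B z| `^ p)%:E)); last 2 first.
- exact: mp.
- by move=> z; rewrite lee_fin powR_ge0.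
rewrite (@fubini_tonelli1 _ _ Rm Rm R mu mu (fun z => (`|B z| `^ p)%:E)); last 2 first.
- exact: mp.
- by move=> z; rewrite lee_fin powR_ge0.
have mF (F : R * R -> R) : measurable_fun [set: Rm * Rm] F ->
    measurable_fun [set: Rm] (fubini_F mu (fun z : Rm * Rm => (`|F z| `^ p)%:E)).
  move=> mF; apply: measurable_fun_fubini_tonelli_F; first exact: mp.
  by move=> z; rewrite lee_fin powR_ge0.
have pos (F : R * R -> R) x : (0 <= fubini_F mu (fun z : Rm * Rm => (`|F z| `^ p)%:E) x)%E.
  by apply: integral_ge0 => y _; rewrite lee_fin powR_ge0.
rewrite -ge0_integralZl//; [|exact: mF].
apply: ge0_le_integral => //.
- exact: mF.
- by apply: emeasurable_funM => //; exact: mF.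
- move=> x _; apply: trunc_hilbert_Lp => //; first exact: integrable_row.
  exact: integrable_row_mul.
Qed.

Lemma trunc_hilbert2_bounded e B : 0 < e -> decays2 B ->
  exists K, forall z, `|trunc_hilbert2 e B z| <= K.
Proof.
move=> e0 dB; have [K BK] := row_norm_le dB; exists (e^-1 * `|K|) => z.
apply: (le_trans (norm_trunc_hilbert_le _ e0 (integrable_row dB z.1))).
rewrite ler_wpM2l ?invr_ge0 ?(ltW e0)// (le_trans (BK _))// (le_trans (ler_norm _))//.
by rewrite normrM ler_piMr// ger0_norm ?wt_ge0// wt_le1.
Qed.

Lemma integrable_mul_trunc_hilbert2 e A B : 0 < e -> decays2 A -> decays2 B ->
  mu2.-integrable [set: Rm * Rm] (fun z => (A z * trunc_hilbert2 e B z)%:E).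
Proof.
move=> e0 dA dB; have [K TK] := trunc_hilbert2_bounded e0 dB.
apply: (@integrable_mul_bounded R _ (Rm * Rm)%type mu2 A _ K _ _ TK); first exact: integrable2_decays2.
by apply: measurable_trunc_hilbert2; exact: measurable_decays2.
Qed.

Lemma trunc_hilbert2_skew e A B : 0 < e -> decays2 A -> decays2 B ->
  \int[mu2]_z (A z * trunc_hilbert2 e B z) = - \int[mu2]_z (B z * trunc_hilbert2 e A z).
Proof.
move=> e0 dA dB.
rewrite (Rintegral_prod1 (integrable_mul_trunc_hilbert2 e0 dA dB)).
have iBA := integrable_mul_trunc_hilbert2 e0 dB dA.
rewrite (Rintegral_prod1 iBA).
transitivity (\int[mu]_x - \int[mu]_y (B (x, y) * trunc_hilbert2 e A (x, y))).
  apply: eq_Rintegral => x _; exact: (trunc_hilbert_skew e0 (integrable_row dA x) (integrable_row dB x)).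
rewrite -mulN1r -RintegralZl//; first by apply: eq_Rintegral => x _; rewrite mulN1r.
exact: integrable_Rintegral1 iBA.
Qed.
End two_dim.

(** * Truncated bilinear forms *)

Section bilinear.
Context {R : realType}.
Local Notation Rm := (measurableTypeR R).
Local Notation mu := (@lebesgue_measure R).
Local Notation mu2 := (mu \x mu)%E.

Lemma Lnorm_EFin d (T : measurableType d) (m : {measure set T -> \bar R}) (p : R) (f : T -> R) :
  ('N[m]_p%:E[EFin \o f] = (\int[m]_x (`|f x| `^ p)%:E) `^ p^-1)%E.
Proof. by rewrite unlock; congr (_ `^ _)%E. Qed.

Lemma le_norm_RintegralM d (T : measurableType d) (m : {measure set T -> \bar R}) (p q : R) (f g : T -> R) :
  0 < p -> 0 < q -> p^-1 + q^-1 = 1 ->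
  measurable_fun [set: T] f -> measurable_fun [set: T] g ->
  m.-integrable [set: T] (fun x => (f x * g x)%:E) ->
  ((`|\int[m]_x (f x * g x)|)%:E <= 'N[m]_p%:E[EFin \o f] * 'N[m]_q%:E[EFin \o g])%E.
Proof.
move=> p0 q0 pq mf mg ifg; apply: le_trans (hoelder m mf mg p0 q0 pq).
rewrite Lnorm1 -[leRHS]fineK.
  by rewrite lee_fin; exact: (le_normr_Rintegral measurableT ifg).
by apply: (integrable_fin_num measurableT); exact: (integrable_norm ifg).
Qed.

Lemma integral_powR_ge0 d (T : measurableType d) (m : {measure set T -> \bar R}) (p : R) (f : T -> R) :
  (0 <= \int[m]_x (`|f x| `^ p)%:E)%E.
Proof. by apply: integral_ge0 => x _; rewrite lee_fin powR_ge0. Qed.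

Lemma measurable_powR_norm d (T : measurableType d) (p : R) (f : T -> R) :
  measurable_fun [set: T] f -> measurable_fun [set: T] (fun x => (`|f x| `^ p)%:E).
Proof.
by move=> mf; apply/measurable_EFinP; apply: measurable_powR_comp; exact: measurableT_comp.
Qed.

Lemma Lnorm_le_scale d (T : measurableType d) (m : {measure set T -> \bar R}) (p c : R) (f g : T -> R) :
  0 < p -> 0 <= c ->
  (\int[m]_x (`|f x| `^ p)%:E <= c%:E * \int[m]_x (`|g x| `^ p)%:E)%E ->
  ('N[m]_p%:E[EFin \o f] <= (c `^ p^-1)%:E * 'N[m]_p%:E[EFin \o g])%E.
Proof.
move=> p0 c0 fg; rewrite !Lnorm_EFin -poweR_EFin -poweRM ?lee_fin ?integral_powR_ge0//.
apply: gt0_ler_poweR fg; rewrite ?invr_ge0 ?(ltW p0)// in_itv/= leey andbT ?integral_powR_ge0//.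
by rewrite mule_ge0 ?lee_fin ?integral_powR_ge0.
Qed.

Lemma bilinear_le2 (p q e : R) (A B : R * R -> R) : 0 < p -> 1 < q -> q <= 2 ->
  p^-1 + q^-1 = 1 -> 0 < e -> e <= 1 -> decays2 A -> decays2 B ->
  ((`|\int[mu2]_z (A z * trunc_hilbert2 e B z)|)%:E <=
   (hilbert_const q `^ q^-1)%:E * ('N[mu2]_p%:E[EFin \o A] * 'N[mu2]_q%:E[EFin \o B]))%E.
Proof.
move=> p0 q1 q2 pq e0 e1 dA dB; have q0 : 0 < q by exact: lt_trans q1.
have mA := measurable_decays2 dA; have mB := measurable_decays2 dB.
apply: (le_trans (le_norm_RintegralM p0 q0 pq mA (measurable_trunc_hilbert2 e mB)
  (integrable_mul_trunc_hilbert2 e0 dA dB))).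
rewrite muleCA; apply: lee_wpmul2l; first exact: Lnorm_ge0.
by apply: Lnorm_le_scale => //; [exact: hilbert_const_ge0|exact: trunc_hilbert2_Lp].
Qed.

(** For [q > 2] the conjugate exponent [p] is less than [2], and skew-adjointness moves
    the transform to the factor with that exponent. *)
Lemma bilinear_le (p q : R) : 1 < p -> 1 < q -> p^-1 + q^-1 = 1 ->
  exists2 C, 0 <= C & forall (e : R) (A B : R * R -> R), 0 < e -> e <= 1 ->
    decays2 A -> decays2 B ->
    ((`|\int[mu2]_z (A z * trunc_hilbert2 e B z)|)%:E <=
      C%:E * ('N[mu2]_p%:E[EFin \o A] * 'N[mu2]_q%:E[EFin \o B]))%E.
Proof.
move=> p1 q1 pq; have p0 : 0 < p by exact: lt_trans p1.
have q0 : 0 < q by exact: lt_trans q1.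
have [q2|q2] := leP q 2.
  by exists (hilbert_const q `^ q^-1) => [|e A B e0 e1 dA dB]; [exact: powR_ge0|exact: bilinear_le2].
have p2 : p <= 2.
  rewrite -(invrK p) -(invrK 2) lef_pV2 ?posrE ?invr_gt0//.
  have : q^-1 < 2^-1 by rewrite ltf_pV2 ?posrE.
  by move: pq; lra.
exists (hilbert_const p `^ p^-1) => [|e A B e0 e1 dA dB]; first exact: powR_ge0.
rewrite trunc_hilbert2_skew// normrN [X in (_ * X)%E]muleC.
by apply: bilinear_le2 => //; rewrite addrC.
Qed.

Lemma lebesgue2_sigma_finite : sigma_finite [set: Rm * Rm] mu2.
Proof.
have /sigma_finiteP[F [TF ndF Foo]] := sigma_finiteT mu.
exists (fun n => F n `*` F n).
  rewrite -setXTT TF predeqE => -[x y]; split.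
    move=> [/= [n _ Fnx] [k _ Gky]]; exists (maxn n k) => //; split.
    - by move: x Fnx; exact/subsetPset/ndF/leq_maxl.
    - by move: y Gky; exact/subsetPset/ndF/leq_maxr.
  by move=> [n _ []/= ? ?]; split; exists n.
move=> k; have [? ?] := Foo k.
split; first exact: measurableX.
by rewrite product_measure1E// lte_mul_pinfty// ge0_fin_numE.
Qed.

(** The product measure as a constant, to which the structure of a sigma-finite measure
    can be attached; Fubini's theorem for its product with a third factor asks for this
    structure. *)
Definition leb2 : set (Rm * Rm) -> \bar R := (mu \x mu)%E.
HB.instance Definition _ := Measure.on leb2.
HB.instance Definition _ := Measure_isSigmaFinite.Build _ _ _ leb2 lebesgue2_sigma_finite.

Section fubini3.
Variables (A : R * R -> R) (b : R * R -> R -> R) (e K : R).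
Hypotheses (iA : mu2.-integrable [set: Rm * Rm] (EFin \o A)).
Hypotheses (mb : measurable_fun [set: (Rm * Rm) * Rm] (fun q => b q.1 q.2)).
Hypotheses (bK : forall z, (\int[mu]_t (`|b z t * hker e t|)%:E <= K%:E)%E).

Let mbh : measurable_fun [set: (Rm * Rm) * Rm] (fun q => b q.1 q.2 * hker e q.2).
Proof.
by apply: measurable_funM => //; exact: (measurableT_comp (measurable_hker e) measurable_snd).
Qed.

Lemma integrable3_trunc : lebesgue3.-integrable [set: (Rm * Rm) * Rm]
  (fun q => (A q.1 * b q.1 q.2 * hker e q.2)%:E).
Proof.
have := @integrable_prod_dominated R _ _ (Rm * Rm)%type Rm leb2 mu A _ K iA mbh bK.
by apply: eq_integrable => // q _; rewrite mulrA.
Qed.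

Lemma Rintegral_annulus :
  \int[lebesgue3]_(q in [set q : R * R * R | e <= `|q.2| <= e^-1]) (A q.1 * b q.1 q.2 * q.2^-1) =
  \int[lebesgue3]_q (A q.1 * b q.1 q.2 * hker e q.2).
Proof.
rewrite Rintegral_mkcond; apply: eq_Rintegral => q _; rewrite patchE /hker; case: ifPn => [|] qe.
  by move: qe; rewrite inE /= => ->.
by move: qe; rewrite notin_setE /= => /negP/negbTE ->; rewrite mulr0.
Qed.

Lemma Rintegral3_trunc :
  \int[lebesgue3]_(q in [set q : R * R * R | e <= `|q.2| <= e^-1]) (A q.1 * b q.1 q.2 * q.2^-1) =
  \int[mu2]_z (A z * \int[mu]_t (b z t * hker e t)).
Proof.
rewrite Rintegral_annulus (@Rintegral_prod1 R _ _ (Rm * Rm)%type Rm leb2 mu _ integrable3_trunc).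
apply: eq_Rintegral => z _; rewrite -RintegralZl//.
  by apply: eq_Rintegral => t _ /=; rewrite mulrA.
apply/integrableP; split; last exact: le_lt_trans (bK z) (ltry _).
by apply/measurable_EFinP; exact: (measurableT_comp mbh (@measurable_pair1 _ _ (Rm * Rm)%type Rm z)).
Qed.
End fubini3.

Lemma Lnorm_swap (p : R) (F : R * R -> R) : measurable_fun [set: Rm * Rm] F ->
  ('N[mu2]_p%:E[EFin \o (fun z => F (z.2, z.1))] = 'N[mu2]_p%:E[EFin \o F])%E.
Proof.
move=> mF; rewrite !Lnorm_EFin (ge0_integral2_swap (f := fun z => (`|F z| `^ p)%:E))//.
exact: measurable_powR_norm.
Qed.

(** The direction is [true] for the second variable and [false] for the first. *)
Definition translate (d : bool) (z : R * R) (t : R) : R * R :=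
  if d then (z.1, z.2 + t) else (z.1 + t, z.2).

Lemma measurable_translate d : measurable_fun [set: (Rm * Rm) * Rm]
  (fun q : (Rm * Rm) * Rm => (translate d q.1 q.2 : Rm * Rm)).
Proof.
have m1 : measurable_fun [set: (Rm * Rm) * Rm] (fun z => z.1.1).
  by apply: (measurableT_comp measurable_fst); exact: measurable_fst.
have m2 : measurable_fun [set: (Rm * Rm) * Rm] (fun z => z.1.2).
  by apply: (measurableT_comp measurable_snd); exact: measurable_fst.
have m3 : measurable_fun [set: (Rm * Rm) * Rm] (fun z => z.2) by exact: measurable_snd.
by case: d; apply: measurable_fun_pair => //; exact: measurable_funD.
Qed.

Lemma integrable_translate B d z : decays2 B ->
  mu.-integrable [set: Rm] (EFin \o (fun t => B (translate d z t))).
Proof.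
move=> dB; case: d.
  exact: (integrable_shiftl z.2 (integrable_row dB z.1)).
exact: (integrable_shiftl (f := fun y => B (y, z.2)) z.1 (integrable_row (decays2_swap dB) z.2)).
Qed.

Lemma translate_hker_le B d e : 0 < e -> decays2 B ->
  exists K, forall z, (\int[mu]_t (`|B (translate d z t) * hker e t|)%:E <= K%:E)%E.
Proof.
have bd (F : R * R -> R) : decays2 F -> exists K, forall x, \int[mu]_y `|F (x, y)| <= K.
  move=> dF; have [K FK] := row_norm_le dF; exists `|K| => x.
  rewrite (le_trans (FK x))// (le_trans (ler_norm _))// normrM ler_piMr//.
  by rewrite ger0_norm ?wt_ge0// wt_le1.
move=> e0 dB; have {bd}[K BK] : exists K, forall z, \int[mu]_t `|B (translate d z t)| <= K.
  case: d => /=.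
    have [K BK] := bd _ dB; exists K => z.
    rewrite (Rintegral_shiftl z.2 (f := fun y => `|B (z.1, y)|))//.
    by apply: measurableT_comp => //; exact: measurable_row.
  have [K BK] := bd _ (decays2_swap dB); exists K => z.
  rewrite (Rintegral_shiftl z.1 (f := fun y => `|B (y, z.2)|)); first exact: BK.
  by apply: measurableT_comp => //; exact: measurable_row (decays2_swap dB) _.
exists (e^-1 * K) => z.
apply: (le_trans (integral_norm_hker_le e0 (integrable_translate d z dB))).
by rewrite lee_fin ler_wpM2l// invr_ge0 ltW.
Qed.

Definition trunc_form (d : bool) (e : R) (A B : R * R -> R) : R :=
  \int[lebesgue3]_(q in [set q : R * R * R | e <= `|q.2| <= e^-1])
    (A q.1 * B (translate d q.1 q.2) * q.2^-1).

Lemma measurable_annulus e : measurable [set q : (Rm * Rm) * Rm | e <= `|q.2| <= e^-1].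
Proof.
have mb : measurable_fun [set: (Rm * Rm) * Rm] (fun q => e <= `|q.2| <= e^-1).
  have mn : measurable_fun [set: (Rm * Rm) * Rm] (fun q => `|q.2|).
    exact: (measurableT_comp (@normr_measurable R setT) measurable_snd).
  by apply: measurable_and; exact: measurable_fun_ler.
by have := mb measurableT [set true] I; rewrite setTI.
Qed.

Lemma integrable_trunc_form d e A B : 0 < e -> decays2 A -> decays2 B ->
  lebesgue3.-integrable [set q : R * R * R | e <= `|q.2| <= e^-1]
    (fun q => (A q.1 * B (translate d q.1 q.2) * q.2^-1)%:E).
Proof.
move=> e0 dA dB; have [K BK] := translate_hker_le d e0 dB.
have mb : measurable_fun [set: (Rm * Rm) * Rm] (fun q => B (translate d q.1 q.2)).
  exact: (measurableT_comp (measurable_decays2 dB) (measurable_translate d)).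
have := integrable3_trunc (integrable2_decays2 dA) mb BK.
move=> /(integrableS measurableT (measurable_annulus e) (@subsetT _ _)); apply: eq_integrable; first exact: measurable_annulus.
by move=> q; rewrite inE /= /hker => ->.
Qed.

Lemma trunc_form_le (p q : R) d : 1 < p -> 1 < q -> p^-1 + q^-1 = 1 ->
  exists2 C, 0 <= C & forall (e : R) (A B : R * R -> R), 0 < e -> e <= 1 ->
    decays2 A -> decays2 B ->
    ((`|trunc_form d e A B|)%:E <=
      C%:E * ('N[mu2]_p%:E[EFin \o A] * 'N[mu2]_q%:E[EFin \o B]))%E.
Proof.
move=> p1 q1 pq; have [C C0 CP] := bilinear_le p1 q1 pq; exists C => // e A B e0 e1 dA dB.
have [K BK] := translate_hker_le d e0 dB.
have mb : measurable_fun [set: (Rm * Rm) * Rm] (fun q => B (translate d q.1 q.2)).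
  exact: (measurableT_comp (measurable_decays2 dB) (measurable_translate d)).
rewrite /trunc_form (Rintegral3_trunc (integrable2_decays2 dA) mb BK).
case: d BK mb => BK mb; first exact: CP.
have dA' := decays2_swap dA; have dB' := decays2_swap dB.
rewrite -(Lnorm_swap p (measurable_decays2 dA)) -(Lnorm_swap q (measurable_decays2 dB)).
apply: le_trans (CP e _ _ e0 e1 dA' dB').
rewrite -(Rintegral2_swap (integrable_mul_trunc_hilbert2 e0 dA' dB')) lee_fin le_eqVlt.
by apply/orP; left; apply/eqP; congr (`|_|); apply: eq_Rintegral => -[x y] _.
Qed.
End bilinear.

(** * Boundedness of the principal values *)

Section schwartz_decay.
Context {R : realType}.
Local Notation Rm := (measurableTypeR R).
Local Notation mu := (@lebesgue_measure R).
Local Notation mu2 := (mu \x mu)%E.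

(** [1 / (wt x * wt y)] is [((x ^+ 2 + 1) * (y ^+ 2 + 1)) ^+ 2], a combination of nine
    monomials, and the product of [u] with each of these is bounded. *)
Lemma schwartz2_real_decays2 (u : R * R -> R) : schwartz2_real u -> decays2 u.
Proof.
move=> [su du]; split; first by apply: continuous_measurable2; exact: (proj1 (su [::])).
have D k l : exists M, forall z : R * R, `|z.1 ^+ k * z.2 ^+ l * u z| <= M by exact: (du k l [::]).
have [M00 m00] := D 0%N 0%N; have [M02 m02] := D 0%N 2%N; have [M04 m04] := D 0%N 4%N.
have [M20 m20] := D 2%N 0%N; have [M22 m22] := D 2%N 2%N; have [M24 m24] := D 2%N 4%N.
have [M40 m40] := D 4%N 0%N; have [M42 m42] := D 4%N 2%N; have [M44 m44] := D 4%N 4%N.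
exists (M00 + 2 * M02 + M04 + 2 * M20 + 4 * M22 + 2 * M24 + M40 + 2 * M42 + M44) => z.
have even k l : `|z.1 ^+ (2 * k) * z.2 ^+ (2 * l) * u z| = z.1 ^+ (2 * k) * z.2 ^+ (2 * l) * `|u z|.
  by rewrite !normrM !(@ger0_norm _ (_ ^+ (2 * _)))// mulnC exprM sqr_ge0.
have wtE x : wt x = ((x ^+ 2 + 1) ^+ 2)^-1 :> R by rewrite /wt /pker div1r expr1n exprVn.
have p x : 0 < (x ^+ 2 + 1 : R) by rewrite ltr_wpDl ?sqr_ge0.
rewrite !wtE -invfM ler_pdivlMr ?mulr_gt0 ?exprn_gt0//.
have := even 0%N 0%N; have := even 0%N 1%N; have := even 0%N 2%N.
have := even 1%N 0%N; have := even 1%N 1%N; have := even 1%N 2%N.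
have := even 2%N 0%N; have := even 2%N 1%N; have := even 2%N 2%N.
move: (m00 z) (m02 z) (m04 z) (m20 z) (m22 z) (m24 z) (m40 z) (m42 z) (m44 z).
rewrite !muln0 !muln1 => b1 b2 b3 b4 b5 b6 b7 b8 b9 e1 e2 e3 e4 e5 e6 e7 e8 e9.
move: b1 b2 b3 b4 b5 b6 b7 b8 b9; rewrite e1 e2 e3 e4 e5 e6 e7 e8 e9.
rewrite !expr0 !mul1r !mulr1 => b1 b2 b3 b4 b5 b6 b7 b8 b9.
have -> : `|u z| * ((z.1 ^+ 2 + 1) ^+ 2 * (z.2 ^+ 2 + 1) ^+ 2) =
  `|u z| + 2 * (z.2 ^+ 2 * `|u z|) + z.2 ^+ 4 * `|u z| + 2 * (z.1 ^+ 2 * `|u z|)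
  + 4 * (z.1 ^+ 2 * z.2 ^+ 2 * `|u z|) + 2 * (z.1 ^+ 2 * z.2 ^+ 4 * `|u z|)
  + z.1 ^+ 4 * `|u z| + 2 * (z.1 ^+ 4 * z.2 ^+ 2 * `|u z|) + z.1 ^+ 4 * z.2 ^+ 4 * `|u z| by ring.
lra.
Qed.

Lemma schwartz1_real_continuous (u : R -> R) : schwartz1_real u -> continuous u.
Proof.
move=> [du _] x; apply: differentiable_continuous; apply/derivable1_diffP.
exact: (du 0%N x).
Qed.

Lemma schwartz1_real_bounded (u : R -> R) : schwartz1_real u -> exists M, forall x, `|u x| <= M.
Proof.
by move=> [_ /(_ 0%N 0%N)[M uM]]; exists M => x; move: (uM x); rewrite expr0 mul1r.
Qed.

Lemma decays2_mul1 (u : R -> R) (B : R * R -> R) : schwartz1_real u -> decays2 B ->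
  decays2 (fun z => u z.1 * B z).
Proof.
move=> su [mB [M BM]]; have [K uK] := schwartz1_real_bounded su; split.
  apply: measurable_funM => //; apply: (measurableT_comp _ measurable_fst).
  by apply: continuous_measurable_fun; exact: schwartz1_real_continuous.
exists (K * M) => z; rewrite normrM -mulrA; apply: ler_pM => //; exact: uK.
Qed.

Lemma decays2N (B : R * R -> R) : decays2 B -> decays2 (fun z => - B z).
Proof.
move=> [mB [M BM]]; split; first exact: measurableT_comp.
by exists M => z; rewrite normrN.
Qed.

Lemma decays2D (A B : R * R -> R) : decays2 A -> decays2 B -> decays2 (fun z => A z + B z).
Proof.
move=> [mA [M AM]] [mB [N BN]]; split; first exact: measurable_funD.
by exists (M + N) => z; rewrite mulrDl (le_trans (ler_normD _ _))// lerD.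
Qed.

Lemma normc_Re (z : R[i]) : `|complex.Re z| <= Normc.normc z.
Proof. by case: z => a b /=; rewrite -sqrtr_sqr ler_wsqrtr// lerDl sqr_ge0. Qed.

Lemma normc_Im (z : R[i]) : `|complex.Im z| <= Normc.normc z.
Proof. by case: z => a b /=; rewrite -sqrtr_sqr ler_wsqrtr// lerDr sqr_ge0. Qed.

Lemma normc_le (z : R[i]) : Normc.normc z <= `|complex.Re z| + `|complex.Im z|.
Proof.
case: z => a b.
change (Num.sqrt (a ^+ 2 + b ^+ 2) <= `|a| + `|b|).
rewrite -[leRHS]ger0_norm ?addr_ge0// -sqrtr_sqr ler_wsqrtr//.
rewrite sqrrD !real_normK ?num_real//.
by rewrite addrAC lerDl mulrn_wge0// mulr_ge0.
Qed.

Lemma normc_ge0 (z : R[i]) : 0 <= Normc.normc z.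
Proof. exact: le_trans (normr_ge0 _) (normc_Re z). Qed.

Lemma measurable_normc d (T : measurableType d) (f : T -> R[i]) :
  measurable_fun [set: T] (fun x => complex.Re (f x)) ->
  measurable_fun [set: T] (fun x => complex.Im (f x)) ->
  measurable_fun [set: T] (fun x => Normc.normc (f x)).
Proof.
move=> mr mi.
have -> : (fun x => Normc.normc (f x)) =
  (fun x => Num.sqrt (complex.Re (f x) ^+ 2 + complex.Im (f x) ^+ 2)).
  by apply/funext => x; case: (f x).
apply: measurableT_comp; first by apply: continuous_measurable_fun; exact: sqrt_continuous.
by apply: measurable_funD; exact: measurable_funX.
Qed.

Lemma le_Lnorm d (T : measurableType d) (m : {measure set T -> \bar R}) (p : R) (f g : T -> R) :
  0 < p -> measurable_fun [set: T] f -> measurable_fun [set: T] g ->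
  (forall x, `|f x| <= `|g x|) -> ('N[m]_p%:E[EFin \o f] <= 'N[m]_p%:E[EFin \o g])%E.
Proof.
move=> p0 mf mg fg; have := @Lnorm_le_scale R _ T m p 1 f g p0 ler01; rewrite powR1 !mul1e; apply.
apply: ge0_le_integral => //; [exact: measurable_powR_norm|exact: measurable_powR_norm|].
by move=> x _; rewrite lee_fin ge0_ler_powR ?nnegrE ?(ltW p0).
Qed.

Definition cdecays2 (A : R * R -> R[i]) :=
  decays2 (fun z => complex.Re (A z)) /\ decays2 (fun z => complex.Im (A z)).

Lemma schwartz2_cdecays2 A : schwartz2 A -> cdecays2 A.
Proof. by move=> [? ?]; split; exact: schwartz2_real_decays2. Qed.

Lemma cdecays2_mul1 (f : R -> R[i]) A : schwartz1 f -> cdecays2 A -> cdecays2 (fun z => f z.1 * A z).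
Proof.
move=> [fr fi] [ar ai]; split.
  have := decays2D (decays2_mul1 fr ar) (decays2N (decays2_mul1 fi ai)).
  by congr decays2; apply/funext => z; case: (f z.1) => a b; case: (A z) => c d.
have := decays2D (decays2_mul1 fr ai) (decays2_mul1 fi ar).
by congr decays2; apply/funext => z; case: (f z.1) => a b; case: (A z) => c d.
Qed.

Lemma Lnorm_Re_le (p : R) A : 0 < p -> cdecays2 A ->
  ('N[mu2]_p%:E[EFin \o (fun z => complex.Re (A z))] <= cLnorm lebesgue2 p%:E A)%E.
Proof.
move=> p0 [ar ai]; apply: le_Lnorm => //; first exact: measurable_decays2.
  by apply: measurable_normc; exact: measurable_decays2.
by move=> z; rewrite (ger0_norm (normc_ge0 _)) normc_Re.
Qed.

Lemma Lnorm_Im_le (p : R) A : 0 < p -> cdecays2 A ->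
  ('N[mu2]_p%:E[EFin \o (fun z => complex.Im (A z))] <= cLnorm lebesgue2 p%:E A)%E.
Proof.
move=> p0 [ar ai]; apply: le_Lnorm => //; first exact: measurable_decays2.
  by apply: measurable_normc; exact: measurable_decays2.
by move=> z; rewrite (ger0_norm (normc_ge0 _)) normc_Im.
Qed.

Lemma Re_truncated_integral d e A B : 0 < e -> cdecays2 A -> cdecays2 B ->
  complex.Re (truncated_integral (fun x y t => A (x, y) * B (translate d (x, y) t)) e) =
  trunc_form d e (fun z => complex.Re (A z)) (fun z => complex.Re (B z)) -
  trunc_form d e (fun z => complex.Im (A z)) (fun z => complex.Im (B z)).
Proof.
move=> e0 [ar ai] [br bi]; rewrite /trunc_form -RintegralB.
- rewrite /truncated_integral /cintegral /=; apply: eq_Rintegral => -[[x y] t] _ /=.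
  by case: (A (x, y)) => a b; case: (B (translate d (x, y) t)) => c d' /=; rewrite mulr0 subr0 -mulrBl.
- exact: measurable_annulus.
- exact: (@integrable_trunc_form _ d e (fun z => complex.Re (A z)) (fun z => complex.Re (B z))).
- exact: (@integrable_trunc_form _ d e (fun z => complex.Im (A z)) (fun z => complex.Im (B z))).
Qed.

Lemma Im_truncated_integral d e A B : 0 < e -> cdecays2 A -> cdecays2 B ->
  complex.Im (truncated_integral (fun x y t => A (x, y) * B (translate d (x, y) t)) e) =
  trunc_form d e (fun z => complex.Re (A z)) (fun z => complex.Im (B z)) +
  trunc_form d e (fun z => complex.Im (A z)) (fun z => complex.Re (B z)).
Proof.
move=> e0 [ar ai] [br bi]; rewrite /trunc_form -RintegralD.
- rewrite /truncated_integral /cintegral /=; apply: eq_Rintegral => -[[x y] t] _ /=.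
  by case: (A (x, y)) => a b; case: (B (translate d (x, y) t)) => c d' /=; rewrite mulr0 add0r -mulrDl.
- exact: measurable_annulus.
- exact: (@integrable_trunc_form _ d e (fun z => complex.Re (A z)) (fun z => complex.Im (B z))).
- exact: (@integrable_trunc_form _ d e (fun z => complex.Im (A z)) (fun z => complex.Re (B z))).
Qed.

(** Where the limit does not exist, [lim] is [0], which satisfies the bound as well. *)
Lemma norm_lim_le (g : R -> R) (X : \bar R) : (0 <= X)%E ->
  (forall e, 0 < e -> e <= 1 -> ((`|g e|)%:E <= X)%E) ->
  ((`|lim (g e @[e --> 0^'+])|)%:E <= X)%E.
Proof.
case: X => [x||] // x0 gx; last by rewrite leey.
rewrite lee_fin in x0; rewrite lee_fin.
have [cg|/dvgP ->] := pselect (cvg (g e @[e --> 0^'+])); last by rewrite normr0.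
have near1 : \forall e \near (0 : R)^'+, 0 < e <= 1.
  near=> e; apply/andP; split; near: e; first exact: nbhs_right_gt.
  exact: nbhs_right_le.
rewrite ler_norml; apply/andP; split.
  apply: limr_ge => //; apply: filterS near1 => e /andP[e0 e1].
  by have := gx e e0 e1; rewrite lee_fin ler_norml => /andP[].
apply: limr_le => //; apply: filterS near1 => e /andP[e0 e1].
by have := gx e e0 e1; rewrite lee_fin ler_norml => /andP[].
Unshelve. all: by end_near. Qed.

Lemma pv_integral_le (p q : R) d : 1 < p -> 1 < q -> p^-1 + q^-1 = 1 ->
  exists2 C, 0 <= C & forall A B, cdecays2 A -> cdecays2 B ->
  ((Normc.normc (pv_integral (fun x y t => A (x, y) * B (translate d (x, y) t))))%:E <=
   C%:E * (cLnorm lebesgue2 p%:E A * cLnorm lebesgue2 q%:E B))%E.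
Proof.
move=> p1 q1 pq; have [C C0 CP] := trunc_form_le d p1 q1 pq.
have p0 : 0 < p by exact: lt_trans p1.
have q0 : 0 < q by exact: lt_trans q1.
(* Real and imaginary part are each a combination of two real forms; hence the factor
   [4]. *)
exists (4 * C) => [|A B dA dB]; first by rewrite mulr_ge0.
set X := (cLnorm lebesgue2 p%:E A * cLnorm lebesgue2 q%:E B)%E.
have X0 : (0 <= X)%E by apply: mule_ge0; exact: Lnorm_ge0.
have [ar ai] := dA; have [br bi] := dB.
have CX0 : (0 <= C%:E * X)%E by rewrite mule_ge0.
have bound (a b : R * R -> R) : decays2 a -> decays2 b ->
   ('N[mu2]_p%:E[EFin \o a] <= cLnorm lebesgue2 p%:E A)%E ->
   ('N[mu2]_q%:E[EFin \o b] <= cLnorm lebesgue2 q%:E B)%E ->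
   forall e, 0 < e -> e <= 1 -> ((`|trunc_form d e a b|)%:E <= C%:E * X)%E.
  move=> da db aA bB e e0 e1; apply: (le_trans (CP e a b e0 e1 da db)).
  apply: lee_wpmul2l; first by rewrite lee_fin.
  by apply: lee_pmul => //; exact: Lnorm_ge0.
have CX2 : (C%:E * X + C%:E * X = (2 * C)%:E * X)%E.
  by rewrite -ge0_muleDl ?lee_fin// -EFinD; congr (_%:E * _)%E; ring.
have CX2' : (0 <= (2 * C)%:E * X)%E by rewrite mule_ge0// lee_fin mulr_ge0.
have CX4 : ((2 * C)%:E * X + (2 * C)%:E * X = (4 * C)%:E * X)%E.
  by rewrite -ge0_muleDl ?lee_fin ?mulr_ge0// -EFinD; congr (_%:E * _)%E; ring.
have rA := Lnorm_Re_le p0 dA; have iA := Lnorm_Im_le p0 dA.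
have rB := Lnorm_Re_le q0 dB; have iB := Lnorm_Im_le q0 dB.
apply: (le_trans (y := (`|complex.Re (pv_integral (fun x y t => A (x, y) * B (translate d (x, y) t)))|%:E +
   `|complex.Im (pv_integral (fun x y t => A (x, y) * B (translate d (x, y) t)))|%:E)%E)).
  by rewrite -EFinD lee_fin normc_le.
rewrite -CX4 /pv_integral; apply: leeD; apply: norm_lim_le => // e e0 e1.
  rewrite Re_truncated_integral//; apply: (@le_trans _ _ (C%:E * X + C%:E * X)%E); last by rewrite CX2.
  apply: (le_trans (y := (`|trunc_form d e (fun z => complex.Re (A z)) (fun z => complex.Re (B z))|%:E +
    `|trunc_form d e (fun z => complex.Im (A z)) (fun z => complex.Im (B z))|%:E)%E)).
    by rewrite -EFinD lee_fin ler_normB.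
  by apply: leeD; apply: bound.
rewrite Im_truncated_integral//; apply: (@le_trans _ _ (C%:E * X + C%:E * X)%E); last by rewrite CX2.
apply: (le_trans (y := (`|trunc_form d e (fun z => complex.Re (A z)) (fun z => complex.Im (B z))|%:E +
  `|trunc_form d e (fun z => complex.Im (A z)) (fun z => complex.Re (B z))|%:E)%E)).
  by rewrite -EFinD lee_fin ler_normD.
by apply: leeD; apply: bound.
Qed.

Lemma lebesgue_measure_setT_gt0 : (0 < mu [set: Rm])%E.
Proof.
apply: (@lt_le_trans _ _ (mu `[0, 1]%classic)); last by apply: le_measure; rewrite ?inE.
by rewrite lebesgue_measure_itv/= lte_fin ltr01 oppr0 adde0 lte_fin ltr01.
Qed.

(** Almost every [x] has [|f x|] at most the essential supremum of [f]; Tonelli's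
    theorem turns the exceptional [x] into a null set of vertical lines. *)
Lemma cLnorm_mul_sup (p : R) (f : R -> R[i]) (G : R * R -> R[i]) : 0 < p ->
  schwartz1 f -> cdecays2 G ->
  (cLnorm lebesgue2 p%:E (fun z : R * R => (f z.1 * G z)%R) <=
   cLnorm (@lebesgue_measure R) +oo f * cLnorm lebesgue2 p%:E G)%E.
Proof.
move=> p0 sf dG; have [fr fi] := sf.
have [Kr Krf] := schwartz1_real_bounded fr; have [Ki Kif] := schwartz1_real_bounded fi.
have mfn : measurable_fun [set: Rm] (fun x => Normc.normc (f x)).
  by apply: measurable_normc; apply: continuous_measurable_fun; exact: schwartz1_real_continuous.
have mGn : measurable_fun [set: Rm * Rm] (fun z => Normc.normc (G z)).
  by case: dG => gr gi; apply: measurable_normc; exact: measurable_decays2.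
have mu0 := @lebesgue_measure_setT_gt0.
set N := cLnorm (@lebesgue_measure R) +oo f.
have NE : N = ess_sup_inf.ess_sup mu (EFin \o (fun x => `|Normc.normc (f x)|)).
  by rewrite /N /cLnorm unlock mu0.
have N0 : (0 <= N)%E by exact: Lnorm_ge0.
have NK : (N <= (Kr + Ki)%:E)%E.
  rewrite NE; apply: ess_sup_inf.ess_sup_ler => x; rewrite lee_fin ger0_norm ?normc_ge0//.
  by rewrite (le_trans (normc_le _))// lerD.
have Nfin : N \is a fin_num by rewrite ge0_fin_numE// (le_lt_trans NK)// ltry.
have fN : \forall x \ae mu, Normc.normc (f x) <= fine N.
  have := ess_sup_inf.ess_sup_ge mu (EFin \o (fun x => `|Normc.normc (f x)|)).
  apply: filterS => x; rewrite -NE -[X in (_ <= X)%E](fineK Nfin) lee_fin.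
  by rewrite ger0_norm ?normc_ge0.
have F0 : 0 <= fine N by rewrite fine_ge0.
rewrite -[X in (_ <= X * _)%E](fineK Nfin) /cLnorm.
have -> : fine N = ((fine N) `^ p) `^ p^-1.
  by rewrite -powRrM mulfV ?gt_eqF// powRr1.
apply: Lnorm_le_scale; rewrite ?powR_ge0//.
have mp := @measurable_powR_norm R _ (Rm * Rm)%type p.
change (\int[mu2]_z (`|Normc.normc (f z.1 * G z)| `^ p)%:E <=
  ((fine N) `^ p)%:E * \int[mu2]_z (`|Normc.normc (G z)| `^ p)%:E)%E.
have mfG : measurable_fun [set: Rm * Rm] (fun z => Normc.normc (f z.1) * Normc.normc (G z)).
  by apply: measurable_funM => //; exact: (measurableT_comp mfn measurable_fst).
under eq_integral do rewrite Normc.normcM.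
rewrite (@fubini_tonelli1 _ _ Rm Rm R mu mu (fun z => (`|Normc.normc (f z.1) * Normc.normc (G z)| `^ p)%:E)); last 2 first.
- exact: mp.
- by move=> z; rewrite lee_fin powR_ge0.
rewrite (@fubini_tonelli1 _ _ Rm Rm R mu mu (fun z => (`|Normc.normc (G z)| `^ p)%:E)); last 2 first.
- exact: mp.
- by move=> z; rewrite lee_fin powR_ge0.
have mF (h : R * R -> R) : measurable_fun [set: Rm * Rm] h ->
    measurable_fun [set: Rm] (fubini_F mu (fun z : Rm * Rm => (`|h z| `^ p)%:E)).
  move=> mh; apply: measurable_fun_fubini_tonelli_F; first exact: mp.
  by move=> z; rewrite lee_fin powR_ge0.
have pos (h : R * R -> R) x : (0 <= fubini_F mu (fun z : Rm * Rm => (`|h z| `^ p)%:E) x)%E.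
  by apply: integral_ge0 => y _; rewrite lee_fin powR_ge0.
rewrite -ge0_integralZl ?lee_fin ?powR_ge0//; last exact: mF.
apply: ae_ge0_le_integral => //.
- exact: mF.
- by move=> x _; rewrite mule_ge0 ?lee_fin ?powR_ge0.
- by apply: emeasurable_funM => //; exact: mF.
have [A [mA A0 AN]] := fN.
exists A; split=> // x nx; apply: AN => /= fNx; apply: nx => _.
have msl (h : R * R -> R) : measurable_fun [set: Rm * Rm] h -> measurable_fun [set: Rm] (fun y => (`|h (x, y)| `^ p)%:E).
  by move=> mh; apply: (measurableT_comp (mp _ mh)); exact: measurable_pair1.
rewrite /fubini_F -ge0_integralZl ?lee_fin ?powR_ge0//; last exact: msl mGn.
apply: ge0_le_integral => //.
- exact: msl mfG.
- by apply: emeasurable_funM => //; exact: msl mGn.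
- move=> y _ /=; rewrite -EFinM lee_fin normrM powRM// ler_wpM2r ?powR_ge0//.
  by rewrite ge0_ler_powR ?nnegrE ?(ltW p0)// ger0_norm// normc_ge0.
Qed.

Lemma inve_EFin (p : R) : p != 0 -> ((p%:E)^-1 = (p^-1)%:E)%E.
Proof. by move=> p0; rewrite inver (negbTE p0). Qed.

(** In [Lambda1] and [Lambda2] the factor [f] is not translated and goes with [G]; in
    [Lambda4 1] it is translated together with [H] and goes with [H]. What remains is a
    Hilbert transform in one variable. *)
Theorem bounded_admissible (p1 p2 p3 : \bar R) (L : trilinear_form R) :
  [\/ L = Lambda1, L = Lambda2 | L = Lambda4 1] ->
  [/\ p1 = +oo%E, (p2^-1 + p3^-1 = 1)%E, (1 < p2 < +oo)%E & (1 < p3 < +oo)%E] ->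
  exists C : R, bounded_with p1 p2 p3 C L.
Proof.
move=> hL [-> pq].
case: p2 pq => [p||]; rewrite ?ltxx ?andbF//; case: p3 => [q||]; rewrite ?ltxx ?andbF//.
move=> pq /andP[p1' _] /andP[q1' _]; rewrite !lte_fin in p1' q1'.
have p0 : 0 < p by exact: lt_trans p1'.
have q0 : 0 < q by exact: lt_trans q1'.
move: pq; rewrite !inve_EFin ?gt_eqF// -EFinD => -[pq].
have [C1 C10 C1P] := pv_integral_le true p1' q1' pq.
have [C2 C20 C2P] := pv_integral_le false p1' q1' pq.
case: hL => ->.
- exists C1 => f G H sf /schwartz2_cdecays2 dG /schwartz2_cdecays2 dH.
  apply: (le_trans (C1P _ _ (cdecays2_mul1 sf dG) dH)).
  apply: lee_wpmul2l; first by rewrite lee_fin.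
  by apply: lee_wpmul2r; [exact: Lnorm_ge0|exact: cLnorm_mul_sup].
- exists C2 => f G H sf /schwartz2_cdecays2 dG /schwartz2_cdecays2 dH.
  apply: (le_trans (C2P _ _ (cdecays2_mul1 sf dG) dH)).
  apply: lee_wpmul2l; first by rewrite lee_fin.
  by apply: lee_wpmul2r; [exact: Lnorm_ge0|exact: cLnorm_mul_sup].
- exists C2 => f G H sf /schwartz2_cdecays2 dG /schwartz2_cdecays2 dH.
  have -> : Lambda4 1 f G H = pv_integral (fun x y t => G (x, y) * (fun z : R * R => f z.1 * H z) (translate false (x, y) t)).
    by congr pv_integral; apply/funext => x; apply/funext => y; apply/funext => t; rewrite /= mul1r mulrCA mulrA.
  apply: (le_trans (C2P _ _ dG (cdecays2_mul1 sf dH))).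
  apply: lee_wpmul2l; first by rewrite lee_fin.
  rewrite [X in (_ <= X * _)%E]muleC -muleA; apply: lee_wpmul2l; first exact: Lnorm_ge0.
  exact: cLnorm_mul_sup.
Qed.
End schwartz_decay.

(** * Gaussians and Schwartz functions *)

Section schwartz_examples.
Context {R : realType}.

Definition gaussian (a x : R) : R := expR (- (a * x ^+ 2)).

Lemma gaussian_ge0 a x : 0 <= gaussian a x. Proof. exact: expR_ge0. Qed.

Lemma gaussianM a b x : gaussian a x * gaussian b x = gaussian (a + b) x.
Proof. by rewrite /gaussian -expRD -opprD mulrDl. Qed.

Lemma gaussian_le1 a x : 0 <= a -> gaussian a x <= 1.
Proof. by move=> a0; rewrite -expR0 ler_expR oppr_le0 mulr_ge0// sqr_ge0. Qed.

Lemma is_derive_gaussian (a x : R) : is_derive x 1 (gaussian a) (- (2 * a * x) * gaussian a x).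
Proof.
rewrite /gaussian; set e := fun x : R => - (a * x ^+ 2).
have de : is_derive x (1 : R) e (- (2 * a * x)).
  by apply: is_derive_eq; rewrite /GRing.scale /= ?expr1 ?mulr1; ring.
have h := is_derive1_comp (is_derive_expR (e x)) de.
by apply: (is_derive_eq h); rewrite /GRing.scale /= mulrC.
Qed.

Definition poly_gaussian (a : R) (p : {poly R}) (x : R) : R := p.[x] * gaussian a x.

Lemma is_derive_poly_gaussian (a : R) (p : {poly R}) (x : R) :
  is_derive x 1 (poly_gaussian a p) (poly_gaussian a (p^`() - (2 * a) *: ('X * p)) x).
Proof.
have dp : is_derive x 1 (horner p) p^`().[x] by exact: is_derive_poly.
have dg := is_derive_gaussian a x.
have := is_deriveM dp dg; rewrite /poly_gaussian => h; apply: (is_derive_eq h).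
rewrite /GRing.scale /= hornerD hornerN hornerZ hornerM hornerX; ring.
Qed.

Lemma derive1n_poly_gaussian a p n :
  exists q, derive1n n (poly_gaussian a p) = poly_gaussian a q.
Proof.
elim: n p => [|n IH] p; first by exists p.
rewrite derive1Sn.
have -> : derive1 (poly_gaussian a p) = poly_gaussian a (p^`() - (2 * a) *: ('X * p)).
  by apply/funext => x; rewrite derive1E; apply: derive_val; exact: is_derive_poly_gaussian.
exact: IH.
Qed.

(** By induction on the degree: half of the Gaussian bounds the factor [x], the other
    half remains for the polynomial of lower degree. *)
Lemma poly_gaussian_bounded (p : {poly R}) : forall a, 0 < a ->
  exists M, forall x, `|poly_gaussian a p x| <= M.
Proof.
elim/poly_ind: p => [|p c IH] a a0.
  by exists 0 => x; rewrite /poly_gaussian horner0 mul0r normr0.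
have a20 : 0 < a / 2 by rewrite divr_gt0.
have [M pM] := IH _ a20.
have lin x : `|x| * gaussian (a / 2) x <= 1 + (a / 2)^-1.
  rewrite /gaussian expRN ler_pdivrMr ?expR_gt0//.
  have e1 := expR_ge1Dx (a / 2 * x ^+ 2).
  have ia0 : 0 < (a / 2)^-1 by rewrite invr_gt0.
  apply: (@le_trans _ _ ((1 + (a / 2)^-1) * (1 + a / 2 * x ^+ 2))); last first.
    by rewrite ler_wpM2l// addr_ge0// ltW.
  have -> : (1 + (a / 2)^-1) * (1 + a / 2 * x ^+ 2) = 1 + (a / 2)^-1 + a / 2 * x ^+ 2 + x ^+ 2.
    by field; rewrite gt_eqF.
  have := sqr_ge0 (`|x| - 1); rewrite sqrrB real_normK ?num_real//.
  have := mulr_ge0 (ltW a20) (sqr_ge0 x); have := normr_ge0 x; move: ia0; lra.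
have M0 : 0 <= M by exact: le_trans (normr_ge0 _) (pM 0).
exists (M * (1 + (a / 2)^-1) + `|c|) => x.
rewrite /poly_gaussian hornerD hornerM hornerX hornerC mulrDl.
apply: (le_trans (ler_normD _ _)); apply: lerD; last first.
  by rewrite normrM (ger0_norm (gaussian_ge0 _ _)) ler_piMr// gaussian_le1// ltW.
have -> : p.[x] * x * gaussian a x = poly_gaussian (a / 2) p x * (x * gaussian (a / 2) x).
  by rewrite /poly_gaussian {1}(splitr a) -gaussianM; ring.
rewrite normrM ler_pM//.
by rewrite normrM (ger0_norm (gaussian_ge0 _ _)).
Qed.

Lemma schwartz1_poly_gaussian a p : 0 < a -> schwartz1_real (poly_gaussian a p).
Proof.
move=> a0; split=> [n x|k n]; have [q ->] := derive1n_poly_gaussian a p n.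
  by have [] := is_derive_poly_gaussian a q x.
have [M HM] := poly_gaussian_bounded ('X^k * q) a0.
by exists M => x; move: (HM x); rewrite /poly_gaussian hornerM hornerXn mulrA.
Qed.

Lemma derive1nD (u v : R -> R) :
  (forall n x, derivable (derive1n n u) x 1) -> (forall n x, derivable (derive1n n v) x 1) ->
  forall n, derive1n n (fun x => u x + v x) = (fun x => derive1n n u x + derive1n n v x).
Proof.
move=> du dv; elim=> [//|n IH]; rewrite derive1nS IH; apply/funext => x.
rewrite derive1E (deriveD (du n x) (dv n x)) !derive1nS !derive1E //.
Qed.

Lemma schwartz1_realD (u v : R -> R) : schwartz1_real u -> schwartz1_real v ->
  schwartz1_real (fun x => u x + v x).
Proof.
move=> [du bu] [dv bv]; split=> [n x|k n]; rewrite (derive1nD du dv).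
  exact: (derivableD (du n x) (dv n x)).
have [M uM] := bu k n; have [N vN] := bv k n; exists (M + N) => x.
by rewrite mulrDr (le_trans (ler_normD _ _))// lerD.
Qed.

Lemma schwartz1_real0 : schwartz1_real (fun _ : R => 0).
Proof.
have -> : (fun _ : R => 0) = poly_gaussian 1 0.
  by apply/funext => x; rewrite /poly_gaussian horner0 mul0r.
exact: schwartz1_poly_gaussian.
Qed.

(** Correlating an odd function with an even one produces a factor [t], which cancels
    the singularity of [1 / t]. *)
Definition odd_sum n (w B : nat -> R) (x : R) : R := \sum_(k < n) w k * (x * gaussian (B k) x).

Lemma schwartz1_odd_sum n w B : (forall k, 0 < B k) -> schwartz1_real (odd_sum n w B).
Proof.
move=> B0; elim: n => [|n IH].
  by have -> : odd_sum 0 w B = fun=> 0; [apply/funext => x; rewrite /odd_sum big_ord0|exact: schwartz1_real0].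
have -> : odd_sum n.+1 w B = fun x => odd_sum n w B x + poly_gaussian (B n) (w n *: 'X) x.
  by apply/funext => x; rewrite /odd_sum big_ord_recr /poly_gaussian hornerZ hornerX mulrA.
exact: schwartz1_realD IH (schwartz1_poly_gaussian _ (B0 n)).
Qed.

Lemma schwartz1_gaussian s a : 0 < a -> schwartz1_real (fun x => s * gaussian a x).
Proof.
have -> : (fun x => s * gaussian a x) = poly_gaussian a s%:P.
  by apply/funext => x; rewrite /poly_gaussian hornerC.
exact: schwartz1_poly_gaussian.
Qed.

Lemma is_derive_tensor (b : bool) (u v : R -> R) (z : R * R) :
  (forall x, derivable u x 1) -> (forall x, derivable v x 1) ->
  is_derive z (coord_dir b) (fun z => u z.1 * v z.2)
    (if b then u z.1 * derive1 v z.2 else derive1 u z.1 * v z.2).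
Proof.
move=> du dv.
suff cv : h^-1 *: (((fun z => u z.1 * v z.2) \o shift z) (h *: coord_dir b) - u z.1 * v z.2)
    @[h --> 0^'] --> (if b then u z.1 * derive1 v z.2 else derive1 u z.1 * v z.2 : R).
  by apply: DeriveDef; [apply/cvg_ex; eexists; exact: cv|exact: cvg_lim cv].
case: b.
  have -> : (fun h : R => h^-1 *: (((fun z => u z.1 * v z.2) \o shift z) (h *: coord_dir true) - u z.1 * v z.2)) =
    (fun h => u z.1 * (h^-1 *: ((v \o shift z.2) (h *: 1) - v z.2))).
    apply/funext => h.
    change (h^-1 * (u (h * 0 + z.1) * v (h * 1 + z.2) - u z.1 * v z.2) = u z.1 * (h^-1 * (v (h * 1 + z.2) - v z.2))).
    by rewrite mulr0 add0r; ring.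
  by apply: cvgMr; rewrite derive1E; exact: dv.
have -> : (fun h : R => h^-1 *: (((fun z => u z.1 * v z.2) \o shift z) (h *: coord_dir false) - u z.1 * v z.2)) =
  (fun h => (h^-1 *: ((u \o shift z.1) (h *: 1) - u z.1)) * v z.2).
  apply/funext => h.
  change (h^-1 * (u (h * 1 + z.1) * v (h * 0 + z.2) - u z.1 * v z.2) = (h^-1 * (u (h * 1 + z.1) - u z.1)) * v z.2).
  by rewrite mulr0 add0r; ring.
by apply: cvgMl; rewrite derive1E; exact: du.
Qed.

Lemma schwartz2_tensor (u v : R -> R) : schwartz1_real u -> schwartz1_real v ->
  schwartz2_real (fun z => u z.1 * v z.2).
Proof.
move=> [du bu] [dv bv].
have E s : iter_partial s (fun z => u z.1 * v z.2) =
    (fun z => derive1n (count negb s) u z.1 * derive1n (count id s) v z.2).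
  elim: s => [//|b s IH]; rewrite /= IH; apply/funext => z.
  have h := is_derive_tensor b z (du (count negb s)) (dv (count id s)).
  by rewrite derive_val; case: b {h} => /=; rewrite ?add0n ?add1n ?derive1nS.
have cont (w : R -> R) : (forall x, derivable w x 1) -> continuous w.
  by move=> dw x; apply: differentiable_continuous; exact/derivable1_diffP.
split=> [s|k l s].
  rewrite E; split=> [z|b z]; last by have [] := is_derive_tensor b z (du (count negb s)) (dv (count id s)).
  apply: (@cvgM _ _ (nbhs z)).
    apply: (continuous_comp (f := fst)); first exact: cvg_fst.
    exact: (cont _ (du _)).
  apply: (continuous_comp (f := snd)); first exact: cvg_snd.
  exact: (cont _ (dv _)).
have [M uM] := bu k (count negb s); have [N vN] := bv l (count id s).
exists (M * N) => z; rewrite E.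
have -> : z.1 ^+ k * z.2 ^+ l * (derive1n (count negb s) u z.1 * derive1n (count id s) v z.2) =
  (z.1 ^+ k * derive1n (count negb s) u z.1) * (z.2 ^+ l * derive1n (count id s) v z.2) by ring.
by rewrite normrM ler_pM.
Qed.

End schwartz_examples.

(** * Principal values of products of Gaussians *)

Section gaussian_integrals.
Context {R : realType}.
Local Notation Rm := (measurableTypeR R).
Local Notation mu := (@lebesgue_measure R).
Local Notation mu2 := (mu \x mu)%E.

Lemma schwartz1_measurable (u : R -> R) : schwartz1_real u -> measurable_fun [set: Rm] u.
Proof. by move=> su; apply: continuous_measurable_fun; exact: schwartz1_real_continuous. Qed.

Lemma schwartz1_integrable (u : R -> R) : schwartz1_real u ->
  mu.-integrable [set: Rm] (EFin \o u).
Proof.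
move=> su; have mu_ := schwartz1_measurable su; have [_ bu] := su.
have [M uM] := bu 0%N 0%N; have [N uN] := bu 2%N 0%N.
have := integrableZl measurableT (M + N) (@integrable_pker1 R); apply: le_integrable => //.
  exact/measurable_EFinP.
move=> x _; change ((`|u x|)%:E <= (`|(M + N) * pker x 1|)%:E)%E.
rewrite lee_fin (le_trans _ (ler_norm _))// /pker expr1n div1r ler_pdivlMr ?ltr_wpDl ?sqr_ge0//.
move: (uM x) (uN x); rewrite expr0 mul1r /= normrM (ger0_norm (sqr_ge0 _)) => h1 h2.
by rewrite mulrDr mulr1 mulrC addrC; exact: lerD.
Qed.

Lemma Rintegral_gaussian (a : R) : 0 < a -> \int[mu]_x gaussian a x = Num.sqrt (pi / a).
Proof.
move=> a0; pose s := Num.sqrt (2 * a)^-1.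
have a20 : 0 < (2 * a)^-1 by rewrite invr_gt0 mulr_gt0.
have s0 : s != 0 by rewrite gt_eqF// sqrtr_gt0.
have s2 : s ^+ 2 = (2 * a)^-1 by rewrite sqr_sqrtr// ltW.
have pk0 : normal_peak s != 0 by rewrite gt_eqF// normal_peak_gt0.
have E x : gaussian a x = (normal_peak s)^-1 * normal_pdf 0 s x.
  rewrite normal_pdfE// mulrA mulVf// mul1r /normal_fun /gaussian; congr expR.
  by rewrite subr0 s2; field; rewrite gt_eqF.
have : \int[mu]_x normal_pdf 0 s x = 1 by rewrite /Rintegral integral_normal_pdf.
have -> : \int[mu]_x gaussian a x = \int[mu]_x ((normal_peak s)^-1 * normal_pdf 0 s x).
  by apply: eq_Rintegral => x _.
rewrite RintegralZl//; last exact: (integrable_normal_pdf 0 s).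
move=> ->; rewrite mulr1 /normal_peak invrK s2; congr Num.sqrt.
by field; rewrite gt_eqF.
Qed.

Lemma schwartz1_gauss (a : R) : 0 < a -> schwartz1_real (gaussian a).
Proof.
move=> a0; have := schwartz1_gaussian 1 a0.
by congr schwartz1_real; apply/funext => x; rewrite mul1r.
Qed.

Lemma schwartz1_odd (a : R) : 0 < a -> schwartz1_real (fun x => x * gaussian a x).
Proof.
move=> a0; have := schwartz1_odd_sum 1 (fun=> 1) (fun _ : nat => a0).
by congr schwartz1_real; apply/funext => x; rewrite /odd_sum big_ord_recl big_ord0 addr0 mul1r.
Qed.

Lemma Rintegral_odd_gaussian (a : R) : 0 < a -> \int[mu]_x (x * gaussian a x) = 0.
Proof.
move=> a0; have i := schwartz1_integrable (schwartz1_odd a0).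
have : \int[mu]_x (x * gaussian a x) = \int[mu]_x (- (x * gaussian a x)).
  rewrite {1}/Rintegral -(integral_oppr (f := fun x => (x * gaussian a x)%:E)); last exact: measurable_int i.
  by congr fine; apply: eq_integral => x _; rewrite /gaussian sqrrN mulNr.
have -> : \int[mu]_x (- (x * gaussian a x)) = - \int[mu]_x (x * gaussian a x).
  by rewrite -mulN1r -RintegralZl//; apply: eq_Rintegral => x _; rewrite mulN1r.
lra.
Qed.

Lemma Rintegral_shift (f : R -> R) (a : R) : measurable_fun [set: Rm] f ->
  \int[mu]_x f (x + a) = \int[mu]_x f x.
Proof. by move=> mf; rewrite -(Rintegral_shiftl a mf); apply: eq_Rintegral => x _; rewrite addrC. Qed.

Lemma gaussian_square (a b x t : R) : 0 < a + b ->
  gaussian a x * gaussian b (x + t) =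
  gaussian (a * b / (a + b)) t * gaussian (a + b) (x + b * t / (a + b)).
Proof.
by move=> ab; rewrite /gaussian -!expRD; congr expR; field; rewrite gt_eqF.
Qed.

Lemma Rintegral_gaussian_conv (a b t : R) : 0 < a -> 0 < b ->
  \int[mu]_x (gaussian a x * gaussian b (x + t)) =
  Num.sqrt (pi / (a + b)) * gaussian (a * b / (a + b)) t.
Proof.
move=> a0 b0; have ab : 0 < a + b by exact: addr_gt0.
have sg := schwartz1_gauss ab; have mg := schwartz1_measurable sg.
transitivity (\int[mu]_x (gaussian (a * b / (a + b)) t * gaussian (a + b) (x + b * t / (a + b)))).
  by apply: eq_Rintegral => x _; rewrite gaussian_square.
rewrite RintegralZl//; last exact: (integrable_shift (b * t / (a + b)) (schwartz1_integrable sg)).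
by rewrite Rintegral_shift// Rintegral_gaussian// mulrC.
Qed.

(** After completing the square, the Gaussian weight is centred where [x + t] equals [t
    * a / (a + b)], and the odd remainder integrates to [0]. *)
Lemma Rintegral_odd_conv (a b t : R) : 0 < a -> 0 < b ->
  \int[mu]_x (gaussian a x * ((x + t) * gaussian b (x + t))) =
  t * (a / (a + b) * Num.sqrt (pi / (a + b)) * gaussian (a * b / (a + b)) t).
Proof.
move=> a0 b0; have ab : 0 < a + b by exact: addr_gt0.
have ab' : a + b != 0 by rewrite gt_eqF.
have ig := schwartz1_integrable (schwartz1_gauss ab); have io := schwartz1_integrable (schwartz1_odd ab).
set c := b * t / (a + b).
pose F x := x * gaussian (a + b) x + t * a / (a + b) * gaussian (a + b) x.
have iZ : mu.-integrable [set: Rm] (fun x => (t * a / (a + b) * gaussian (a + b) x)%:E).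
  by have := integrableZl measurableT (t * a / (a + b)) ig; apply: eq_integrable.
have iF : mu.-integrable [set: Rm] (EFin \o F).
  by have := integrableD measurableT io iZ; apply: eq_integrable => // x _; rewrite /= EFinD.
have mF : measurable_fun [set: Rm] F by apply/measurable_EFinP; exact: measurable_int iF.
transitivity (\int[mu]_x (gaussian (a * b / (a + b)) t * F (x + c))).
  apply: eq_Rintegral => x _; rewrite mulrCA gaussian_square// /F -/c.
  have -> : x + t = x + c + t * a / (a + b) by rewrite /c; field.
  by ring.
rewrite RintegralZl//; last exact: (integrable_shift c iF).
rewrite Rintegral_shift// /F RintegralD// Rintegral_odd_gaussian// RintegralZl// Rintegral_gaussian//.
by rewrite add0r; field.
Qed.

Lemma gaussianN (a x : R) : gaussian a (- x) = gaussian a x.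
Proof. by rewrite /gaussian sqrrN. Qed.

Lemma Rintegral_odd_sum_conv n (w B : nat -> R) (a t : R) : 0 < a -> (forall k, 0 < B k) ->
  \int[mu]_x (gaussian a x * odd_sum n w B (x + t)) =
  t * \sum_(k < n) (w k * (a / (a + B k) * Num.sqrt (pi / (a + B k))) * gaussian (a * B k / (a + B k)) t).
Proof.
move=> a0 B0; have sg := schwartz1_gauss a0; have ig := schwartz1_integrable sg.
have I m : mu.-integrable [set: Rm] (fun x => (gaussian a x * odd_sum m w B (x + t))%:E).
  have so := schwartz1_odd_sum m w B0; have [M oM] := schwartz1_real_bounded so.
  apply: (integrable_mul_bounded (M := M) ig) => //.
  by apply: (measurableT_comp (schwartz1_measurable so)); exact: measurable_funD.
have I1 k : mu.-integrable [set: Rm] (fun x => (gaussian a x * ((x + t) * gaussian (B k) (x + t)))%:E).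
  have so := schwartz1_odd (B0 k); have [M oM] := schwartz1_real_bounded so.
  apply: (@integrable_mul_bounded R _ Rm mu (gaussian a) (fun x => (x + t) * gaussian (B k) (x + t)) M ig) => //.
  by apply: (measurableT_comp (schwartz1_measurable so)); exact: measurable_funD.
elim: n => [|n IH].
  rewrite big_ord0 mulr0.
  transitivity (\int[mu]_(x in [set: R]) (0 : R)).
    by apply: eq_Rintegral => x _; rewrite /odd_sum big_ord0 mulr0.
  by rewrite /Rintegral integral0.
have iZ : mu.-integrable [set: Rm] (fun x => (w n * (gaussian a x * ((x + t) * gaussian (B n) (x + t))))%:E).
  by have := integrableZl measurableT (w n) (I1 n); apply: eq_integrable.
rewrite big_ord_recr mulrDr -IH /=.
transitivity (\int[mu]_x (gaussian a x * odd_sum n w B (x + t) + w n * (gaussian a x * ((x + t) * gaussian (B n) (x + t))))).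
  by apply: eq_Rintegral => x _; rewrite /odd_sum big_ord_recr /=; ring.
rewrite RintegralD//; last exact: I.
rewrite RintegralZl//; last exact: I1.
by rewrite Rintegral_odd_conv//; congr (_ + _); ring.
Qed.

(** Exchanging the factors replaces [t] by [- t]. *)
Lemma Rintegral_odd_sum_conv_rev n (w B : nat -> R) (a t : R) : 0 < a -> (forall k, 0 < B k) ->
  \int[mu]_x (odd_sum n w B x * gaussian a (x + t)) =
  - t * \sum_(k < n) (w k * (a / (a + B k) * Num.sqrt (pi / (a + B k))) * gaussian (a * B k / (a + B k)) t).
Proof.
move=> a0 B0; rewrite -(@Rintegral_shift _ (- t)).
  have -> : \sum_(k < n) (w k * (a / (a + B k) * Num.sqrt (pi / (a + B k))) * gaussian (a * B k / (a + B k)) t) =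
     \sum_(k < n) (w k * (a / (a + B k) * Num.sqrt (pi / (a + B k))) * gaussian (a * B k / (a + B k)) (- t)).
    by apply: eq_bigr => k _; rewrite gaussianN.
  rewrite -Rintegral_odd_sum_conv//; apply: eq_Rintegral => x _.
  by rewrite subrK mulrC.
apply: measurable_funM; first exact: schwartz1_measurable (schwartz1_odd_sum n w B0).
by apply: (measurableT_comp (schwartz1_measurable (schwartz1_gauss a0))); exact: measurable_funD.
Qed.

Lemma integrable_tensor (p q : R -> R) :
  mu.-integrable [set: Rm] (EFin \o p) -> mu.-integrable [set: Rm] (EFin \o q) ->
  mu2.-integrable [set: Rm * Rm] (fun z => (p z.1 * q z.2)%:E).
Proof.
move=> ip iq; have mq : measurable_fun [set: Rm] q by apply/measurable_EFinP; exact: measurable_int iq.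
apply: (@integrable_prod_dominated R _ _ Rm Rm mu mu p (fun z => q z.2) (\int[mu]_y `|q y|) ip).
  exact: (measurableT_comp mq measurable_snd).
by move=> x; rewrite fineK//; exact: (integrable_fin_num measurableT (integrable_norm iq)).
Qed.

Lemma Rintegral_tensor (p q : R -> R) :
  mu.-integrable [set: Rm] (EFin \o p) -> mu.-integrable [set: Rm] (EFin \o q) ->
  \int[mu2]_z (p z.1 * q z.2) = (\int[mu]_x p x) * (\int[mu]_y q y).
Proof.
move=> ip iq; rewrite (Rintegral_prod1 (integrable_tensor ip iq)).
transitivity (\int[mu]_x ((\int[mu]_y q y) * p x)).
  by apply: eq_Rintegral => x _ /=; rewrite RintegralZl// mulrC.
by rewrite RintegralZl// mulrC.
Qed.

Lemma cvg_trunc_integral (M : R -> R) : mu.-integrable [set: Rm] (EFin \o M) ->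
  \int[mu]_t (if e <= `|t| <= e^-1 then M t else 0) @[e --> (0 : R)^'+] --> \int[mu]_t M t.
Proof.
move=> iM; apply/cvg_at_rightP => u [u0 ucvg].
have mM : measurable_fun [set: Rm] M by apply/measurable_EFinP; exact: measurable_int iM.
have mn : measurable_fun [set: Rm] (fun t : R => `|t|) by exact: (@normr_measurable R setT).
have mtr e : measurable_fun [set: Rm] (fun t => if e <= `|t| <= e^-1 then M t else 0).
  apply: measurable_fun_ifT => //.
  by apply: measurable_and; exact: measurable_fun_ler.
have := @dominated_convergence _ _ _ mu setT measurableT
  (fun n t => (if u n <= `|t| <= (u n)^-1 then M t else 0)%:E) (EFin \o M) (fun t => (`|M t|)%:E).
case.
- by move=> n; exact/measurable_EFinP.
- exact/measurable_EFinP.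
- exists [set (0 : R)]; split; [exact: measurable_set1|exact: lebesgue_measure_set1|].
  move=> t /= nt; apply: contrapT => t0; apply: nt => _.
  apply: cvg_near_cst.
  have t1 : 0 < `|t| by rewrite normr_gt0; exact/eqP.
  have t2 : 0 < `|t|^-1 by rewrite invr_gt0.
  move/cvgrPdist_lt : ucvg => cu.
  near=> n.
  have h1 : `|0 - u n| < `|t| by near: n; exact: cu.
  have h2 : `|0 - u n| < `|t|^-1 by near: n; exact: cu.
  move: h1 h2; rewrite sub0r normrN gtr0_norm// => h1 h2.
  by rewrite (ltW h1) -{1}(invrK `|t|) lef_pV2 ?posrE// (ltW h2).
- exact: (integrable_norm iM).
- apply: aeW => t n _; rewrite lee_fin; case: ifP => // _; rewrite normr0//.
move=> _ _ cE; apply: (@fine_cvg _ _ _ _ (fun n => (\int[mu]_t (if u n <= `|t| <= (u n)^-1 then M t else 0)%:E)%E)).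
by rewrite fineK//; exact: (integrable_fin_num measurableT iM).
Unshelve. all: by end_near. Qed.

Lemma integrable_hker (e : R) : 0 < e -> mu.-integrable [set: Rm] (EFin \o hker e).
Proof.
move=> e0; have := integrableZl measurableT (e^-1 * (1 + e^-1 ^+ 2)) (@integrable_pker1 R).
apply: le_integrable => //; first by apply/measurable_EFinP; exact: measurable_hker.
move=> t _; change ((`|hker e t|)%:E <= (`|e^-1 * (1 + e^-1 ^+ 2) * pker t 1|)%:E)%E.
rewrite lee_fin; have p0 := pker_gt0 t (ltr01 : (0 : R) < 1).
have ie0 : 0 < e^-1 by rewrite invr_gt0.
have d0 : 0 < 1 + e^-1 ^+ 2 by rewrite ltr_wpDr ?sqr_ge0.
rewrite [leRHS]gtr0_norm; last by apply: mulr_gt0 => //; exact: mulr_gt0.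
rewrite -mulrA.
have [et|et] := boolP (e <= `|t| <= e^-1); last first.
  rewrite /hker (negbTE et) normr0; apply: ltW; apply: mulr_gt0 => //; exact: mulr_gt0.
apply: (le_trans (hker_le _ e0)); rewrite ler_peMr ?(ltW ie0)//.
rewrite /pker expr1n div1r ler_pdivlMr ?ltr_wpDl ?sqr_ge0// mul1r addrC lerD2l.
move/andP : et => [_ te]; rewrite -(real_normK (num_real t)).
by rewrite ler_sqr ?nnegrE// ltW.
Qed.

Lemma bounded_hker_le (e K : R) (c : R -> R) : 0 < e -> measurable_fun [set: Rm] c ->
  (forall t, `|c t| <= K) ->
  (\int[mu]_t (`|c t * hker e t|)%:E <= (K * \int[mu]_t `|hker e t|)%:E)%E.
Proof.
move=> e0 mc cK; have ih := integrable_norm (integrable_hker e0).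
rewrite EFinM fineK; last exact: (integrable_fin_num measurableT ih).
rewrite -integralZl//; apply: ge0_le_integral => //.
- apply/measurable_EFinP; apply: measurableT_comp => //; apply: measurable_funM => //.
  exact: measurable_hker.
- by apply: emeasurable_funM => //; exact: measurable_int ih.
- by move=> t _; rewrite -EFinM lee_fin normrM ler_wpM2r.
Qed.
(** The hypothesis on the product of the two correlations cancels the singularity, so
    that the principal value is an absolutely convergent integral. *)
Lemma pv_integral_tensor (u1 u2 v1 v2 M : R -> R) :
  schwartz1_real u1 -> schwartz1_real u2 ->
  continuous v1 -> continuous v2 ->
  (exists K, forall x, `|v1 x| <= K) -> (exists K, forall x, `|v2 x| <= K) ->
  mu.-integrable [set: Rm] (EFin \o M) ->
  (forall t, (\int[mu]_x (u1 x * v1 (x + t))) * (\int[mu]_y (u2 y * v2 (y + t))) = t * M t) ->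
  pv_integral (fun x y t => ((u1 x * v1 (x + t)) * (u2 y * v2 (y + t)))%:C%C) =
    (\int[mu]_t M t)%:C%C.
Proof.
move=> su1 su2 cv1 cv2 [K1 vK1] [K2 vK2] iM PQ.
have iu1 := schwartz1_integrable su1; have iu2 := schwartz1_integrable su2.
have mv1 := continuous_measurable_fun cv1; have mv2 := continuous_measurable_fun cv2.
pose A (z : R * R) := u1 z.1 * u2 z.2.
pose b (z : R * R) (t : R) := v1 (z.1 + t) * v2 (z.2 + t).
have bK z t : `|b z t| <= K1 * K2 by rewrite normrM ler_pM.
have mb : measurable_fun [set: (Rm * Rm) * Rm] (fun q => b q.1 q.2).
  have m1 : measurable_fun [set: (Rm * Rm) * Rm] (fun z => z.1.1).
    by apply: (measurableT_comp measurable_fst); exact: measurable_fst.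
  have m2 : measurable_fun [set: (Rm * Rm) * Rm] (fun z => z.1.2).
    by apply: (measurableT_comp measurable_snd); exact: measurable_fst.
  have m3 : measurable_fun [set: (Rm * Rm) * Rm] (fun z => z.2) by exact: measurable_snd.
  apply: measurable_funM; first by apply: (measurableT_comp mv1); exact: measurable_funD.
  by apply: (measurableT_comp mv2); exact: measurable_funD.
have trE e : 0 < e ->
    complex.Re (truncated_integral (fun x y t => ((u1 x * v1 (x + t)) * (u2 y * v2 (y + t)))%:C%C) e) =
    \int[mu]_t (if e <= `|t| <= e^-1 then M t else 0).
  move=> e0; have bhK z : (\int[mu]_t (`|b z t * hker e t|)%:E <= (K1 * K2 * \int[mu]_t `|hker e t|)%:E)%E.
    apply: bounded_hker_le => //.
    exact: (measurableT_comp mb (@measurable_pair1 _ _ (Rm * Rm)%type Rm z)).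
  have i3 := integrable3_trunc (integrable_tensor iu1 iu2) mb bhK.
  transitivity (\int[lebesgue3]_q (A q.1 * b q.1 q.2 * hker e q.2)).
    rewrite -Rintegral_annulus /truncated_integral /cintegral /=.
    by apply: eq_Rintegral => q _; rewrite /A /b mulr0 subr0; ring.
  rewrite (@Rintegral_prod2 R _ _ (Rm * Rm)%type Rm leb2 mu _ i3).
  apply: eq_Rintegral => t _.
  change (\int[mu2]_z (A z * b z t * hker e t) = if e <= `|t| <= e^-1 then M t else 0).
  have msh (v : R -> R) : measurable_fun [set: Rm] v -> measurable_fun [set: Rm] (fun x => v (x + t)).
    by move=> mv; apply: (measurableT_comp mv); exact: measurable_funD.
  have ip1 := integrable_mul_bounded iu1 (msh _ mv1) (fun x => vK1 (x + t)).
  have ip2 := integrable_mul_bounded iu2 (msh _ mv2) (fun x => vK2 (x + t)).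
  transitivity (\int[mu2]_z (hker e t * ((u1 z.1 * v1 (z.1 + t)) * (u2 z.2 * v2 (z.2 + t))))).
    by apply: eq_Rintegral => z _; rewrite /A /b; ring.
  rewrite RintegralZl//; last exact: (integrable_tensor ip1 ip2).
  rewrite (Rintegral_tensor ip1 ip2) PQ /hker; case: ifPn => [/andP[et _]|_]; last by rewrite mul0r.
  by rewrite mulKf// -normr_gt0 (lt_le_trans e0).
have trI e : complex.Im (truncated_integral (fun x y t => ((u1 x * v1 (x + t)) * (u2 y * v2 (y + t)))%:C%C) e) = 0.
  rewrite /truncated_integral /cintegral /=.
  transitivity (\int[@lebesgue3 R]_(q in [set q : R * R * R | e <= `|q.2| <= e^-1]) (0 : R)).
    by apply: eq_Rintegral => q _; rewrite mulr0 mul0r addr0.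
  by rewrite /Rintegral integral0.
rewrite /pv_integral; congr (_ +i* _)%C; last first.
  by apply: (@cvg_lim _ _ _ (0 : R)^'+) => //; under eq_fun do rewrite trI; exact: cvg_cst.
apply: (@cvg_lim _ _ _ (0 : R)^'+) => //.
apply: cvg_trans (cvg_trunc_integral iM).
apply: near_eq_cvg; near=> e; rewrite trE//; near: e; exact: nbhs_right_gt.
Unshelve. all: by end_near. Qed.

Lemma integrable_sum_gaussian n (c d : nat -> R) : (forall k, 0 < d k) ->
  mu.-integrable [set: Rm] (fun t => (\sum_(k < n) c k * gaussian (d k) t)%:E).
Proof.
move=> d0; elim: n => [|n IH].
  by have := @integrable0 _ _ R mu setT; apply: eq_integrable => // t _; rewrite big_ord0.
have iZ := integrableZl measurableT (c n) (schwartz1_integrable (schwartz1_gauss (d0 n))).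
have := integrableD measurableT IH iZ; apply: eq_integrable => // t _.
by rewrite big_ord_recr.
Qed.

Lemma Rintegral_sum_gaussian n (c d : nat -> R) : (forall k, 0 < d k) ->
  \int[mu]_t (\sum_(k < n) c k * gaussian (d k) t) = \sum_(k < n) c k * Num.sqrt (pi / d k).
Proof.
move=> d0; elim: n => [|n IH].
  rewrite big_ord0; transitivity (\int[mu]_(t in [set: R]) (0 : R)).
    by apply: eq_Rintegral => t _; rewrite big_ord0.
  by rewrite /Rintegral integral0.
have ig := schwartz1_integrable (schwartz1_gauss (d0 n)).
have iZ := integrableZl measurableT (c n) ig.
rewrite big_ord_recr -IH /=.
transitivity (\int[mu]_t (\sum_(k < n) c k * gaussian (d k) t + c n * gaussian (d n) t)).
  by apply: eq_Rintegral => t _; rewrite big_ord_recr.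
rewrite RintegralD//; last exact: integrable_sum_gaussian.
by rewrite RintegralZl// Rintegral_gaussian.
Qed.
End gaussian_integrals.

(** * Odd test functions and norms of test functions *)

Section values.
Context {R : realType}.
Local Notation Rm := (measurableTypeR R).
Local Notation mu := (@lebesgue_measure R).
Local Notation mu2 := (mu \x mu)%E.

Lemma normc_real (x : R) : Normc.normc x%:C%C = `|x|.
Proof. by rewrite /= expr0n addr0 sqrtr_sqr. Qed.

(** The integral of the Gaussian with parameter [A] against the Hilbert transform of
    [odd_sum n w B]. *)
Definition odd_value n (w B : nat -> R) (A : R) : R :=
  \sum_(k < n) w k * (A / (A + B k) * (pi / Num.sqrt (A * B k))).

Lemma odd_valueE n (w B : nat -> R) (A : R) : 0 < A -> (forall k, 0 < B k) ->
  \sum_(k < n) w k * (A / (A + B k) * Num.sqrt (pi / (A + B k))) * Num.sqrt (pi / (A * B k / (A + B k))) =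
  odd_value n w B A.
Proof.
move=> A0 B0; apply: eq_bigr => k _; have AB : 0 < A + B k by rewrite addr_gt0.
have AB' : 0 < A * B k by rewrite mulr_gt0.
rewrite -!mulrA; congr (_ * (_ * (_ * _))).
rewrite -sqrtrM ?divr_ge0 ?pi_ge0 ?(ltW AB)//.
have -> : pi / (A + B k) * (pi / (A * (B k / (A + B k)))) = pi ^+ 2 * (A * B k)^-1.
  by field; rewrite !gt_eqF.
by rewrite sqrtrM ?sqr_ge0// sqrtr_sqr (ger0_norm (pi_ge0 R)) sqrtrV ?(ltW AB').
Qed.

Lemma continuous_cst1 : continuous (fun _ : R => 1 : R). Proof. by move=> x; exact: cvg_cst. Qed.

Lemma bounded_cst1 : exists K, forall x : R, `|(fun _ : R => 1 : R) x| <= K.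
Proof. by exists 1 => x; rewrite normr1. Qed.

Lemma Rintegral_scaled_gaussian (s D t : R) : 0 < D ->
  \int[mu]_x (s * gaussian D x * (fun _ : R => 1 : R) (x + t)) = s * Num.sqrt (pi / D).
Proof.
move=> D0; transitivity (\int[mu]_x (s * gaussian D x)).
  by apply: eq_Rintegral => x _; rewrite mulr1.
by rewrite RintegralZl ?Rintegral_gaussian//; exact: (schwartz1_integrable (schwartz1_gauss D0)).
Qed.

Section tensor_values.
Variables (n : nat) (w B : nat -> R) (A s D : R).
Hypotheses (A0 : 0 < A) (B0 : forall k, 0 < B k) (D0 : 0 < D).
Let M (c : R) t := \sum_(k < n) (c * (w k * (A / (A + B k) * Num.sqrt (pi / (A + B k))))) *
  gaussian (A * B k / (A + B k)) t.

Let d0 k : 0 < A * B k / (A + B k).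
Proof. by rewrite divr_gt0 ?mulr_gt0 ?addr_gt0. Qed.

Let iM c : mu.-integrable [set: Rm] (EFin \o M c).
Proof. exact: (@integrable_sum_gaussian _ _ (fun k => c * (w k * (A / (A + B k) * Num.sqrt (pi / (A + B k))))) _ d0). Qed.

Let ME c : \int[mu]_t M c t = c * odd_value n w B A.
Proof.
rewrite (@Rintegral_sum_gaussian _ _ (fun k => c * (w k * (A / (A + B k) * Num.sqrt (pi / (A + B k))))) _ d0).
by rewrite -odd_valueE// mulr_sumr; apply: eq_bigr => k _; rewrite !mulrA.
Qed.

Let cg a : 0 < a -> continuous (gaussian a : R -> R).
Proof. by move=> a0; exact: schwartz1_real_continuous (schwartz1_gauss a0). Qed.
Let so := schwartz1_odd_sum n w B0.
Let sg := schwartz1_gauss A0.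
Let sD := schwartz1_gaussian s D0.

Let MS c t : t * M c t = c * (t * \sum_(k < n) (w k * (A / (A + B k) * Num.sqrt (pi / (A + B k))) * gaussian (A * B k / (A + B k)) t)).
Proof. by rewrite /M mulrCA; congr (_ * _); rewrite mulr_sumr; apply: eq_bigr => k _; rewrite !mulrA. Qed.

Lemma pv_odd_x : Normc.normc (pv_integral (fun x y t =>
  ((gaussian A x * odd_sum n w B (x + t)) * (s * gaussian D y * (fun=> 1) (y + t)))%:C%C)) =
  `|s * Num.sqrt (pi / D) * odd_value n w B A|.
Proof.
rewrite (pv_integral_tensor (M := M (s * Num.sqrt (pi / D))) sg sD (schwartz1_real_continuous so) continuous_cst1
  (schwartz1_real_bounded so) bounded_cst1 (iM _)); first by rewrite normc_real ME.
by move=> t; rewrite Rintegral_odd_sum_conv// Rintegral_scaled_gaussian// MS mulrC.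
Qed.

Lemma pv_odd_y : Normc.normc (pv_integral (fun x y t =>
  ((s * gaussian D x * (fun=> 1) (x + t)) * (gaussian A y * odd_sum n w B (y + t)))%:C%C)) =
  `|s * Num.sqrt (pi / D) * odd_value n w B A|.
Proof.
rewrite (pv_integral_tensor (M := M (s * Num.sqrt (pi / D))) sD sg continuous_cst1 (schwartz1_real_continuous so)
  bounded_cst1 (schwartz1_real_bounded so) (iM _)); first by rewrite normc_real ME.
by move=> t; rewrite Rintegral_odd_sum_conv// Rintegral_scaled_gaussian// MS.
Qed.

Lemma pv_odd_rev_x : Normc.normc (pv_integral (fun x y t =>
  ((odd_sum n w B x * gaussian A (x + t)) * (s * gaussian D y * (fun=> 1) (y + t)))%:C%C)) =
  `|s * Num.sqrt (pi / D) * odd_value n w B A|.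
Proof.
rewrite (pv_integral_tensor (M := M (- (s * Num.sqrt (pi / D)))) so sD (cg A0) continuous_cst1
  (schwartz1_real_bounded sg) bounded_cst1 (iM _)); first by rewrite normc_real ME mulNr normrN.
by move=> t; rewrite Rintegral_odd_sum_conv_rev// Rintegral_scaled_gaussian// MS !mulNr mulrC.
Qed.

Lemma pv_odd_rev_y : Normc.normc (pv_integral (fun x y t =>
  ((s * gaussian D x * (fun=> 1) (x + t)) * (odd_sum n w B y * gaussian A (y + t)))%:C%C)) =
  `|s * Num.sqrt (pi / D) * odd_value n w B A|.
Proof.
rewrite (pv_integral_tensor (M := M (- (s * Num.sqrt (pi / D)))) sD so continuous_cst1 (cg A0)
  bounded_cst1 (schwartz1_real_bounded sg) (iM _)); first by rewrite normc_real ME mulNr normrN.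
by move=> t; rewrite Rintegral_odd_sum_conv_rev// Rintegral_scaled_gaussian// MS !mulNr mulrN.
Qed.

(** Both factors in [y] are even: their correlation is a Gaussian in [t], which adds to
    the exponent of each term. *)
Lemma pv_odd_both (E : R) : 0 < E -> Normc.normc (pv_integral (fun x y t =>
  ((gaussian A x * odd_sum n w B (x + t)) * (gaussian E y * gaussian E (y + t)))%:C%C)) =
  `|Num.sqrt (pi / (E + E)) * \sum_(k < n) w k * (A / (A + B k) * Num.sqrt (pi / (A + B k))) *
     Num.sqrt (pi / (A * B k / (A + B k) + E * E / (E + E)))|.
Proof.
move=> E0; pose c k := Num.sqrt (pi / (E + E)) * (w k * (A / (A + B k) * Num.sqrt (pi / (A + B k)))).
pose d k := A * B k / (A + B k) + E * E / (E + E).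
have dd0 k : 0 < d k by rewrite addr_gt0 ?d0// divr_gt0 ?mulr_gt0 ?addr_gt0.
have sE := schwartz1_gauss E0.
rewrite (pv_integral_tensor (M := fun t => \sum_(k < n) c k * gaussian (d k) t) sg sE
  (schwartz1_real_continuous so) (schwartz1_real_continuous sE) (schwartz1_real_bounded so) (schwartz1_real_bounded sE)
  (integrable_sum_gaussian n c dd0)).
  rewrite normc_real Rintegral_sum_gaussian// mulr_sumr; congr (`|_|).
  by apply: eq_bigr => k _; rewrite /c /d !mulrA.
move=> t; rewrite Rintegral_odd_sum_conv// Rintegral_gaussian_conv// -[t * _ * _]mulrA; congr (_ * _).
rewrite mulr_suml; apply: eq_bigr => k _; rewrite /c /d -gaussianM; ring.
Qed.

End tensor_values.

(** Telescoping: [r * exp (- r ^+ 2) <= 4 * (1 / (1 + r) - 1 / (1 + 2 * r))], applied to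
    [r = 2 ^ k * |x|]. *)
Lemma odd_sum_dyadic_le n (x : R) : `|odd_sum n (fun k => 2 ^+ k) (fun k => 2 ^+ k ^+ 2) x| <= 4.
Proof.
have step (r : R) : 0 <= r -> r * expR (- r ^+ 2) <= 4 * ((1 + r)^-1 - (1 + 2 * r)^-1).
  move=> r0; have p1 : 0 < 1 + r by rewrite ltr_wpDr.
  have p2 : 0 < 1 + 2 * r by rewrite ltr_wpDr// mulr_ge0.
  have -> : 4 * ((1 + r)^-1 - (1 + 2 * r)^-1) = r * (4 / ((1 + r) * (1 + 2 * r))).
    by field; rewrite !gt_eqF.
  rewrite ler_wpM2l// expRN ler_pdivlMr ?mulr_gt0// mulrC ler_pdivrMr ?expR_gt0//.
  have := expR_ge1Dx (r ^+ 2); have := sqr_ge0 (r - 1); rewrite sqrrB; nra.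
have main : `|odd_sum n (fun k => 2 ^+ k) (fun k => 2 ^+ k ^+ 2) x| <=
    4 * ((1 + `|x|)^-1 - (1 + 2 ^+ n * `|x|)^-1).
  elim: n => [|n IH].
    by rewrite /odd_sum big_ord0 normr0 expr0 mul1r subrr mulr0.
  rewrite /odd_sum big_ord_recr /= (le_trans (ler_normD _ _))//.
  have -> : `|2 ^+ n * (x * gaussian (2 ^+ n ^+ 2) x)| = (2 ^+ n * `|x|) * expR (- (2 ^+ n * `|x|) ^+ 2).
    rewrite !normrM (ger0_norm (gaussian_ge0 _ _)) ger0_norm ?exprn_ge0// mulrA; congr (_ * _).
    by rewrite /gaussian exprMn real_normK ?num_real.
  have := step (2 ^+ n * `|x|) (mulr_ge0 (exprn_ge0 _ (ler0n _ _)) (normr_ge0 _)).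
  by rewrite /odd_sum in IH; move: IH; rewrite (exprS 2 n) -[2 * 2 ^+ n * `|x|]mulrA; lra.
apply: (le_trans main).
have p0 : 0 < 1 + 2 ^+ n * `|x| by rewrite ltr_wpDr// mulr_ge0// exprn_ge0.
have i0 : 0 < (1 + 2 ^+ n * `|x|)^-1 by rewrite invr_gt0.
have i1 : (1 + `|x|)^-1 <= 1 by rewrite invf_le1 ?lerDl// ltr_wpDr.
move: i0 i1; lra.
Qed.

(** Half of the exponent [2 * p ^+ 2] bounds the factor [p * x]; the other half remains.
    *)
Lemma odd_sum1_le (p x : R) : 0 < p ->
  `|odd_sum 1 (fun=> p) (fun=> 2 * p ^+ 2) x| <= gaussian (p ^+ 2) x.
Proof.
move=> p0; rewrite /odd_sum big_ord_recl big_ord0 addr0.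
have -> : 2 * p ^+ 2 = p ^+ 2 + p ^+ 2 by ring.
rewrite -gaussianM !mulrA normrM (ger0_norm (gaussian_ge0 _ _)) ler_piMl ?gaussian_ge0//.
rewrite normrM (ger0_norm (gaussian_ge0 _ _)) /gaussian expRN ler_pdivrMr ?expR_gt0// mul1r.
rewrite -exprMn -(real_normK (num_real (p * x))).
have := expR_ge1Dx (`|p * x| ^+ 2); have := sqr_ge0 (`|p * x| - 1); rewrite sqrrB.
have := normr_ge0 (p * x); nra.
Qed.

Section norms.
Variables (d : measure_display) (T : measurableType d) (m : {measure set T -> \bar R}).

Lemma cLnorm_real (P : \bar R) (u : T -> R) :
  cLnorm m P (fun z => (u z)%:C%C) = ('N[m]_P[EFin \o u])%E.
Proof.
rewrite /cLnorm -Lnorm_abse -[RHS]Lnorm_abse; congr Lnorm.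
apply/funext => z; change ((`|Normc.normc (u z)%:C%C|)%:E = (`|u z|)%:E).
by rewrite normc_real normr_id.
Qed.

Lemma Lnorm_sup_le (u : T -> R) (K : R) : 0 <= K -> (forall z, `|u z| <= K) ->
  ('N[m]_+oo[EFin \o u] <= K%:E)%E.
Proof.
move=> K0 uK; rewrite unlock; case: ifP => _; last by rewrite lee_fin.
by apply: (@ess_sup_inf.ess_sup_ler _ _ _ m (fun z => `|u z|)) => z; rewrite lee_fin.
Qed.

End norms.

(** The reciprocal of an exponent as a real number, with value [0] at infinity; the
    conditions on the exponents are linear in it. *)
Definition rexp (P : \bar R) : R := fine P^-1%E.

Lemma rexp_pinfty : rexp +oo%E = 0. Proof. by rewrite /rexp invey. Qed.

Lemma rexp_EFin (p : R) : p != 0 -> rexp p%:E = p^-1.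
Proof. by move=> p0; rewrite /rexp inve_EFin. Qed.

Lemma pi_ge1 : 1 <= pi :> R. Proof. by rewrite (le_trans _ (pi_ge2 R))// ler1n. Qed.

Lemma gaussian_powR (r a x : R) : gaussian (r * a) x = gaussian a x `^ r.
Proof. by rewrite /gaussian -expRM; congr expR; ring. Qed.

(** A function between [0] and [1] with mass of order [1 / s], like a Gaussian at
    frequency [s], has norm at most of order [s `^ (- rexp P)]. The factor [pi] serves
    for all [P] at once. *)
Lemma Lnorm_profile_le d (T : measurableType d) (m : {measure set T -> \bar R}) (P : \bar R)
    (u g : T -> R) (s K : R) : (1 <= P)%E -> 0 < s -> 0 <= K ->
  measurable_fun [set: T] u -> measurable_fun [set: T] g -> (forall z, 0 <= g z <= 1) ->
  (forall r, 1 <= r -> (\int[m]_z (`|g z| `^ r)%:E <= (pi / s)%:E)%E) ->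
  (forall z, `|u z| <= K * g z) ->
  ('N[m]_P[EFin \o u] <= (K * pi * s `^ (- rexp P))%:E)%E.
Proof.
move=> P1 s0 K0 mu_ mg g01 ig uK; have pi0 := pi_ge0 R.
case: P P1 => [r|_|//]; last first.
  rewrite rexp_pinfty oppr0 powRr0 mulr1; apply: Lnorm_sup_le => [|z]; first exact: mulr_ge0.
  have /andP[_ g1] := g01 z.
  by rewrite (le_trans (uK z))// ler_wpM2l// (le_trans g1)// pi_ge1.
rewrite lee_fin => r1; have r0 : 0 < r by rewrite (lt_le_trans _ r1).
have ps0 : 0 <= pi / s by rewrite divr_ge0// ltW.
rewrite rexp_EFin ?gt_eqF// Lnorm_EFin.
have Ile : (\int[m]_z (`|u z| `^ r)%:E <= (K `^ r * (pi / s))%:E)%E.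
  apply: (@le_trans _ _ (\int[m]_z ((K `^ r)%:E * (`|g z| `^ r)%:E))%E).
    apply: ge0_le_integral => //; [exact: measurable_powR_norm| |move=> z _].
      by apply: emeasurable_funM => //; exact: measurable_powR_norm.
    have /andP[g0 _] := g01 z.
    rewrite -EFinM lee_fin -powRM// (ger0_norm g0); apply: ge0_ler_powR; rewrite ?nnegrE ?(ltW r0)//.
    exact: mulr_ge0.
  rewrite ge0_integralZl ?lee_fin ?powR_ge0//; last exact: measurable_powR_norm.
  by rewrite EFinM lee_wpmul2l// ?lee_fin ?powR_ge0//; exact: ig.
apply: (@le_trans _ _ ((K `^ r * (pi / s))%:E `^ r^-1)%E).
  apply: gt0_ler_poweR; rewrite ?invr_ge0 ?(ltW r0)// ?in_itv/= ?leey ?andbT ?integral_powR_ge0//.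
  by rewrite lee_fin mulr_ge0 ?powR_ge0.
rewrite poweR_EFin lee_fin powRM ?powR_ge0// -powRrM mulfV ?gt_eqF// powRr1// -mulrA.
apply: ler_wpM2l => //; rewrite powRM ?invr_ge0 ?(ltW s0)//.
have -> : s^-1 `^ r^-1 = s `^ (- r^-1) by rewrite -powR_inv1 ?(ltW s0)// -powRrM mulN1r.
rewrite ler_wpM2r ?powR_ge0// -[leRHS]powRr1//.
by rewrite ler_powR ?pi_ge1// invf_le1.
Qed.

Lemma gaussian_01 (c x : R) : 0 <= c -> 0 <= gaussian c x <= 1.
Proof. by move=> c0; rewrite gaussian_ge0 gaussian_le1. Qed.

Lemma Lnorm_gaussian1_le (P : \bar R) (u : R -> R) (p K : R) : (1 <= P)%E -> 0 < p -> 0 <= K ->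
  measurable_fun [set: Rm] u -> (forall x, `|u x| <= K * gaussian (p ^+ 2) x) ->
  ('N[@lebesgue_measure R]_P[EFin \o u] <= (K * pi * p `^ (- rexp P))%:E)%E.
Proof.
move=> P1 p0 K0 mu_ uK; have pp : 0 < p ^+ 2 by rewrite exprn_gt0.
apply: (Lnorm_profile_le P1 p0 K0 mu_ _ _ _ uK) => [|x|q q1].
- exact: schwartz1_measurable (schwartz1_gauss pp).
- by rewrite gaussian_01// ltW.
have q0 : 0 < q by rewrite (lt_le_trans _ q1).
have qp : 0 < q * p ^+ 2 by rewrite mulr_gt0.
under eq_integral do rewrite (ger0_norm (gaussian_ge0 _ _)) -gaussian_powR.
rewrite -[leLHS]fineK; last exact: (integrable_fin_num measurableT (schwartz1_integrable (schwartz1_gauss qp))).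
rewrite lee_fin; change (\int[mu]_x gaussian (q * p ^+ 2) x <= pi / p).
have s0 : 0 <= pi / p by rewrite divr_ge0 ?pi_ge0 ?(ltW p0).
rewrite Rintegral_gaussian// -[leRHS](ger0_norm s0) -sqrtr_sqr ler_wsqrtr// expr_div_n.
rewrite invfM mulrA ler_wpM2r ?invr_ge0 ?sqr_ge0// ler_pdivrMr//.
rewrite expr2 -mulrA ler_peMr ?pi_ge0//.
by rewrite -[leLHS]mulr1 ler_pM// pi_ge1.
Qed.

Lemma Lnorm_gaussian2_le (P : \bar R) (u : R * R -> R) (p q K : R) : (1 <= P)%E -> 0 < p -> 0 < q -> 0 <= K ->
  measurable_fun [set: Rm * Rm] u ->
  (forall z, `|u z| <= K * (gaussian (p ^+ 2) z.1 * gaussian (q ^+ 2) z.2)) ->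
  ('N[mu2]_P[EFin \o u] <= (K * pi * (p * q) `^ (- rexp P))%:E)%E.
Proof.
move=> P1 p0 q0 K0 mu_ uK; have pq : 0 < p * q by rewrite mulr_gt0.
have pp : 0 < p ^+ 2 by rewrite exprn_gt0.
have qq : 0 < q ^+ 2 by rewrite exprn_gt0.
apply: (Lnorm_profile_le P1 pq K0 mu_ _ _ _ uK) => [|z|r r1].
- apply: measurable_funM.
    exact: (measurableT_comp (schwartz1_measurable (schwartz1_gauss pp)) measurable_fst).
  exact: (measurableT_comp (schwartz1_measurable (schwartz1_gauss qq)) measurable_snd).
- have /andP[a0 a1] := gaussian_01 z.1 (ltW pp); have /andP[b0 b1] := gaussian_01 z.2 (ltW qq).
  by rewrite mulr_ge0//= mulr_ile1.
have r0 : 0 < r by rewrite (lt_le_trans _ r1).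
have rp : 0 < r * p ^+ 2 by rewrite mulr_gt0.
have rq : 0 < r * q ^+ 2 by rewrite mulr_gt0.
have igp := schwartz1_integrable (schwartz1_gauss rp).
have igq := schwartz1_integrable (schwartz1_gauss rq).
under eq_integral do rewrite normrM !(ger0_norm (gaussian_ge0 _ _)) powRM ?gaussian_ge0// -!gaussian_powR.
rewrite -[leLHS]fineK; last exact: (integrable_fin_num measurableT (integrable_tensor igp igq)).
rewrite lee_fin; change (\int[mu2]_x (gaussian (r * p ^+ 2) x.1 * gaussian (r * q ^+ 2) x.2) <= pi / (p * q)).
rewrite (Rintegral_tensor igp igq) !Rintegral_gaussian// -sqrtrM ?divr_ge0 ?pi_ge0 ?(ltW rp)//.
have -> : pi / (r * p ^+ 2) * (pi / (r * q ^+ 2)) = (pi / (r * (p * q))) ^+ 2.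
  by field; rewrite !gt_eqF.
rewrite sqrtr_sqr ger0_norm ?divr_ge0 ?pi_ge0 ?mulr_ge0 ?(ltW r0) ?(ltW p0) ?(ltW q0)//.
by rewrite ler_wpM2l ?pi_ge0// lef_pV2 ?posrE ?mulr_gt0// ler_peMl ?(ltW pq).
Qed.

End values.

(** * Lower bounds for the forms *)

Section forms_values.
Context {R : realType}.

Definition cplx (T : Type) (u : T -> R) : T -> R[i] := fun z => (u z)%:C%C.

Local Notation bump p := (odd_sum 1 (fun=> p) (fun=> 2 * p ^+ 2)).

Definition tens (u v : R -> R) (z : R * R) : R := u z.1 * v z.2.

Lemma schwartz1_cplx (u : R -> R) : schwartz1_real u -> schwartz1 (cplx u).
Proof. by move=> su; split=> //; exact: schwartz1_real0. Qed.

Lemma schwartz2_cplx (u : R * R -> R) : schwartz2_real u -> schwartz2 (cplx u).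
Proof.
move=> su; split=> //=.
have := schwartz2_tensor (@schwartz1_real0 R) (@schwartz1_real0 R).
by congr schwartz2_real; apply/funext => z; rewrite mulr0.
Qed.

Lemma schwartz2_tens (u v : R -> R) : schwartz1_real u -> schwartz1_real v -> schwartz2_real (tens u v).
Proof. exact: schwartz2_tensor. Qed.

Lemma gaussian_odd_sum n (w B : nat -> R) (c x : R) :
  gaussian c x * odd_sum n w B x = odd_sum n w (fun k => B k + c) x.
Proof.
rewrite /odd_sum mulr_sumr; apply: eq_bigr => k _; rewrite -gaussianM; ring.
Qed.

Definition form_size (L : trilinear_form R) (f : R -> R) (G H : R * R -> R) : R :=
  Normc.normc (L (cplx f) (cplx G) (cplx H)).

Section values.
(* In each value below, the last letter of the name says which factor carries the odd
   sum. *)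
Variables (n : nat) (w B : nat -> R) (A c d s : R).
Hypotheses (A0 : 0 < A) (B0 : forall k, 0 < B k) (c0 : 0 < c) (d0 : 0 < d).

Let h := odd_sum n w B.
Let g := fun x => s * gaussian A x.

Lemma Lambda1_odd_H :
  form_size Lambda1 (gaussian d) (tens (gaussian d) g) (tens (gaussian d) h) =
  `|s * Num.sqrt (pi / (d + d + d)) * odd_value n w B A|.
Proof.
rewrite -(pv_odd_y n w s A0 B0 (addr_gt0 (addr_gt0 d0 d0) d0)).
rewrite /form_size; congr (Normc.normc (pv_integral _)).
apply/funext => x; apply/funext => y; apply/funext => t.
by rewrite /cplx -!rmorphM; congr (_%:C)%C; rewrite /tens /g /h /= -!gaussianM; ring.
Qed.

Lemma Lambda1_odd_G :
  form_size Lambda1 (gaussian d) (tens (gaussian d) h) (tens (gaussian d) g) =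
  `|s * Num.sqrt (pi / (d + d + d)) * odd_value n w B A|.
Proof.
rewrite -(pv_odd_rev_y n w s A0 B0 (addr_gt0 (addr_gt0 d0 d0) d0)).
rewrite /form_size; congr (Normc.normc (pv_integral _)).
apply/funext => x; apply/funext => y; apply/funext => t.
by rewrite /cplx -!rmorphM; congr (_%:C)%C; rewrite /tens /g /h /= -!gaussianM; ring.
Qed.

Lemma Lambda2_odd_H :
  form_size Lambda2 (gaussian c) (tens g (gaussian d)) (tens h (gaussian d)) =
  `|s * Num.sqrt (pi / (d + d)) * odd_value n w B (A + c)|.
Proof.
rewrite -(pv_odd_x n w s (addr_gt0 A0 c0) B0 (addr_gt0 d0 d0)).
rewrite /form_size; congr (Normc.normc (pv_integral _)).
apply/funext => x; apply/funext => y; apply/funext => t.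
by rewrite /cplx -!rmorphM; congr (_%:C)%C; rewrite /tens /g /h /= -!gaussianM; ring.
Qed.

Let Bc0 k : 0 < B k + c. Proof. by rewrite addr_gt0. Qed.

Lemma Lambda2_odd_G :
  form_size Lambda2 (gaussian c) (tens h (gaussian d)) (tens g (gaussian d)) =
  `|s * Num.sqrt (pi / (d + d)) * odd_value n w (fun k => B k + c) A|.
Proof.
rewrite -(pv_odd_rev_x n w s A0 Bc0 (addr_gt0 d0 d0)).
rewrite /form_size; congr (Normc.normc (pv_integral _)).
apply/funext => x; apply/funext => y; apply/funext => t.
by rewrite /cplx -!rmorphM; congr (_%:C)%C; rewrite /tens /g /h /= -!gaussianM -gaussian_odd_sum; ring.
Qed.

Lemma Lambda41_odd_H :
  form_size (Lambda4 1) (gaussian c) (tens g (gaussian d)) (tens h (gaussian d)) =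
  `|s * Num.sqrt (pi / (d + d)) * odd_value n w (fun k => B k + c) A|.
Proof.
rewrite -(pv_odd_x n w s A0 Bc0 (addr_gt0 d0 d0)).
rewrite /form_size; congr (Normc.normc (pv_integral _)).
apply/funext => x; apply/funext => y; apply/funext => t; rewrite mul1r.
by rewrite /cplx -!rmorphM; congr (_%:C)%C; rewrite /tens /g /h /= -!gaussianM -gaussian_odd_sum; ring.
Qed.

Lemma Lambda41_odd_G :
  form_size (Lambda4 1) (gaussian c) (tens h (gaussian d)) (tens g (gaussian d)) =
  `|s * Num.sqrt (pi / (d + d)) * odd_value n w B (A + c)|.
Proof.
rewrite -(pv_odd_rev_x n w s (addr_gt0 A0 c0) B0 (addr_gt0 d0 d0)).
rewrite /form_size; congr (Normc.normc (pv_integral _)).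
apply/funext => x; apply/funext => y; apply/funext => t; rewrite mul1r.
by rewrite /cplx -!rmorphM; congr (_%:C)%C; rewrite /tens /g /h /= -!gaussianM; ring.
Qed.

Lemma Lambda40_odd_f :
  form_size (Lambda4 0) h (tens (gaussian A) (gaussian d)) (tens (gaussian A) (gaussian d)) =
  `|1 * Num.sqrt (pi / (d + d)) * odd_value n w B (A + A)|.
Proof.
rewrite -(pv_odd_x n w 1 (addr_gt0 A0 A0) B0 (addr_gt0 d0 d0)).
rewrite /form_size; congr (Normc.normc (pv_integral _)).
apply/funext => x; apply/funext => y; apply/funext => t; rewrite mul0r addr0.
by rewrite /cplx -!rmorphM; congr (_%:C)%C; rewrite /tens /h /= -!gaussianM; ring.
Qed.

Lemma Lambda3_odd_f :
  form_size Lambda3 h (tens (gaussian A) (gaussian d)) (tens (gaussian A) (gaussian d)) =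
  `|Num.sqrt (pi / (d + d)) * \sum_(k < n) w k * (A + A) / (A + A + B k) * Num.sqrt (pi / (A + A + B k)) *
     Num.sqrt (pi / ((A + A) * B k / (A + A + B k) + d * d / (d + d)))|.
Proof.
transitivity (`|Num.sqrt (pi / (d + d)) * \sum_(k < n) w k * ((A + A) / (A + A + B k) * Num.sqrt (pi / (A + A + B k))) *
     Num.sqrt (pi / ((A + A) * B k / (A + A + B k) + d * d / (d + d)))|); last first.
  by congr (`| _ * _ |); apply: eq_bigr => k _; rewrite !mulrA.
rewrite -(pv_odd_both n w (addr_gt0 A0 A0) B0 d0).
rewrite /form_size; congr (Normc.normc (pv_integral _)).
apply/funext => x; apply/funext => y; apply/funext => t.
by rewrite /cplx -!rmorphM; congr (_%:C)%C; rewrite /tens /h /= -!gaussianM; ring.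
Qed.

End values.

Lemma ratio_ge (a b A B : R) : 0 < b -> b <= a -> a ^+ 2 <= A -> 0 < B -> B <= 3 * b ^+ 2 ->
  1 / 4 <= A / (A + B).
Proof.
move=> b0 ba aA B0 Bb; have b2 : b ^+ 2 <= a ^+ 2 by rewrite ler_sqr ?nnegrE ?(ltW b0)// (le_trans (ltW b0)).
have bb : 0 < b ^+ 2 by rewrite exprn_gt0.
have A0 : 0 < A by rewrite (lt_le_trans _ aA)// (lt_le_trans bb).
rewrite ler_pdivlMr ?addr_gt0// mulrC mulrA ler_pdivrMr//; lra.
Qed.

(** The bound does not involve the frequency [b] of the odd term: all terms of a
    lacunary sum contribute equally. *)
Lemma odd_term_ge (a b A B : R) : 0 < b -> b <= a -> a ^+ 2 <= A -> A <= 2 * a ^+ 2 ->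
  0 < B -> B <= 3 * b ^+ 2 -> pi / 12 / a <= b * (A / (A + B) * (pi / Num.sqrt (A * B))).
Proof.
move=> b0 ba aA Aa B0 Bb; have a0 : 0 < a by exact: lt_le_trans ba.
have A0 : 0 < A by rewrite (lt_le_trans _ aA)// exprn_gt0.
have AB0 : 0 < A * B by rewrite mulr_gt0.
have r := ratio_ge b0 ba aA B0 Bb.
have s : Num.sqrt (A * B) <= 3 * (a * b).
  have ab0 : 0 <= 3 * (a * b) by rewrite !mulr_ge0// ltW.
  rewrite -[leRHS](ger0_norm ab0) -sqrtr_sqr ler_wsqrtr//.
  apply: (@le_trans _ _ ((2 * a ^+ 2) * (3 * b ^+ 2))).
    by apply: ler_pM => //; exact: ltW.
  have := mulr_ge0 (sqr_ge0 a) (sqr_ge0 b); have -> : (3 * (a * b)) ^+ 2 = 9 * (a ^+ 2 * b ^+ 2) by ring.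
  have -> : 2 * a ^+ 2 * (3 * b ^+ 2) = 6 * (a ^+ 2 * b ^+ 2) by ring.
  lra.
have s0 : 0 < Num.sqrt (A * B) by rewrite sqrtr_gt0.
have ps : pi / (3 * (a * b)) <= pi / Num.sqrt (A * B).
  by rewrite ler_wpM2l ?pi_ge0// lef_pV2 ?posrE// !mulr_gt0.
apply: (@le_trans _ _ (b * (1 / 4 * (pi / (3 * (a * b)))))).
  by rewrite le_eqVlt; apply/orP; left; apply/eqP; field; rewrite !gt_eqF.
rewrite ler_wpM2l ?(ltW b0)//; apply: ler_pM => //.
by rewrite divr_ge0 ?pi_ge0// !mulr_ge0// ltW.
Qed.

Lemma odd_value_ge n (w B : nat -> R) (A a : R) :
  (forall k, (k < n)%N -> 0 < w k /\ w k <= a) ->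
  (forall k, (k < n)%N -> 0 < B k /\ B k <= 3 * w k ^+ 2) ->
  a ^+ 2 <= A -> A <= 2 * a ^+ 2 -> n%:R * (pi / 12 / a) <= odd_value n w B A.
Proof.
move=> wa Bw aA Aa; rewrite /odd_value.
have -> : n%:R * (pi / 12 / a) = \sum_(k < n) (pi / 12 / a).
  by rewrite sumr_const card_ord mulr_natl.
apply: ler_sum => k _; have [w0 wk] := wa k (ltn_ord k); have [B0 Bk] := Bw k (ltn_ord k).
exact: odd_term_ge.
Qed.

Lemma sqrt_pi_ge (D d : R) : 0 < d -> 0 < D -> D <= 3 * d ^+ 2 -> (2 * d)^-1 <= Num.sqrt (pi / D).
Proof.
move=> d0 D0 Dd; have i0 : 0 <= (2 * d)^-1 by rewrite invr_ge0 mulr_ge0// ltW.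
rewrite -[leLHS](ger0_norm i0) -sqrtr_sqr ler_wsqrtr//.
rewrite ler_pdivlMr// exprVn mulrC ler_pdivrMr ?exprn_gt0 ?mulr_gt0//.
have := pi_ge2 R; have := sqr_ge0 d; have -> : (2 * d) ^+ 2 = 4 * d ^+ 2 by ring.
move: (exprn_gt0 2 d0); nra.
Qed.

Lemma odd_form_ge n (w B : nat -> R) (A D a d s : R) : 0 < s -> 0 < a -> 0 < d -> 0 < D -> D <= 3 * d ^+ 2 ->
  (forall k, (k < n)%N -> 0 < w k /\ w k <= a) ->
  (forall k, (k < n)%N -> 0 < B k /\ B k <= 3 * w k ^+ 2) ->
  a ^+ 2 <= A -> A <= 2 * a ^+ 2 ->
  n%:R * (s * (pi / 24) / (a * d)) <= `|s * Num.sqrt (pi / D) * odd_value n w B A|.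
Proof.
move=> s0 a0 d0 D0 Dd wa Bw aA Aa; rewrite (le_trans _ (ler_norm _))//.
have h1 := odd_value_ge wa Bw aA Aa; have h2 := sqrt_pi_ge d0 D0 Dd.
apply: (@le_trans _ _ (s * (2 * d)^-1 * (n%:R * (pi / 12 / a)))).
  by rewrite le_eqVlt; apply/orP; left; apply/eqP; field; rewrite !gt_eqF.
apply: ler_pM => //; rewrite ?mulr_ge0 ?invr_ge0 ?mulr_ge0 ?divr_ge0 ?pi_ge0 ?(ltW s0) ?(ltW d0) ?(ltW a0)//.
by rewrite ler_wpM2l// ltW.
Qed.

(** As long as every frequency [w k] is at least the frequency [d] of the second
    variable, the motion of that variable costs each term no more than a constant
    factor. *)
Lemma both_form_ge n (w B : nat -> R) (A a d : R) : 0 < a -> 0 < d ->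
  (forall k, (k < n)%N -> 0 < w k /\ w k <= a) -> (forall k, (k < n)%N -> d <= w k) ->
  (forall k, (k < n)%N -> 0 < B k /\ B k <= 3 * w k ^+ 2) ->
  a ^+ 2 <= A -> A <= 2 * a ^+ 2 ->
  n%:R * (24 * (a * d))^-1 <= `|Num.sqrt (pi / (d ^+ 2 + d ^+ 2)) * \sum_(k < n) w k * A / (A + B k) * Num.sqrt (pi / (A + B k)) *
     Num.sqrt (pi / (A * B k / (A + B k) + d ^+ 2 * d ^+ 2 / (d ^+ 2 + d ^+ 2)))|.
Proof.
move=> a0 d0 wa dw Bw aA Aa; rewrite (le_trans _ (ler_norm _))//.
have p2 := pi_ge2 R.
have lowb (x y : R) : 0 < x -> 0 < y -> y <= 2 * x ^+ 2 -> x^-1 <= Num.sqrt (pi / y).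
  move=> x0 y0 yx; have i0 : 0 <= x^-1 by rewrite invr_ge0 ltW.
  rewrite -[leLHS](ger0_norm i0) -sqrtr_sqr ler_wsqrtr//.
  by rewrite ler_pdivlMr// exprVn mulrC ler_pdivrMr ?exprn_gt0//; move: (exprn_gt0 2 x0); nra.
have h1 : d^-1 <= Num.sqrt (pi / (d ^+ 2 + d ^+ 2)).
  by apply: lowb => //; [rewrite addr_gt0 ?exprn_gt0|lra].
apply: (@le_trans _ _ (d^-1 * \sum_(k < n) (24 * a)^-1)).
  rewrite sumr_const card_ord -mulr_natl le_eqVlt; apply/orP; left; apply/eqP.
  by field; rewrite !gt_eqF.
apply: ler_pM => //; first by rewrite invr_ge0 ltW.
  by apply: sumr_ge0 => k _; rewrite invr_ge0 mulr_ge0// ltW.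
apply: ler_sum => k _; have [w0 wk] := wa k (ltn_ord k); have [B0 Bk] := Bw k (ltn_ord k).
have dk := dw k (ltn_ord k).
have A0 : 0 < A by rewrite (lt_le_trans _ aA)// exprn_gt0.
have AB : 0 < A + B k by rewrite addr_gt0.
have w2 : w k ^+ 2 <= a ^+ 2 by rewrite ler_sqr ?nnegrE ?(ltW w0) ?(ltW a0).
have d2 : d ^+ 2 <= w k ^+ 2 by rewrite ler_sqr ?nnegrE ?(ltW w0) ?(ltW d0).
have r := ratio_ge w0 wk aA B0 Bk.
have d20 : 0 < d ^+ 2 by rewrite exprn_gt0.
have t1 : (3 * a)^-1 <= Num.sqrt (pi / (A + B k)).
  by apply: lowb; rewrite ?mulr_gt0// exprMn; lra.
have eE : d ^+ 2 * d ^+ 2 / (d ^+ 2 + d ^+ 2) = d ^+ 2 / 2.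
  set z := d ^+ 2; have z0 : z != 0 by rewrite gt_eqF.
  have zz : z + z != 0 by rewrite gt_eqF// addr_gt0.
  by apply: (canLR (mulfK zz)); field.
have t2 : (2 * w k)^-1 <= Num.sqrt (pi / (A * B k / (A + B k) + d ^+ 2 * d ^+ 2 / (d ^+ 2 + d ^+ 2))).
  apply: lowb; rewrite ?mulr_gt0//.
    by rewrite addr_gt0// divr_gt0 ?mulr_gt0 ?addr_gt0.
  have : A * B k / (A + B k) <= B k.
    rewrite ler_pdivrMr// mulrC; have := mulr_gt0 B0 B0; nra.
  rewrite eE exprMn; lra.
apply: (@le_trans _ _ (w k * (1 / 4) * (3 * a)^-1 * (2 * w k)^-1)).
  by rewrite le_eqVlt; apply/orP; left; apply/eqP; field; rewrite !gt_eqF.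
rewrite -[w k * A / _]mulrA.
have i1 : 0 <= w k * (1 / 4) by rewrite mulr_ge0// ltW.
have i2 : 0 <= (2 * w k)^-1 by rewrite invr_ge0 mulr_ge0// ltW.
have i3 : 0 <= (3 * a)^-1 by rewrite invr_ge0 mulr_ge0// ltW.
apply: ler_pM => //; first exact: mulr_ge0.
by apply: ler_pM => //; rewrite ler_wpM2l// ltW.
Qed.

(** The functions are dominated by Gaussians at the frequencies [p] and [q], so that
    their norms are at most constant multiples of powers of [p] and [q]. If the form is
    bounded, then [k0] is at most a constant times [p `^ (- rexp P1) * (p * q) `^ (1 -
    rexp P2 - rexp P3)]. *)
Definition scaling_witness (L : trilinear_form R) (k0 p q : R) : Prop := exists f G H,
  [/\ schwartz1_real f, schwartz2_real G & schwartz2_real H] /\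
  [/\ forall x, `|f x| <= gaussian (p ^+ 2) x,
      forall z, `|G z| <= gaussian (p ^+ 2) z.1 * gaussian (q ^+ 2) z.2,
      forall z, `|H z| <= gaussian (p ^+ 2) z.1 * gaussian (q ^+ 2) z.2 &
      k0 <= form_size L f G H * (p * q)].

Definition scaling_family (L : trilinear_form R) : Prop :=
  exists2 k0 : R, 0 < k0 & forall p q : R, 0 < q -> q <= p -> scaling_witness L k0 p q.

(** [U] is dominated by a Gaussian of integral [pi], and [f] and [V] are bounded. The
    boolean tells whether [U] stands for [G] and [V] for [H], or conversely. *)
Definition endpoint_witness (b : bool) (L : trilinear_form R) (k : R) : Prop := exists f U V,
  [/\ schwartz1_real f, schwartz2_real U & schwartz2_real V] /\
  [/\ forall x, `|f x| <= 1,
      exists p q : R, [/\ 0 < p, 0 < q & forall z, `|U z| <= (p * q) * (gaussian (p ^+ 2) z.1 * gaussian (q ^+ 2) z.2)],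
      forall z, `|V z| <= 4 &
      k <= if b then form_size L f U V else form_size L f V U].

Definition endpoint_family (b : bool) (L : trilinear_form R) : Prop :=
  exists2 k0 : R, 0 < k0 & forall n : nat, endpoint_witness b L (n%:R * k0).

(** The integral of [G ^+ 2] is at most of order [1 / p], which the last factor
    compensates. *)
Definition logarithmic_witness (L : trilinear_form R) (k : R) : Prop := exists f G p,
  [/\ schwartz1_real f, schwartz2_real G & 0 < p] /\
  [/\ forall x, `|f x| <= 4,
      forall z, `|G z| <= gaussian (p ^+ 2) z.1 * gaussian (1 ^+ 2) z.2 &
      k <= form_size L f G G * p].

Definition logarithmic_family (L : trilinear_form R) : Prop :=
  exists2 k0 : R, 0 < k0 & forall n : nat, logarithmic_witness L (n%:R * k0).

Lemma tens_le (u v u' v' : R -> R) : (forall x, `|u x| <= u' x) -> (forall x, `|v x| <= v' x) ->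
  forall z, `|tens u v z| <= u' z.1 * v' z.2.
Proof. by move=> uu vv z; rewrite normrM ler_pM. Qed.

Lemma gaussian_norm (a x : R) : `|gaussian a x| <= gaussian a x.
Proof. by rewrite ger0_norm ?gaussian_ge0. Qed.

Lemma scaled_gaussian_norm (s a x : R) : 0 <= s -> `|s * gaussian a x| <= s * gaussian a x.
Proof. by move=> s0; rewrite ger0_norm ?mulr_ge0 ?gaussian_ge0. Qed.

Section scaling.
Variables p q : R.
Hypotheses (p0 : 0 < p) (q0 : 0 < q).
Let p2 : 0 < p ^+ 2. Proof. exact: exprn_gt0. Qed.
Let q2 : 0 < q ^+ 2. Proof. exact: exprn_gt0. Qed.
Let pp : forall k : nat, 0 < (fun=> 2 * p ^+ 2) k. Proof. by move=> k; rewrite mulr_gt0. Qed.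
Let qq : forall k : nat, 0 < (fun=> 2 * q ^+ 2) k. Proof. by move=> k; rewrite mulr_gt0. Qed.
Let one (a : R) : (fun x => 1 * gaussian a x) = gaussian a :> (R -> R).
Proof. by apply/funext => x; rewrite mul1r. Qed.

Lemma Lambda1_scaling : pi / 24 <=
  form_size Lambda1 (gaussian (p ^+ 2)) (tens (gaussian (p ^+ 2)) (gaussian (q ^+ 2))) (tens (gaussian (p ^+ 2)) (bump q)) * (p * q).
Proof.
rewrite -(one (q ^+ 2)) (@Lambda1_odd_H 1 (fun=> q) (fun=> 2 * q ^+ 2) _ _ 1 q2 qq p2).
rewrite -ler_pdivrMr ?mulr_gt0//.
have := @odd_form_ge 1 (fun=> q) (fun=> 2 * q ^+ 2) (q ^+ 2) (p ^+ 2 + p ^+ 2 + p ^+ 2) q p 1 ltr01 q0 p0.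
rewrite !mul1r [q * p]mulrC; apply => //; try by move=> k _; split=> //; lra.
- by rewrite !addr_gt0.
- lra.
- by move=> k _; split; [exact: qq|move: q2; lra].
- move: q2; lra.
Qed.

Lemma Lambda2_scaling : pi / 24 <=
  form_size Lambda2 (gaussian (p ^+ 2)) (tens (gaussian (p ^+ 2)) (gaussian (q ^+ 2))) (tens (bump p) (gaussian (q ^+ 2))) * (p * q).
Proof.
rewrite -{2}(one (p ^+ 2)) (@Lambda2_odd_H 1 (fun=> p) (fun=> 2 * p ^+ 2) _ _ _ 1 p2 pp p2 q2).
rewrite -ler_pdivrMr ?mulr_gt0//.
have := @odd_form_ge 1 (fun=> p) (fun=> 2 * p ^+ 2) (p ^+ 2 + p ^+ 2) (q ^+ 2 + q ^+ 2) p q 1 ltr01 p0 q0.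
rewrite !mul1r; apply => //.
- by rewrite !addr_gt0.
- move: q2; lra.
- by move=> k _; split; [exact: pp|move: p2; lra].
- move: p2; lra.
- move: p2; lra.
Qed.

Lemma Lambda41_scaling : pi / 24 <=
  form_size (Lambda4 1) (gaussian (p ^+ 2)) (tens (gaussian (p ^+ 2)) (gaussian (q ^+ 2))) (tens (bump p) (gaussian (q ^+ 2))) * (p * q).
Proof.
rewrite -{2}(one (p ^+ 2)) (@Lambda41_odd_H 1 (fun=> p) (fun=> 2 * p ^+ 2) _ _ _ 1 p2 pp p2 q2).
rewrite -ler_pdivrMr ?mulr_gt0//.
have := @odd_form_ge 1 (fun=> p) (fun=> 2 * p ^+ 2 + p ^+ 2) (p ^+ 2) (q ^+ 2 + q ^+ 2) p q 1 ltr01 p0 q0.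
rewrite !mul1r; apply => //.
- by rewrite !addr_gt0.
- move: q2; lra.
- by move=> k _; split; [rewrite addr_gt0 ?mulr_gt0|move: p2; lra].
- move: p2; lra.
Qed.

Lemma Lambda40_scaling : pi / 24 <=
  form_size (Lambda4 0) (bump p) (tens (gaussian (p ^+ 2)) (gaussian (q ^+ 2))) (tens (gaussian (p ^+ 2)) (gaussian (q ^+ 2))) * (p * q).
Proof.
rewrite (@Lambda40_odd_f 1 (fun=> p) (fun=> 2 * p ^+ 2) _ _ p2 pp q2).
rewrite -ler_pdivrMr ?mulr_gt0//.
have := @odd_form_ge 1 (fun=> p) (fun=> 2 * p ^+ 2) (p ^+ 2 + p ^+ 2) (q ^+ 2 + q ^+ 2) p q 1 ltr01 p0 q0.
rewrite !mul1r; apply => //.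
- by rewrite !addr_gt0.
- move: q2; lra.
- by move=> k _; split; [exact: pp|move: p2; lra].
- move: p2; lra.
- move: p2; lra.
Qed.

Lemma Lambda3_scaling : q <= p -> 24^-1 <=
  form_size Lambda3 (bump p) (tens (gaussian (p ^+ 2)) (gaussian (q ^+ 2))) (tens (gaussian (p ^+ 2)) (gaussian (q ^+ 2))) * (p * q).
Proof.
move=> qp; rewrite (@Lambda3_odd_f 1 (fun=> p) (fun=> 2 * p ^+ 2) _ _ p2 pp q2).
rewrite -ler_pdivrMr ?mulr_gt0// -invfM.
have := @both_form_ge 1 (fun=> p) (fun=> 2 * p ^+ 2) (p ^+ 2 + p ^+ 2) p q p0 q0.
rewrite mul1r; apply => //.
- by move=> k _; split; [exact: pp|move: p2; lra].
- move: p2; lra.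
- move: p2; lra.
Qed.

End scaling.

Lemma scaling_witness_tens (L : trilinear_form R) (k0 p q : R) (f u v u' v' : R -> R) :
  [/\ schwartz1_real f, schwartz1_real u, schwartz1_real v, schwartz1_real u' & schwartz1_real v'] ->
  [/\ forall x, `|f x| <= gaussian (p ^+ 2) x,
      forall x, `|u x| <= gaussian (p ^+ 2) x, forall x, `|v x| <= gaussian (q ^+ 2) x,
      forall x, `|u' x| <= gaussian (p ^+ 2) x & forall x, `|v' x| <= gaussian (q ^+ 2) x] ->
  k0 <= form_size L f (tens u v) (tens u' v') * (p * q) -> scaling_witness L k0 p q.
Proof.
move=> [sf su sv su' sv'] [bf bu bv bu' bv'] hL; exists f, (tens u v), (tens u' v'); split; split => //.
- exact: schwartz2_tens.
- exact: schwartz2_tens.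
- exact: tens_le.
- exact: tens_le.
Qed.

Lemma schwartz1_bump (p : R) : 0 < p -> schwartz1_real (bump p).
Proof. by move=> p0; apply: schwartz1_odd_sum => k; rewrite mulr_gt0// exprn_gt0. Qed.

Lemma scaling_family_H (L : trilinear_form R) :
  [\/ L = Lambda1, L = Lambda2 | L = Lambda4 1] -> scaling_family L.
Proof.
have pi0 : 0 < pi / 24 :> R by rewrite divr_gt0// pi_gt0.
have sg (p : R) : 0 < p -> schwartz1_real (gaussian (p ^+ 2)) by move=> p0; exact: schwartz1_gauss (exprn_gt0 2 p0).
have gn (p : R) := @gaussian_norm (p ^+ 2).
case=> ->; exists (pi / 24) => // p q q0 qp; have p0 : 0 < p by exact: lt_le_trans qp.
all: have bp := fun x => odd_sum1_le x p0; have bq := fun x => odd_sum1_le x q0.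
all: have sp := schwartz1_bump p0; have sq := schwartz1_bump q0.
- by apply: scaling_witness_tens (Lambda1_scaling p0 q0); split=> //; exact: sg.
- by apply: scaling_witness_tens (Lambda2_scaling p0 q0); split=> //; exact: sg.
- by apply: scaling_witness_tens (Lambda41_scaling p0 q0); split=> //; exact: sg.
Qed.

Lemma scaling_family_f (L : trilinear_form R) : L = Lambda3 \/ L = Lambda4 0 -> scaling_family L.
Proof.
have pi0 : 0 < pi / 24 :> R by rewrite divr_gt0// pi_gt0.
have sg (p : R) : 0 < p -> schwartz1_real (gaussian (p ^+ 2)) by move=> p0; exact: schwartz1_gauss (exprn_gt0 2 p0).
have gn (p : R) := @gaussian_norm (p ^+ 2).
case=> ->; [exists 24^-1; first by rewrite invr_gt0|exists (pi / 24) => //].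
all: move=> p q q0 qp; have p0 : 0 < p by exact: lt_le_trans qp.
all: have bp := fun x => odd_sum1_le x p0; have sp := schwartz1_bump p0.
- by apply: scaling_witness_tens (Lambda3_scaling p0 q0 qp); split=> //; exact: sg.
- by apply: scaling_witness_tens (Lambda40_scaling p0 q0); split=> //; exact: sg.
Qed.

Section dyadic.
(* The odd sum has the frequencies [2 ^ k] for [k < n]; the Gaussian tested against it
   has the frequency [2 ^ n], higher than all of these. *)
Variable n : nat.
Let w (k : nat) : R := 2 ^+ k.
Let B (k : nat) : R := 2 ^+ k ^+ 2.
Let a : R := 2 ^+ n.
Let A : R := a ^+ 2.
Let h := odd_sum n w B.

Let w1 k : 1 <= w k. Proof. by rewrite exprn_ege1// ler1n. Qed.
Let w0 k : 0 < w k. Proof. exact: lt_le_trans (w1 k). Qed.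
Let B0 k : 0 < B k. Proof. by rewrite exprn_gt0. Qed.
Let Bc0 k : 0 < B k + 1 ^+ 2. Proof. by rewrite addr_gt0. Qed.
Let a1 : 1 <= a. Proof. by rewrite /a exprn_ege1// ler1n. Qed.
Let a0 : 0 < a. Proof. exact: lt_le_trans a1. Qed.
Let A0 : 0 < A. Proof. exact: exprn_gt0. Qed.
Let A1 : 1 <= A. Proof. by rewrite /A exprn_ege1. Qed.
Let o0 : 0 < 1 ^+ 2 :> R. Proof. by rewrite expr1n. Qed.
Let wa k : (k < n)%N -> 0 < w k /\ w k <= a.
Proof. by move=> kn; split=> //; rewrite /w /a ler_eXn2l ?ltr1n// ltnW. Qed.
Let Bw k : (k < n)%N -> 0 < B k /\ B k <= 3 * w k ^+ 2.
Proof. by move=> kn; split=> //; rewrite -/(w k) /B; move: (B0 k); rewrite /B /w; lra. Qed.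
Let Bw1 k : (k < n)%N -> 0 < B k + 1 ^+ 2 /\ B k + 1 ^+ 2 <= 3 * w k ^+ 2.
Proof.
move=> kn; split=> //; have := @exprn_ege1 _ 2 _ (w1 k); rewrite /B /w expr1n; lra.
Qed.
Let AA : A <= 2 * a ^+ 2. Proof. by rewrite /A; move: A0; rewrite /A; lra. Qed.
Let A1A : A + 1 ^+ 2 <= 2 * a ^+ 2. Proof. by rewrite expr1n /A; move: A1; rewrite /A; lra. Qed.
Let AA1 : a ^+ 2 <= A + 1 ^+ 2. Proof. by rewrite expr1n /A lerDl. Qed.
Let d3 : 1 ^+ 2 + 1 ^+ 2 + 1 ^+ 2 <= 3 * 1 ^+ 2 :> R. Proof. by rewrite !expr1n; lra. Qed.
Let d2 : 1 ^+ 2 + 1 ^+ 2 <= 3 * 1 ^+ 2 :> R. Proof. by rewrite !expr1n; lra. Qed.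
Let d30 : 0 < 1 ^+ 2 + 1 ^+ 2 + 1 ^+ 2 :> R. Proof. by rewrite !addr_gt0. Qed.
Let d20 : 0 < 1 ^+ 2 + 1 ^+ 2 :> R. Proof. by rewrite !addr_gt0. Qed.
Let AE : n%:R * (a * (pi / 24) / (a * 1)) = n%:R * (pi / 24).
Proof. by field; rewrite gt_eqF. Qed.

Let sh : schwartz1_real h. Proof. exact: schwartz1_odd_sum. Qed.
Let so : schwartz1_real (gaussian (1 ^+ 2) : R -> R). Proof. exact: schwartz1_gauss. Qed.
Let sU : schwartz1_real (fun x => a * gaussian A x). Proof. exact: schwartz1_gaussian. Qed.
Let o1 x : `|gaussian (1 ^+ 2) x| <= 1 :> R.
Proof. by rewrite (le_trans (gaussian_norm _ _))// gaussian_le1// ltW. Qed.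
Let h4 x : `|h x| <= 4. Proof. exact: odd_sum_dyadic_le. Qed.

Local Notation g1 := (gaussian (1 ^+ 2)).
Local Notation gA := (fun x => a * gaussian A x).

Lemma dyadic_Lambda1_H : n%:R * (pi / 24) <= form_size Lambda1 g1 (tens g1 gA) (tens g1 h).
Proof. by rewrite Lambda1_odd_H// -AE; exact: odd_form_ge. Qed.

Lemma dyadic_Lambda1_G : n%:R * (pi / 24) <= form_size Lambda1 g1 (tens g1 h) (tens g1 gA).
Proof. by rewrite Lambda1_odd_G// -AE; exact: odd_form_ge. Qed.

Lemma dyadic_Lambda2_H : n%:R * (pi / 24) <= form_size Lambda2 g1 (tens gA g1) (tens h g1).
Proof. by rewrite Lambda2_odd_H// -AE; exact: odd_form_ge. Qed.

Lemma dyadic_Lambda2_G : n%:R * (pi / 24) <= form_size Lambda2 g1 (tens h g1) (tens gA g1).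
Proof. by rewrite Lambda2_odd_G// -AE; exact: odd_form_ge. Qed.

Lemma dyadic_Lambda41_H : n%:R * (pi / 24) <= form_size (Lambda4 1) g1 (tens gA g1) (tens h g1).
Proof. by rewrite Lambda41_odd_H// -AE; exact: odd_form_ge. Qed.

Lemma dyadic_Lambda41_G : n%:R * (pi / 24) <= form_size (Lambda4 1) g1 (tens h g1) (tens gA g1).
Proof. by rewrite Lambda41_odd_G// -AE; exact: odd_form_ge. Qed.

Lemma dyadic_Lambda40 :
  n%:R * (pi / 24) <= form_size (Lambda4 0) h (tens (gaussian A) g1) (tens (gaussian A) g1) * a.
Proof.
rewrite Lambda40_odd_f// -ler_pdivrMr//.
have -> : n%:R * (pi / 24) / a = n%:R * (1 * (pi / 24) / (a * 1)) by field; rewrite gt_eqF.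
by apply: odd_form_ge => //; rewrite /A; move: A0; rewrite /A; lra.
Qed.

Lemma dyadic_Lambda3 :
  n%:R * 24^-1 <= form_size Lambda3 h (tens (gaussian A) g1) (tens (gaussian A) g1) * a.
Proof.
rewrite Lambda3_odd_f// -ler_pdivrMr//.
have -> : n%:R * 24^-1 / a = n%:R * (24 * (a * 1))^-1 by field; rewrite gt_eqF.
by apply: both_form_ge => //; rewrite /A; move: A0; rewrite /A; lra.
Qed.

Lemma endpoint_witness_x b (L : trilinear_form R) (k : R) :
  k <= (if b then form_size L g1 (tens gA g1) (tens h g1) else form_size L g1 (tens h g1) (tens gA g1)) ->
  endpoint_witness b L k.
Proof.
move=> hL; exists g1, (tens gA g1), (tens h g1); split; split => //.
- exact: schwartz2_tens sU so.
- exact: schwartz2_tens sh so.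
- exists a, 1; split=> // z; rewrite mulr1 mulrA.
  by apply: (tens_le (u' := gA)) => x; [exact: scaled_gaussian_norm (ltW a0)|exact: gaussian_norm].
- by move=> z; rewrite -[leRHS]mulr1; exact: (tens_le h4 o1).
Qed.

Lemma endpoint_witness_y b (L : trilinear_form R) (k : R) :
  k <= (if b then form_size L g1 (tens g1 gA) (tens g1 h) else form_size L g1 (tens g1 h) (tens g1 gA)) ->
  endpoint_witness b L k.
Proof.
move=> hL; exists g1, (tens g1 gA), (tens g1 h); split; split => //.
- exact: schwartz2_tens so sU.
- exact: schwartz2_tens so sh.
- exists 1, a; split=> // z; rewrite mul1r mulrCA.
  by apply: (tens_le (v' := gA)) => x; [exact: gaussian_norm|exact: scaled_gaussian_norm (ltW a0)].
- by move=> z; rewrite -[leRHS]mul1r; exact: (tens_le o1 h4).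
Qed.

Lemma logarithmic_witness_tens (L : trilinear_form R) (k : R) :
  k <= form_size L h (tens (gaussian A) g1) (tens (gaussian A) g1) * a -> logarithmic_witness L k.
Proof.
move=> hL; exists h, (tens (gaussian A) g1), a; split; split=> //.
- exact: schwartz2_tens (schwartz1_gauss A0) so.
- exact: tens_le (gaussian_norm _) (gaussian_norm _).
Qed.

End dyadic.

Lemma endpoint_family_GH b (L : trilinear_form R) :
  [\/ L = Lambda1, L = Lambda2 | L = Lambda4 1] -> endpoint_family b L.
Proof.
have pi0 : 0 < pi / 24 :> R by rewrite divr_gt0// pi_gt0.
case=> ->; exists (pi / 24) => // n.
- by apply: endpoint_witness_y; case: b; [exact: dyadic_Lambda1_H|exact: dyadic_Lambda1_G].
- by apply: endpoint_witness_x; case: b; [exact: dyadic_Lambda2_H|exact: dyadic_Lambda2_G].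
- by apply: endpoint_witness_x; case: b; [exact: dyadic_Lambda41_H|exact: dyadic_Lambda41_G].
Qed.

Lemma logarithmic_family_f (L : trilinear_form R) : L = Lambda3 \/ L = Lambda4 0 -> logarithmic_family L.
Proof.
have pi0 : 0 < pi / 24 :> R by rewrite divr_gt0// pi_gt0.
case=> ->; [exists 24^-1 => [|n]; first by rewrite invr_gt0|exists (pi / 24) => // n].
  by apply: logarithmic_witness_tens; exact: dyadic_Lambda3.
by apply: logarithmic_witness_tens; exact: dyadic_Lambda40.
Qed.

End forms_values.

(** * Conditions on the exponents *)

Section necessity.
Context {R : realType}.

Lemma rexp_ge0 (P : \bar R) : (1 <= P)%E -> 0 <= rexp P.
Proof.
case: P => [p| |//]; last by rewrite rexp_pinfty.
rewrite lee_fin => p1; have p0 : 0 < p by exact: lt_le_trans p1.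
by rewrite rexp_EFin ?gt_eqF// invr_ge0 ltW.
Qed.

Lemma inve_rexp (P : \bar R) : (1 <= P)%E -> (P^-1 = (rexp P)%:E)%E.
Proof.
case: P => [p| |//]; last by rewrite rexp_pinfty invey.
rewrite lee_fin => p1; have p0 : p != 0 by rewrite gt_eqF// (lt_le_trans _ p1).
by rewrite rexp_EFin// inve_EFin.
Qed.

Lemma rexp_eq0 (P : \bar R) : (1 <= P)%E -> rexp P = 0 -> P = +oo%E.
Proof.
case: P => [p| |//]; last by [].
rewrite lee_fin => p1.
have p0 : 0 < p by rewrite (lt_le_trans _ p1).
by rewrite rexp_EFin ?gt_eqF// => /eqP; rewrite invr_eq0 gt_eqF.
Qed.

Lemma rexp_eq1 (P : \bar R) : (1 <= P)%E -> rexp P = 1 -> P = 1%E.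
Proof.
case: P => [p| |//]; last by rewrite rexp_pinfty => _ /esym/eqP; rewrite oner_eq0.
rewrite lee_fin => p1; have p0 : 0 < p by rewrite (lt_le_trans _ p1).
by rewrite rexp_EFin ?gt_eqF// => /eqP; rewrite invr_eq1 => /eqP ->.
Qed.

Lemma powR_bounded_le0 (s K : R) : (forall b, 1 <= b -> b `^ s <= K) -> s <= 0.
Proof.
move=> bK; rewrite leNgt; apply/negP => s0.
have K1 : 1 <= K by have := bK 1 (lexx 1); rewrite powR1.
have K0 : 0 <= K + 1 by rewrite addr_ge0// (le_trans ler01).
have b1 : 1 <= (K + 1) `^ s^-1.
  have -> : 1 = 1 `^ s^-1 :> R by rewrite powR1.
  by apply: ge0_ler_powR; rewrite ?nnegrE ?invr_ge0 ?(ltW s0)// powR1; move: K1; lra.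
have := bK _ b1; rewrite -powRrM mulVf ?gt_eqF// powRr1//; lra.
Qed.

Lemma bounded_with_real (P1 P2 P3 : \bar R) (C N1 N2 N3 : R) (L : trilinear_form R)
    (f : R -> R) (G H : R * R -> R) : bounded_with P1 P2 P3 C L ->
  schwartz1_real f -> schwartz2_real G -> schwartz2_real H ->
  ('N[@lebesgue_measure R]_P1[EFin \o f] <= N1%:E)%E ->
  ('N[@lebesgue2 R]_P2[EFin \o G] <= N2%:E)%E ->
  ('N[@lebesgue2 R]_P3[EFin \o H] <= N3%:E)%E ->
  form_size L f G H <= `|C| * (N1 * N2 * N3).
Proof.
move=> bL sf sG sH f1 G2 H3.
have := bL _ _ _ (schwartz1_cplx sf) (schwartz2_cplx sG) (schwartz2_cplx sH).
rewrite /cplx !cLnorm_real => h; rewrite -lee_fin (le_trans h)//.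
apply: (@le_trans _ _ (`|C|%:E * ('N[@lebesgue_measure R]_P1[EFin \o f] *
  'N[@lebesgue2 R]_P2[EFin \o G] * 'N[@lebesgue2 R]_P3[EFin \o H]))%E).
  apply: lee_wpmul2r; last by rewrite lee_fin ler_norm.
  by rewrite !mule_ge0 ?Lnorm_ge0.
rewrite !EFinM; apply: lee_wpmul2l; first by rewrite lee_fin.
apply: lee_pmul => //; rewrite ?mule_ge0 ?Lnorm_ge0//.
by apply: lee_pmul => //; rewrite Lnorm_ge0.
Qed.

Section with_exponents.
Variables (P1 P2 P3 : \bar R) (C : R) (L : trilinear_form R).
Hypotheses (h1 : (1 <= P1)%E) (h2 : (1 <= P2)%E) (h3 : (1 <= P3)%E).
Hypothesis bL : bounded_with P1 P2 P3 C L.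
Let r1 := rexp P1.
Let r2 := rexp P2.
Let r3 := rexp P3.

Lemma scaling_inequality (k0 p q : R) : 0 < k0 -> 0 < q -> q <= p ->
  scaling_witness L k0 p q ->
  k0 <= `|C| * pi ^+ 3 * (p `^ (- r1) * (p * q) `^ (- r2) * (p * q) `^ (- r3) * (p * q)).
Proof.
move=> k00 q0 qp; have p0 : 0 < p by exact: lt_le_trans qp.
move=> [f [G [H [[sf sG sH] [bf bG bH hk]]]]].
have mG (u : R * R -> R) : schwartz2_real u -> measurable_fun [set: measurableTypeR R * measurableTypeR R] u.
  by move=> /schwartz2_real_decays2/measurable_decays2.
have bf' x : `|f x| <= 1 * gaussian (p ^+ 2) x by rewrite mul1r.
have bG' z : `|G z| <= 1 * (gaussian (p ^+ 2) z.1 * gaussian (q ^+ 2) z.2) by rewrite mul1r.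
have bH' z : `|H z| <= 1 * (gaussian (p ^+ 2) z.1 * gaussian (q ^+ 2) z.2) by rewrite mul1r.
have hN := bounded_with_real bL sf sG sH
  (Lnorm_gaussian1_le h1 p0 ler01 (schwartz1_measurable sf) bf')
  (Lnorm_gaussian2_le h2 p0 q0 ler01 (mG _ sG) bG')
  (Lnorm_gaussian2_le h3 p0 q0 ler01 (mG _ sH) bH').
apply: (le_trans hk).
apply: (le_trans (ler_wpM2r _ hN)); first by rewrite mulr_ge0// ltW.
by rewrite le_eqVlt; apply/orP; left; apply/eqP; ring.
Qed.

(** At the frequencies [(1, b^-1)] and [(b, 1)], letting [b] tend to infinity gives [1 -
    r2 - r3 <= 0] and [r1 + r2 + r3 - 1 <= 0]. Since [r1 >= 0], both are equalities and
    [r1 = 0]. *)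
Lemma scaling_exponents : scaling_family L -> r1 = 0 /\ r2 + r3 = 1.
Proof.
move=> [k0 k00 fam]; have r10 : 0 <= r1 by exact: rexp_ge0.
have S p q : 0 < q -> q <= p -> k0 <= `|C| * pi ^+ 3 * (p `^ (- r1) * (p * q) `^ (- r2) * (p * q) `^ (- r3) * (p * q)).
  by move=> q0 qp; apply: scaling_inequality => //; exact: fam.
set K := `|C| * pi ^+ 3 in S.
have s1 : 1 - r2 - r3 <= 0.
  apply: (@powR_bounded_le0 _ (K / k0)) => b b1; have b0 : 0 < b by rewrite (lt_le_trans _ b1).
  have ib0 : 0 < b^-1 by rewrite invr_gt0.
  have := S 1 b^-1 ib0 (_ : b^-1 <= 1); rewrite invf_le1// => /(_ b1).
  have iE r : b^-1 `^ (- r) = b `^ r by rewrite -powR_inv1 ?(ltW b0)// -powRrM mulN1r opprK.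
  rewrite !mul1r powR1 mul1r !iE => h.
  rewrite !powRD ?(gt_eqF b0) ?implybT// !powRN powRr1 ?(ltW b0)// ler_pdivlMr//.
  have p2 : 0 < b `^ r2 by exact: powR_gt0.
  have p3 : 0 < b `^ r3 by exact: powR_gt0.
  have m0 : 0 <= b / b `^ r2 / b `^ r3 by rewrite !divr_ge0 ?(ltW b0) ?(ltW p2) ?(ltW p3).
  apply: (le_trans (ler_wpM2l m0 h)); rewrite le_eqVlt; apply/orP; left; apply/eqP.
  by field; rewrite !gt_eqF.
have s2 : r1 + r2 + r3 - 1 <= 0.
  apply: (@powR_bounded_le0 _ (K / k0)) => b b1; have b0 : 0 < b by rewrite (lt_le_trans _ b1).
  have := S b 1 ltr01 b1; rewrite mulr1 => h.
  rewrite !powRD ?(gt_eqF b0) ?implybT// powRN powRr1 ?(ltW b0)// ler_pdivlMr//.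
  have q1 : 0 < b `^ r1 by exact: powR_gt0.
  have q2 : 0 < b `^ r2 by exact: powR_gt0.
  have q3 : 0 < b `^ r3 by exact: powR_gt0.
  have m0 : 0 <= b `^ r1 * b `^ r2 * b `^ r3 / b by rewrite !mulr_ge0 ?invr_ge0 ?(ltW b0) ?(ltW q1) ?(ltW q2) ?(ltW q3).
  apply: (le_trans (ler_wpM2l m0 h)); rewrite !powRN le_eqVlt; apply/orP; left; apply/eqP.
  by field; rewrite !gt_eqF.
by split; lra.
Qed.

Lemma linear_growth_contradiction (k0 K : R) : 0 < k0 -> (forall n : nat, n%:R * k0 <= K) -> False.
Proof.
move=> k00 hK; have K0 : 0 <= K by have := hK 0%N; rewrite mul0r.
have := archi_boundP (divr_ge0 K0 (ltW k00)).
rewrite ltr_pdivrMr// => h; have := hK (Num.bound (K / k0)).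
by rewrite leNgt h.
Qed.

Lemma endpoint_unbounded (b : bool) : P1 = +oo%E ->
  (if b then P2 else P3) = 1%E -> (if b then P3 else P2) = +oo%E -> endpoint_family b L -> False.
Proof.
move=> e1 eU eV [k0 k00 fam].
apply: (@linear_growth_contradiction k0 (`|C| * (1 * (pi * 4)))) => // n.
have [f [U [V [[sf sU sV] [bf [p [q [p0 q0 bU]]] bV hk]]]]] := fam n.
apply: (le_trans hk).
have mG (u : R * R -> R) : schwartz2_real u -> measurable_fun [set: measurableTypeR R * measurableTypeR R] u.
  by move=> /schwartz2_real_decays2/measurable_decays2.
have pq : 0 < p * q by rewrite mulr_gt0.
have nf : ('N[@lebesgue_measure R]_P1[EFin \o f] <= 1%:E)%E by rewrite e1; exact: Lnorm_sup_le.
have nU : ('N[@lebesgue2 R]_1[EFin \o U] <= pi%:E)%E.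
  have := @Lnorm_gaussian2_le R 1%E U p q (p * q) (lexx _) p0 q0 (ltW pq) (mG _ sU) bU.
  rewrite rexp_EFin ?oner_eq0// invr1 powRN powRr1 ?(ltW pq)//.
  by rewrite mulrAC divff ?gt_eqF// mul1r.
have nV : ('N[@lebesgue2 R]_+oo[EFin \o V] <= 4%:E)%E by exact: Lnorm_sup_le.
case: b fam hk eU eV => _ _ e2 e3.
  rewrite mulrA; apply: (bounded_with_real bL) => //; [by rewrite e2|by rewrite e3].
rewrite [pi * 4]mulrC [1 * _]mulrA; apply: (bounded_with_real bL) => //; [by rewrite e3|by rewrite e2].
Qed.

(** Because of [r2 + r3 = 1] the two norms of [G] multiply to a constant times [p^-1].
    *)
Lemma logarithmic_unbounded : P1 = +oo%E -> r2 + r3 = 1 -> logarithmic_family L -> False.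
Proof.
move=> e1 r23 [k0 k00 fam].
apply: (@linear_growth_contradiction k0 (`|C| * 4 * pi ^+ 2)) => // n.
have [f [G [p [[sf sG p0] [bf bG hk]]]]] := fam n.
apply: (le_trans hk).
have mG : measurable_fun [set: measurableTypeR R * measurableTypeR R] G.
  by move/schwartz2_real_decays2/measurable_decays2 : sG.
have nf : ('N[@lebesgue_measure R]_P1[EFin \o f] <= 4%:E)%E by rewrite e1; exact: Lnorm_sup_le.
have bG' z : `|G z| <= 1 * (gaussian (p ^+ 2) z.1 * gaussian (1 ^+ 2) z.2) by rewrite mul1r.
have n2 := @Lnorm_gaussian2_le R P2 G p 1 1 h2 p0 ltr01 ler01 mG bG'.
have n3 := @Lnorm_gaussian2_le R P3 G p 1 1 h3 p0 ltr01 ler01 mG bG'.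
have := bounded_with_real bL sf sG sG nf n2 n3; rewrite !mul1r !mulr1 => hN.
apply: (le_trans (ler_wpM2r (ltW p0) hN)).
have : p `^ (- r2) * p `^ (- r3) = p^-1.
  by rewrite -powRD ?(gt_eqF p0) ?implybT// -opprD r23 powRN powRr1 ?(ltW p0).
rewrite -/r2 -/r3 => pE; rewrite le_eqVlt; apply/orP; left; apply/eqP.
have -> : `|C| * (4 * (pi * p `^ (- r2)) * (pi * p `^ (- r3))) * p =
  `|C| * 4 * pi ^+ 2 * ((p `^ (- r2) * p `^ (- r3)) * p) by ring.
by rewrite pE mulVf ?gt_eqF// mulr1.
Qed.

End with_exponents.

(** After the scaling conditions, the exponents that are not admissible are those with
    [(P2, P3)] equal to [(1, +oo)] or [(+oo, 1)]. *)
Lemma unbounded_not_admissible (P1 P2 P3 : \bar R) (L : trilinear_form R) :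
  (1 <= P1)%E -> (1 <= P2)%E -> (1 <= P3)%E ->
  [\/ L = Lambda1, L = Lambda2 | L = Lambda4 1] ->
  ~ [/\ P1 = +oo%E, (P2^-1 + P3^-1 = 1)%E, (1 < P2 < +oo)%E & (1 < P3 < +oo)%E] ->
  ~ exists C : R, bounded_with P1 P2 P3 C L.
Proof.
move=> h1 h2 h3 hL nadm [C bL].
have [r1 r23] := scaling_exponents h1 h2 h3 bL (scaling_family_H hL).
have e1 := rexp_eq0 h1 r1.
have eT (P : \bar R) : (1 <= P)%E -> [\/ P = 1%E, P = +oo%E | (1 < P < +oo)%E].
  case: P => [p| |//]; last by move=> _; constructor 2.
  rewrite le_eqVlt => /orP[/eqP <-|p1]; first by constructor 1.
  by constructor 3; rewrite p1 ltry.
have E1 (P Q : \bar R) : (1 <= Q)%E -> rexp P + rexp Q = 1 -> P = 1%E -> Q = +oo%E.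
  by move=> Q1 + PE; rewrite PE rexp_EFin ?oner_eq0// invr1 => h; apply: rexp_eq0 => //; lra.
have Eoo (P Q : \bar R) : (1 <= Q)%E -> rexp P + rexp Q = 1 -> P = +oo%E -> Q = 1%E.
  by move=> Q1 + PE; rewrite PE rexp_pinfty => h; apply: rexp_eq1 => //; lra.
have r32 : rexp P3 + rexp P2 = 1 by rewrite addrC.
have U1 : P2 = 1%E -> P3 = +oo%E -> False.
  by move=> e2 e3; apply: (@endpoint_unbounded P1 P2 P3 C L bL true) => //; exact: endpoint_family_GH.
have U2 : P3 = 1%E -> P2 = +oo%E -> False.
  by move=> e3 e2; apply: (@endpoint_unbounded P1 P2 P3 C L bL false) => //; exact: endpoint_family_GH.
case: (eT P2 h2) => [e2|e2|b2].
- exact: U1 e2 (E1 _ _ h3 r23 e2).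
- exact: U2 (Eoo _ _ h3 r23 e2) e2.
case: (eT P3 h3) => [e3|e3|b3].
- exact: U2 e3 (E1 _ _ h2 r32 e3).
- exact: U1 (Eoo _ _ h2 r32 e3) e3.
apply: nadm; split=> //; rewrite !inve_rexp// -EFinD; congr _%:E; exact: r23.
Qed.

Lemma unbounded_every_exponent (P1 P2 P3 : \bar R) (L : trilinear_form R) :
  (1 <= P1)%E -> (1 <= P2)%E -> (1 <= P3)%E ->
  L = Lambda3 \/ L = Lambda4 0 -> ~ exists C : R, bounded_with P1 P2 P3 C L.
Proof.
move=> h1 h2 h3 hL [C bL].
have [r1 r23] := scaling_exponents h1 h2 h3 bL (scaling_family_f hL).
exact: (logarithmic_unbounded h2 h3 bL (rexp_eq0 h1 r1) r23 (logarithmic_family_f hL)).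
Qed.

End necessity.

Theorem theorem1p3 (R : realType) (p1 p2 p3 : \bar R)
    (hp1 : (1 <= p1)%E) (hp2 : (1 <= p2)%E) (hp3 : (1 <= p3)%E) :
  (forall L : trilinear_form R,
      [\/ L = Lambda1, L = Lambda2 | L = Lambda4 1] ->
      let admissible :=
        [/\ p1 = +oo%E, (p2^-1 + p3^-1 = 1)%E,
            (1 < p2 < +oo)%E & (1 < p3 < +oo)%E] in
      (admissible -> exists C : R, bounded_with p1 p2 p3 C L) /\
      (~ admissible -> ~ exists C : R, bounded_with p1 p2 p3 C L)) /\
  (forall L : trilinear_form R,
      L = Lambda3 \/ L = Lambda4 0 ->
      ~ exists C : R, bounded_with p1 p2 p3 C L).
Proof.
split=> [L hL admissible|L hL]; last exact: unbounded_every_exponent.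
split=> [adm|nadm]; first exact: bounded_admissible.
exact: unbounded_not_admissible.
Qed.
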